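(* Let $A\in\mathbb{R}$, $B>0$, let $L\subset\mathbb{R}^2$ be the lattice generated by $(1,0)$ and $(A,B)$, and let $T^2_L=\mathbb{R}^2/L$ with the flat metric induced from $\mathbb{R}^2$. Then $$\mathrm{Det}\,\Delta_{T^2_L}=B^2e^{-\frac{\pi B}{3}}\prod_{n=1}^\infty\left|1-e^{-2\pi n(B-\sqrt{-1}A)}\right|^4.$$
   Context: For a closed Riemannian manifold $\mathbf{M}$ with nonnegative Laplacian $\Delta_{\mathbf{M}}$ on functions, the spectral zeta-function $\zeta_{\mathbf{M}}(s)$ is the meromorphic continuation of the sum of $\lambda^{-s}$ over the non-zero eigenvalues $\lambda$ (with multiplicity); it is holomorphic at $s=0$, and $\mathrm{Det}\,\Delta_{\mathbf{M}}=e^{-\zeta_{\mathbf{M}}'(0)}$. For $T^2_L$ the eigenvalues are $4\pi^2\left(n^2+\frac{(m-nA)^2}{B^2}\right)$, $n,m\in\mathbb{Z}$. *)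

(* Defs.v *)
From Stdlib Require Import Reals List.
From Coquelicot Require Import Coquelicot.
Open Scope R_scope.

Definition Cexp (z : C) : C := (exp (Re z) * cos (Im z), exp (Re z) * sin (Im z)).

(** [a ^ s = exp (s ln a)]; meaningful for [0 < a] only, since [ln] is [0] on
    nonpositive reals. *)
Definition Rpow_C (a : R) (s : C) : C := Cexp (s * RtoC (ln a)).

(** * The flat torus R^2 / L and its Laplacian

    Functions on the torus are L-periodic functions on the plane. *)

Definition lattice (A B : R) (v : R * R) : Prop :=
  exists a b : Z, v = (IZR a * 1 + IZR b * A, IZR a * 0 + IZR b * B).

Definition periodic (L : R * R -> Prop) (f : R * R -> C) : Prop :=
  forall v p : R * R, L v -> f (fst p + fst v, snd p + snd v) = f p.

Definition is_partial_x (f fx : R * R -> C) : Prop :=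
  forall x y : R,
    @is_derive R_AbsRing C_R_NormedModule (fun t : R => f (t, y)) x (fx (x, y)).

Definition is_partial_y (f fy : R * R -> C) : Prop :=
  forall x y : R,
    @is_derive R_AbsRing C_R_NormedModule (fun t : R => f (x, t)) y (fy (x, y)).

Fixpoint class_C (n : nat) (f : R * R -> C) : Prop :=
  match n with
  | O => forall p : R * R,
      @continuous (prod_UniformSpace R_UniformSpace R_UniformSpace) C_UniformSpace f p
  | S m => exists fx fy : R * R -> C,
      is_partial_x f fx /\ is_partial_y f fy /\ class_C m fx /\ class_C m fy
  end.

Definition smooth (f : R * R -> C) : Prop := forall n : nat, class_C n f.

(** The nonnegative Laplacian [- (d^2/dx^2 + d^2/dy^2)] of the flat metric. *)
Definition is_laplacian (f g : R * R -> C) : Prop :=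
  exists fx fy fxx fyy : R * R -> C,
    is_partial_x f fx /\ is_partial_x fx fxx /\
    is_partial_y f fy /\ is_partial_y fy fyy /\
    forall p : R * R, g p = (- (fxx p + fyy p))%C.

Definition eigenspace (L : R * R -> Prop) (mu : R) (f : R * R -> C) : Prop :=
  smooth f /\ periodic L f /\
  is_laplacian f (fun p => (RtoC mu * f p)%C).

(** Complex dimension of a linear space of functions; the basis is indexed by
    [1, ..., n], so that the sums are empty when [n = 0]. *)
Definition is_dimension (E : (R * R -> C) -> Prop) (n : nat) : Prop :=
  exists e : nat -> R * R -> C,
    (forall i : nat, (1 <= i <= n)%nat -> E (e i)) /\
    (forall f : R * R -> C, E f ->
       exists c : nat -> C, forall p : R * R,
         f p = sum_n_m (fun i => (c i * e i p)%C) 1 n) /\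
    (forall c : nat -> C,
       (forall p : R * R, sum_n_m (fun i => (c i * e i p)%C) 1 n = RtoC 0) ->
       forall i : nat, (1 <= i <= n)%nat -> c i = RtoC 0).

(** [lam] lists the eigenvalues with multiplicity: each real [mu] occurs exactly
    [dim (eigenspace mu)] times.  The Laplacian is symmetric, so there are no
    non-real eigenvalues.  No ordering is imposed: the sums below converge
    absolutely. *)
Definition is_spectrum (L : R * R -> Prop) (lam : nat -> R) : Prop :=
  forall mu : R, exists l : list nat,
    NoDup l /\ (forall k : nat, In k l <-> lam k = mu) /\
    is_dimension (eigenspace L mu) (length l).

(** * Spectral zeta-function and determinant *)

Definition holomorphic_at (f : C -> C) (z : C) : Prop :=
  @locally C_UniformSpace z (fun w => @ex_derive C_AbsRing C_NormedModule f w).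

(** Meromorphic on the whole plane: near every [p], a power of [s - p] times [f]
    agrees off [p] with a function holomorphic at [p].  The values of [f] at the
    poles are irrelevant. *)
Definition meromorphic (f : C -> C) : Prop :=
  forall p : C, exists (k : nat) (g : C -> C),
    holomorphic_at g p /\
    @locally' C_UniformSpace p (fun s => ((s - p) ^ k * f s)%C = g s).

Definition zeta_term (lam : nat -> R) (s : C) (k : nat) : C :=
  if Req_EM_T (lam k) 0 then RtoC 0 else Rpow_C (lam k) (- s)%C.

(** The sum is taken on [Re s > 1], half the dimension of the torus, which is its
    half-plane of convergence. *)
Definition is_spectral_zeta (lam : nat -> R) (Z : C -> C) : Prop :=
  meromorphic Z /\
  forall s : C, 1 < Re s ->
    ex_series (fun k => Cmod (zeta_term lam s k)) /\
    @is_series C_AbsRing C_NormedModule (zeta_term lam s) (Z s).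

(** [d = exp (- Z'(0))].  By the identity theorem the continuation [Z] is unique up
    to its values on a discrete set, and it is required to be holomorphic at [0], so
    at most one [d] satisfies this. *)
Definition is_Det_Laplacian (L : R * R -> Prop) (d : C) : Prop :=
  exists (lam : nat -> R) (Z : C -> C) (Z'0 : C),
    is_spectrum L lam /\ is_spectral_zeta lam Z /\
    holomorphic_at Z (RtoC 0) /\
    @is_derive C_AbsRing C_NormedModule Z (RtoC 0) Z'0 /\
    d = Cexp (- Z'0)%C.

(** The product of the [u n] over [n >= 1]. *)
Definition is_inf_prod (u : nat -> R) (P : R) : Prop :=
  is_lim_seq (fun N => prod_f_R0 (fun k => u (S k)) N) (Finite P).

(* Main.v *)
Require Import Defs.
From Stdlib Require Import Reals Lra Lia ZArith List Cantor IndefiniteDescription FinFun FunctionalExtensionality.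
From Coquelicot Require Import Coquelicot.
Open Scope R_scope.

(** The rows of the double series over the eigenvalues are compared with integrals
    by the Euler-Maclaurin formula.  The row [n = 0] is a value of the Riemann zeta
    function at [2s], the integrals of the other rows give [2 B W(s) zeta(2s - 1)]
    with [W(s)] the integral of [(1 + x^2)^(-s)], and integrating by parts often
    enough makes the sum of the remainders holomorphic on any half-plane.  At
    [s = 0] only the derivatives matter: [zeta(0)], [zeta'(0)] and [W'(0) zeta(-1)]
    give [B^2] and [exp (- PI B / 3)], and the remainder of the row [n] contributes
    [ln |1 - q^n|].  This last evaluation comes from the duplication formula
    [1 - q^2 = (1 - q)(1 + q)]: iterated, it writes [ln |1 - q|] as an
    equidistant sum of the logarithm of a sine, with [2^r] nodes over a period,
    whose Euler-Maclaurin remainder tends to that of the row; the same identity as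
    the lattice degenerates yields [zeta'(0)].  The spectrum follows from uniqueness
    of Fourier coefficients, applied in one variable at a time. *)

(** The analytic quantities are built from integrals of powers over unit cells, and one kind of
    estimate serves throughout: a quadratic Taylor bound in the exponent, uniform on a disc, which
    passes to integrals and dominated series and so justifies termwise differentiation without
    Cauchy's theorem. Continuation rests on the fact that the second derivative of
    [(1 + k^2 x^2)^(-s)] is [s k^2] times a combination of the same powers with exponents [s + 1]
    and [s + 2]. The factor [k^2], where [k = 1 / (n B)], offsets the growth of [n^(-2s)] to the
    left. The factor [s] turns a derivative at [0] into the value of a cofactor in which only the
    exponents [1] and [2] occur: what remains of a row is a Bernoulli integral of
    [(x^2 - b^2) / (x^2 + b^2)^2], minus the second derivative of [ln (x^2 + b^2) / 2]. In the same
    way [W(s) = s / (s - 1/2) W(s + 1)] and [W(1) = PI] give [W'(0) = - 2 PI], hence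
    [2 B (- 2 PI) (- 1/12) = PI B / 3]. The powers of [2 PI] cancel between
    [zeta'(0) = - ln (2 PI) / 2] and the common factor [(4 PI^2)^(-s)], because the bracket it
    multiplies equals [2 zeta(0) = - 1] at [0]. *)

(* Equations whose type is a carrier such as [NormedModule.sort R_NormedModule] are not recognised by [ring]. *)
Ltac eqR := match goal with |- @eq _ ?a ?b => change (@eq R a b) end.
Ltac Rring := eqR; ring.

(** * Calculus of complex-valued functions of a real variable *)

Lemma Ceq (x y : C) : Re x = Re y -> Im x = Im y -> x = y.
Proof. destruct x, y; simpl; intros; subst; reflexivity. Qed.

Lemma Re_plus (x y : C) : Re (x + y)%C = Re x + Re y. Proof. reflexivity. Qed.
Lemma Im_plus (x y : C) : Im (x + y)%C = Im x + Im y. Proof. reflexivity. Qed.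
Lemma Re_opp (x : C) : Re (- x)%C = - Re x. Proof. reflexivity. Qed.
Lemma Im_opp (x : C) : Im (- x)%C = - Im x. Proof. reflexivity. Qed.
Lemma Re_minus (x y : C) : Re (x - y)%C = Re x - Re y. Proof. reflexivity. Qed.
Lemma Im_minus (x y : C) : Im (x - y)%C = Im x - Im y. Proof. reflexivity. Qed.
Lemma Re_mult (x y : C) : Re (x * y)%C = Re x * Re y - Im x * Im y. Proof. reflexivity. Qed.
Lemma Im_mult (x y : C) : Im (x * y)%C = Re x * Im y + Im x * Re y. Proof. reflexivity. Qed.
Lemma Re_RtoC (x : R) : Re (RtoC x) = x. Proof. reflexivity. Qed.
Lemma Im_RtoC (x : R) : Im (RtoC x) = 0. Proof. reflexivity. Qed.
Lemma Re_scal (x : R) (y : C) : Re (RtoC x * y)%C = x * Re y.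
Proof. rewrite Re_mult, Re_RtoC, Im_RtoC; ring. Qed.
Lemma Im_scal (x : R) (y : C) : Im (RtoC x * y)%C = x * Im y.
Proof. rewrite Im_mult, Re_RtoC, Im_RtoC; ring. Qed.

Lemma Cmod_Re_Im (z : C) : Cmod z <= Rabs (Re z) + Rabs (Im z).
Proof.
  destruct z as [a b]; unfold Cmod; simpl.
  pose proof (Rabs_pos a); pose proof (Rabs_pos b).
  rewrite <- (sqrt_square (Rabs a + Rabs b)) by lra.
  apply sqrt_le_1_alt.
  pose proof (Rsqr_abs a); pose proof (Rsqr_abs b); unfold Rsqr in *; nra.
Qed.

Lemma im_le_Cmod (c : C) : Rabs (Im c) <= Cmod c.
Proof.
  eapply Rle_trans; [| apply Rmax_Cmod]. apply Rmax_r.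
Qed.

Lemma Cmod_le_2 (z : C) M : Rabs (Re z) <= M -> Rabs (Im z) <= M -> Cmod z <= 2 * M.
Proof. intros; pose proof (Cmod_Re_Im z); lra. Qed.

(** Continuity, derivatives, integrals and series of complex values are all taken componentwise, so
    that real calculus applies to each component. *)
Definition Ccont (f : R -> C) (x : R) : Prop :=
  continuous (fun t => Re (f t)) x /\ continuous (fun t => Im (f t)) x.

Definition Cder (f : R -> C) (x : R) (l : C) : Prop :=
  is_derive (fun t => Re (f t)) x (Re l) /\ is_derive (fun t => Im (f t)) x (Im l).

Lemma Cder_cont f x l : Cder f x l -> Ccont f x.
Proof. intros [h1 h2]; split; apply (ex_derive_continuous (K := R_AbsRing) (V := R_NormedModule)); eexists; eauto. Qed.

Lemma Ccont_const (c : C) x : Ccont (fun _ => c) x.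
Proof. split; apply continuous_const. Qed.

Lemma Ccont_plus f g x : Ccont f x -> Ccont g x -> Ccont (fun t => f t + g t)%C x.
Proof. intros [] []; split; [apply (continuous_plus (fun t => Re (f t)) (fun t => Re (g t)))
 | apply (continuous_plus (fun t => Im (f t)) (fun t => Im (g t)))]; assumption. Qed.

Lemma Ccont_opp f x : Ccont f x -> Ccont (fun t => - f t)%C x.
Proof. intros []; split; [apply (continuous_opp (fun t => Re (f t)))
 | apply (continuous_opp (fun t => Im (f t)))]; assumption. Qed.

Lemma Ccont_mult f g x : Ccont f x -> Ccont g x -> Ccont (fun t => f t * g t)%C x.
Proof.
  intros [a b] [c d]; split; simpl.
  - apply (continuous_minus (fun t => Re (f t) * Re (g t)) (fun t => Im (f t) * Im (g t)));
    apply (continuous_mult (K := R_AbsRing)); assumption.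
  - apply (continuous_plus (fun t => Re (f t) * Im (g t)) (fun t => Im (f t) * Re (g t)));
    apply (continuous_mult (K := R_AbsRing)); assumption.
Qed.

Lemma Ccont_RtoC (f : R -> R) x : continuous f x -> Ccont (fun t => RtoC (f t)) x.
Proof. intros; split; simpl; [assumption | apply continuous_const]. Qed.

Lemma Ccont_ext f g x : (forall t, f t = g t) -> Ccont f x -> Ccont g x.
Proof.
  intros e [a b]; split; [apply (continuous_ext (fun t => Re (f t))) |
  apply (continuous_ext (fun t => Im (f t)))]; auto; intros; now rewrite e.
Qed.

Lemma Ccont_comp (f : R -> C) (g : R -> R) x :
  continuous g x -> Ccont f (g x) -> Ccont (fun t => f (g t)) x.
Proof.
  intros h [a b]; split.
  - apply (continuous_comp g (fun t => Re (f t))); assumption.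
  - apply (continuous_comp g (fun t => Im (f t))); assumption.
Qed.

Lemma Cder_const (c : C) x : Cder (fun _ => c) x 0%C.
Proof. split; simpl; apply (is_derive_const (V := R_NormedModule)). Qed.

Lemma Cder_plus f g x a b : Cder f x a -> Cder g x b -> Cder (fun t => f t + g t)%C x (a + b)%C.
Proof. intros [] []; split; apply (is_derive_plus (V := R_NormedModule)); assumption. Qed.

Lemma Cder_mult f g x a b : Cder f x a -> Cder g x b ->
  Cder (fun t => f t * g t)%C x (a * g x + f x * b)%C.
Proof.
  intros [h1 h2] [h3 h4]; split; simpl.
  - evar_last.
    + apply (is_derive_minus (V := R_NormedModule)); apply Derive.is_derive_mult; eassumption.
    + unfold minus, plus, opp, Re, Im; simpl; Rring.
  - evar_last.
    + apply (is_derive_plus (V := R_NormedModule)); apply Derive.is_derive_mult; eassumption.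
    + unfold plus, Re, Im; simpl; Rring.
Qed.

Lemma Cder_RtoC (f : R -> R) x l : is_derive f x l -> Cder (fun t => RtoC (f t)) x (RtoC l).
Proof. intros; split; simpl; [assumption | apply (is_derive_const (V := R_NormedModule))]. Qed.

Lemma Cder_eq f x a b : Cder f x a -> a = b -> Cder f x b.
Proof. intros; subst; assumption. Qed.

Lemma Cder_ext f g x a : (forall t, f t = g t) -> Cder f x a -> Cder g x a.
Proof.
  intros e [h1 h2]; split; [apply (is_derive_ext (fun t => Re (f t))) |
  apply (is_derive_ext (fun t => Im (f t)))]; auto; intros; now rewrite e.
Qed.

Lemma Cder_comp (f : R -> C) (g : R -> R) x l d :
  Cder f (g x) l -> is_derive g x d -> Cder (fun t => f (g t)) x (RtoC d * l)%C.
Proof.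
  intros [h1 h2] h; split; [rewrite Re_scal | rewrite Im_scal].
  - apply (is_derive_comp (V := R_NormedModule) (fun t => Re (f t)) g); assumption.
  - apply (is_derive_comp (V := R_NormedModule) (fun t => Im (f t)) g); assumption.
Qed.

Definition is_CInt (f : R -> C) (a b : R) (l : C) : Prop :=
  is_RInt (fun t => Re (f t)) a b (Re l) /\ is_RInt (fun t => Im (f t)) a b (Im l).

Definition CInt (f : R -> C) (a b : R) : C :=
  (RInt (fun t => Re (f t)) a b, RInt (fun t => Im (f t)) a b).

Lemma is_CInt_unique f a b l : is_CInt f a b l -> CInt f a b = l.
Proof.
  intros [h1 h2]; apply Ceq; unfold CInt; simpl; apply (is_RInt_unique (V := R_CompleteNormedModule)); assumption.
Qed.

Lemma CInt_correct f a b : (forall t, Rmin a b <= t <= Rmax a b -> Ccont f t) -> is_CInt f a b (CInt f a b).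
Proof.
  intros h; split; simpl; apply (RInt_correct (V := R_CompleteNormedModule));
  apply (ex_RInt_continuous (V := R_CompleteNormedModule)); intros z hz; destruct (h z hz); assumption.
Qed.

Lemma is_CInt_ext f g a b l : (forall t, Rmin a b < t < Rmax a b -> f t = g t) -> is_CInt f a b l -> is_CInt g a b l.
Proof.
  intros e [h1 h2]; split.
  - apply (is_RInt_ext (fun t => Re (f t))); auto. intros; now rewrite e.
  - apply (is_RInt_ext (fun t => Im (f t))); auto. intros; now rewrite e.
Qed.

Lemma CInt_ext f g a b : (forall t, Rmin a b < t < Rmax a b -> f t = g t) -> CInt f a b = CInt g a b.
Proof.
  intros e; unfold CInt; f_equal; apply RInt_ext; intros; now rewrite e.
Qed.

Lemma is_CInt_plus f g a b l m : is_CInt f a b l -> is_CInt g a b m -> is_CInt (fun t => f t + g t)%C a b (l + m)%C.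
Proof. intros [] []; split; apply (is_RInt_plus (V := R_NormedModule)); assumption. Qed.

Lemma is_CInt_Cmult f a b l c : is_CInt f a b l -> is_CInt (fun t => c * f t)%C a b (c * l)%C.
Proof.
  intros [h1 h2]; split; simpl.
  - apply (is_RInt_minus (V := R_NormedModule) (fun t => Re c * Re (f t)) (fun t => Im c * Im (f t)));
    apply (is_RInt_scal (V := R_NormedModule)); assumption.
  - apply (is_RInt_plus (V := R_NormedModule) (fun t => Re c * Im (f t)) (fun t => Im c * Re (f t)));
    apply (is_RInt_scal (V := R_NormedModule)); assumption.
Qed.

Lemma is_CInt_opp f a b l : is_CInt f a b l -> is_CInt (fun t => - f t)%C a b (- l)%C.
Proof. intros []; split; apply (is_RInt_opp (V := R_NormedModule)); assumption. Qed.

(** The components are bounded separately, which costs the factor [2]; it is harmless because only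
    the order of the bounds matters later. *)
Lemma is_CInt_bound f a b l M : a <= b -> (forall t, a <= t <= b -> Cmod (f t) <= M) ->
  is_CInt f a b l -> Cmod l <= 2 * ((b - a) * M).
Proof.
  intros hab h [h1 h2]. apply Cmod_le_2.
  - apply (norm_RInt_le_const (V := R_NormedModule) (fun t => Re (f t)) a b); auto.
    intros; eapply Rle_trans; [apply re_le_Cmod | auto].
  - apply (norm_RInt_le_const (V := R_NormedModule) (fun t => Im (f t)) a b); auto.
    intros; eapply Rle_trans; [apply im_le_Cmod | auto].
Qed.

Lemma is_CInt_der f f' a b :
  (forall t, Rmin a b <= t <= Rmax a b -> Cder f t (f' t)) ->
  (forall t, Rmin a b <= t <= Rmax a b -> Ccont f' t) ->
  is_CInt f' a b (f b - f a)%C.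
Proof.
  intros h c; split.
  - apply (is_RInt_derive (V := R_CompleteNormedModule) (fun t => Re (f t)) (fun t => Re (f' t))).
    intros x hx; apply (h x hx). intros x hx; apply (c x hx).
  - apply (is_RInt_derive (V := R_CompleteNormedModule) (fun t => Im (f t)) (fun t => Im (f' t))).
    intros x hx; apply (h x hx). intros x hx; apply (c x hx).
Qed.

Lemma is_CInt_parts f f' g g' a b :
  (forall t, Rmin a b <= t <= Rmax a b -> Cder f t (f' t)) ->
  (forall t, Rmin a b <= t <= Rmax a b -> Cder g t (g' t)) ->
  (forall t, Rmin a b <= t <= Rmax a b -> Ccont f' t) ->
  (forall t, Rmin a b <= t <= Rmax a b -> Ccont g' t) ->
  (CInt (fun t => f t * g' t) a b = f b * g b - f a * g a - CInt (fun t => f' t * g t) a b)%C.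
Proof.
  intros h1 h2 h3 h4.
  assert (k1 : is_CInt (fun t => f' t * g t + f t * g' t)%C a b (f b * g b - f a * g a)%C).
  { apply (is_CInt_der (fun t => f t * g t)%C); intros t ht.
    - apply Cder_mult; auto.
    - apply Ccont_plus; apply Ccont_mult; auto; eapply Cder_cont; auto. }
  assert (k2 : is_CInt (fun t => f' t * g t)%C a b (CInt (fun t => f' t * g t)%C a b)).
  { apply CInt_correct; intros; apply Ccont_mult; auto; eapply Cder_cont; auto. }
  apply is_CInt_unique.
  eapply is_CInt_ext; [| apply is_CInt_plus; [apply k1 | apply is_CInt_opp, k2]].
  intros; simpl; ring.
Qed.

(** * Series of complex numbers *)

Definition is_Cser (f : nat -> C) (l : C) : Prop :=
  is_series (fun k => Re (f k)) (Re l) /\ is_series (fun k => Im (f k)) (Im l).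

Definition Cser (f : nat -> C) : C := (Series (fun k => Re (f k)), Series (fun k => Im (f k))).

Lemma is_Cser_unique f l : is_Cser f l -> Cser f = l.
Proof. intros [h1 h2]; apply Ceq; unfold Cser; simpl; apply is_series_unique; assumption. Qed.

Lemma Cser_correct f b : (forall k, Cmod (f k) <= b k) -> ex_series b -> is_Cser f (Cser f).
Proof.
  intros h hb; split; simpl; apply Series_correct;
  apply (ex_series_le (V := R_CompleteNormedModule) _ b); auto; intros n.
  - eapply Rle_trans; [apply re_le_Cmod | auto].
  - eapply Rle_trans; [apply im_le_Cmod | auto].
Qed.

Lemma is_Cser_ext f g l : (forall k, f k = g k) -> is_Cser f l -> is_Cser g l.
Proof.
  intros e [h1 h2]; split; [apply (is_series_ext (fun k => Re (f k))) | apply (is_series_ext (fun k => Im (f k)))];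
  auto; intros; now rewrite e.
Qed.

Lemma Cser_ext f g : (forall k, f k = g k) -> Cser f = Cser g.
Proof. intros e; unfold Cser; f_equal; apply Series_ext; intros; now rewrite e. Qed.

Lemma is_Cser_plus f g l m : is_Cser f l -> is_Cser g m -> is_Cser (fun k => f k + g k)%C (l + m)%C.
Proof. intros [] []; split; apply (is_series_plus (V := R_NormedModule)); assumption. Qed.

Lemma is_Cser_Cmult f l c : is_Cser f l -> is_Cser (fun k => c * f k)%C (c * l)%C.
Proof.
  intros [h1 h2]; split; simpl.
  - apply (is_series_minus (V := R_NormedModule) (fun t => Re c * Re (f t)) (fun t => Im c * Im (f t)));
    apply (is_series_scal (V := R_NormedModule)); assumption.
  - apply (is_series_plus (V := R_NormedModule) (fun t => Re c * Im (f t)) (fun t => Im c * Re (f t)));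
    apply (is_series_scal (V := R_NormedModule)); assumption.
Qed.

Lemma is_Cser_opp f l : is_Cser f l -> is_Cser (fun k => - f k)%C (- l)%C.
Proof. intros []; split; apply (is_series_opp (V := R_NormedModule)); assumption. Qed.

Lemma is_series_eq (f : nat -> R) l m : is_series f l -> l = m -> is_series f m.
Proof. intros; subst; assumption. Qed.

Lemma is_Cser_eq f l m : is_Cser f l -> l = m -> is_Cser f m.
Proof. intros; subst; assumption. Qed.

Lemma is_series_abs_le f b l B : (forall k, Rabs (f k) <= b k) -> is_series f l -> is_series b B -> Rabs l <= B.
Proof.
  intros h hf hb.
  assert (e : ex_series (fun k => Rabs (f k))).
  { apply (ex_series_le (V := R_CompleteNormedModule) _ b).
    intros n; unfold norm; simpl; unfold abs; simpl; rewrite Rabs_Rabsolu; apply h.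
    eexists; apply hb. }
  rewrite <- (is_series_unique _ _ hf), <- (is_series_unique _ _ hb).
  eapply Rle_trans; [apply Series_Rabs, e|].
  apply Series_le. intros n; split; [apply Rabs_pos | apply h]. eexists; apply hb.
Qed.

Lemma is_Cser_bound f b l B : (forall k, Cmod (f k) <= b k) -> is_Cser f l -> is_series b B -> Cmod l <= 2 * B.
Proof.
  intros h [h1 h2] hb; apply Cmod_le_2; eapply is_series_abs_le; eauto; simpl; intros k.
  - eapply Rle_trans; [apply re_le_Cmod | auto].
  - eapply Rle_trans; [apply im_le_Cmod | auto].
Qed.

(** * The complex exponential and complex powers *)

Lemma exp_le_compat x y : x <= y -> exp x <= exp y.
Proof. intros [h|h]; [left; apply exp_increasing, h | right; congruence]. Qed.

Lemma Cexp_plus z w : Cexp (z + w)%C = (Cexp z * Cexp w)%C.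
Proof.
  unfold Cexp. rewrite Re_plus, Im_plus, exp_plus, cos_plus, sin_plus.
  apply Ceq; simpl; ring.
Qed.

Lemma Cexp_0 : Cexp 0%C = 1%C.
Proof. unfold Cexp; simpl; rewrite exp_0, cos_0, sin_0; apply Ceq; simpl; ring. Qed.

Lemma Cmod_Cexp z : Cmod (Cexp z) = exp (Re z).
Proof.
  unfold Cexp, Cmod; simpl.
  pose proof (sin2_cos2 (Im z)) as h; unfold Rsqr in h.
  replace (_ + _) with (exp (Re z) * exp (Re z)) by nra.
  apply sqrt_square, Rlt_le, exp_pos.
Qed.

Lemma Cexp_RtoC x : Cexp (RtoC x) = RtoC (exp x).
Proof. unfold Cexp; simpl; rewrite cos_0, sin_0; apply Ceq; simpl; ring. Qed.

Lemma Cder_Cexp (f : R -> C) x l : Cder f x l -> Cder (fun t => Cexp (f t)) x (l * Cexp (f x))%C.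
Proof.
  intros [h1 h2]; split; simpl.
  - evar_last.
    + apply Derive.is_derive_mult.
      apply (is_derive_comp exp (fun t => Re (f t))); [apply is_derive_exp | apply h1].
      apply (is_derive_comp cos (fun t => Im (f t))); [apply is_derive_cos | apply h2].
    + unfold scal; simpl; unfold mult; simpl; unfold Re, Im; simpl; Rring.
  - evar_last.
    + apply Derive.is_derive_mult.
      apply (is_derive_comp exp (fun t => Re (f t))); [apply is_derive_exp | apply h1].
      apply (is_derive_comp sin (fun t => Im (f t))); [apply is_derive_sin | apply h2].
    + unfold scal; simpl; unfold mult; simpl; unfold Re, Im; simpl; Rring.
Qed.

Lemma Ccont_Cexp f x : Ccont f x -> Ccont (fun t => Cexp (f t)) x.
Proof.
  intros [h1 h2]; split; simpl; apply (continuous_mult (K := R_AbsRing)).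
  - apply continuous_exp_comp; assumption.
  - apply continuous_cos_comp; assumption.
  - apply continuous_exp_comp; assumption.
  - apply continuous_sin_comp; assumption.
Qed.

Lemma Cder_linear (z : C) x : Cder (fun t => RtoC t * z)%C x z.
Proof.
  eapply Cder_eq. apply Cder_mult. apply Cder_RtoC, (is_derive_id (K := R_AbsRing)). apply Cder_const.
  simpl; unfold one; simpl; ring.
Qed.

Lemma Ccont_linear (z : C) x : Ccont (fun t => RtoC t * z)%C x.
Proof. eapply Cder_cont, Cder_linear. Qed.

(** [Cexp z - 1] is the integral over [[0, 1]] of [z Cexp (t z)], the derivative along the segment
    from [0] to [z]. *)
Lemma Cexp_sub1_le z : Cmod (Cexp z - 1)%C <= 2 * (Cmod z * exp (Cmod z)).
Proof.
  assert (h : is_CInt (fun t => z * Cexp (RtoC t * z))%C 0 1 (Cexp z - 1)%C).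
  { replace (Cexp z - 1)%C with (Cexp (RtoC 1 * z) - Cexp (RtoC 0 * z))%C.
    apply (is_CInt_der (fun t => Cexp (RtoC t * z))).
    intros; apply Cder_Cexp, Cder_linear.
    intros; apply Ccont_mult. apply Ccont_const. apply Ccont_Cexp, Ccont_linear.
    rewrite Cmult_1_l, Cmult_0_l, Cexp_0; reflexivity. }
  eapply Rle_trans. refine (is_CInt_bound _ 0 1 _ (Cmod z * exp (Cmod z)) _ _ h); [lra|].
  - intros t ht; rewrite Cmod_mult, Cmod_Cexp.
    apply Rmult_le_compat_l; [apply Cmod_ge_0|].
    apply exp_le_compat. rewrite Re_scal. pose proof (re_le_Cmod z); pose proof (Rle_abs (Re z)).
    pose proof (Cmod_ge_0 z). nra.
  - right; ring.
Qed.

(** The same integral representation once more, with the first-order bound applied to the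
    integrand. *)
Lemma Cexp_taylor2 z : Cmod (Cexp z - 1 - z)%C <= 4 * (Cmod z ^ 2 * exp (Cmod z)).
Proof.
  assert (h : is_CInt (fun t => z * (Cexp (RtoC t * z) - 1))%C 0 1 (Cexp z - 1 - z)%C).
  { replace (Cexp z - 1 - z)%C with ((Cexp (RtoC 1 * z) + - (RtoC 1 * z)) - (Cexp (RtoC 0 * z) + - (RtoC 0 * z)))%C.
    apply (is_CInt_der (fun t => Cexp (RtoC t * z) + - (RtoC t * z))%C).
    - intros. eapply Cder_eq. apply Cder_plus. apply Cder_Cexp, Cder_linear.
      apply Cder_ext with (fun t => RtoC t * (- z))%C; [intros; ring | apply Cder_linear]. cbv beta. ring.
    - intros; apply Ccont_mult. apply Ccont_const. apply Ccont_plus; [apply Ccont_Cexp, Ccont_linear | apply Ccont_const].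
    - rewrite Cmult_1_l, Cmult_0_l, Cexp_0; ring. }
  eapply Rle_trans. refine (is_CInt_bound _ 0 1 _ (Cmod z * (2 * (Cmod z * exp (Cmod z)))) _ _ h); [lra|].
  - intros t ht; rewrite Cmod_mult.
    apply Rmult_le_compat_l; [apply Cmod_ge_0|].
    eapply Rle_trans; [apply Cexp_sub1_le|].
    apply Rmult_le_compat_l; [lra|].
    assert (Cmod (RtoC t * z) <= Cmod z).
    { rewrite Cmod_mult, Cmod_R, Rabs_pos_eq by lra. pose proof (Cmod_ge_0 z); nra. }
    apply Rmult_le_compat; auto. apply Cmod_ge_0. left; apply exp_pos. apply exp_le_compat; auto.
  - right; simpl; ring.
Qed.

(** The sign is built in: [pw x s] is [x^(-s)], the only form in which powers occur in Dirichlet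
    series. *)
Definition pw (x : R) (s : C) : C := Rpow_C x (- s)%C.

Lemma pw_exp x s : pw x s = Cexp (- (s * RtoC (ln x)))%C.
Proof. unfold pw, Rpow_C; f_equal; ring. Qed.

Lemma pw_plus x s t : pw x (s + t)%C = (pw x s * pw x t)%C.
Proof. rewrite !pw_exp, <- Cexp_plus; f_equal; ring. Qed.

Lemma pw_0 x : pw x 0%C = 1%C.
Proof. rewrite pw_exp, <- Cexp_0; f_equal; ring. Qed.

Lemma pw_1 x : 0 < x -> pw x 1%C = RtoC (/ x).
Proof.
  intros h. rewrite pw_exp.
  replace (- (1 * RtoC (ln x)))%C with (RtoC (- ln x)) by (apply Ceq; simpl; ring).
  rewrite Cexp_RtoC, exp_Ropp, exp_ln by assumption. reflexivity.
Qed.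

Lemma pw_plus1 x s : 0 < x -> pw x (s + 1)%C = (RtoC (/ x) * pw x s)%C.
Proof. intros; rewrite pw_plus, pw_1 by assumption; ring. Qed.

Lemma pw_mult x y s : 0 < x -> 0 < y -> pw (x * y) s = (pw x s * pw y s)%C.
Proof. intros; rewrite !pw_exp, <- Cexp_plus, ln_mult, RtoC_plus by assumption; f_equal; ring. Qed.

Lemma pw_one s : pw 1 s = 1%C.
Proof. rewrite pw_exp, ln_1, <- Cexp_0; f_equal; ring. Qed.

Lemma Cmod_pw x s : Cmod (pw x s) = exp (- (Re s * ln x)).
Proof. rewrite pw_exp, Cmod_Cexp; f_equal. destruct s; simpl; ring. Qed.

Lemma ln_ge_0 x : 1 <= x -> 0 <= ln x.
Proof.
  intros [h|h]; [| subst; rewrite ln_1; lra]. rewrite <- ln_1; left; apply ln_increasing; lra.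
Qed.

Lemma exp_INR q x : 0 < x -> exp (INR q * ln x) = x ^ q.
Proof. intros. rewrite <- Rpower_pow by assumption. reflexivity. Qed.

Lemma Cmod_pw_le x s q : 1 <= x -> INR q <= Re s -> Cmod (pw x s) <= / x ^ q.
Proof.
  intros hx hs; rewrite Cmod_pw, <- exp_INR, <- exp_Ropp by lra.
  apply exp_le_compat. pose proof (ln_ge_0 x hx). nra.
Qed.

Lemma Cder_pw f x d s : is_derive f x d -> 0 < f x ->
  Cder (fun t => pw (f t) s) x (- s * RtoC d * pw (f x) (s + 1))%C.
Proof.
  intros hf h.
  apply Cder_ext with (fun t => Cexp (RtoC (ln (f t)) * - s)%C).
  { intros t; rewrite pw_exp; f_equal; ring. }
  eapply Cder_eq. apply Cder_Cexp, Cder_mult; [| apply Cder_const].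
  apply Cder_RtoC. apply (is_derive_comp ln f); [apply is_derive_ln, h | apply hf].
  rewrite pw_plus1 by assumption. rewrite pw_exp.
  replace (RtoC (ln (f x)) * - s)%C with (- (s * RtoC (ln (f x))))%C by ring.
  unfold scal; simpl; unfold mult; simpl. rewrite RtoC_mult. ring.
Qed.

Lemma Ccont_pw f x s : continuous f x -> 0 < f x -> Ccont (fun t => pw (f t) s) x.
Proof.
  intros hf h.
  apply Ccont_ext with (fun t => Cexp (- s * RtoC (ln (f t)))%C).
  { intros t; rewrite pw_exp; f_equal; ring. }
  apply Ccont_Cexp, Ccont_mult; [apply Ccont_const | apply Ccont_RtoC].
  apply (continuous_comp f ln); [assumption |].
  apply (ex_derive_continuous (K := R_AbsRing) (V := R_NormedModule)). eexists; apply is_derive_ln, h.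
Qed.

(** * Holomorphy with explicit bounds *)

(** A quantitative form of holomorphy on the disc of radius 1/4 about [p]; the
    constant makes it stable under integrals and series of functions. *)
Definition HB (f f' : C -> C) (p : C) (M : R) : Prop :=
  forall s t : C, Cmod (s - p)%C <= 1/4 -> Cmod (t - p)%C <= 1/4 ->
    Cmod (f s) <= M /\ Cmod (f' s) <= M /\
    Cmod (f t - f s - (t - s) * f' s)%C <= M * Cmod (t - s)%C ^ 2.

Lemma Cmod_self p : Cmod (p - p)%C <= 1/4.
Proof. replace (p - p)%C with (RtoC 0) by ring. rewrite Cmod_0; lra. Qed.

Lemma HB_pos f f' p M : HB f f' p M -> 0 <= M.
Proof.
  intros h. destruct (h p p (Cmod_self p) (Cmod_self p)) as (h1 & _).
  pose proof (Cmod_ge_0 (f p)); lra.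
Qed.

Lemma HB_le f f' p M N : HB f f' p M -> M <= N -> HB f f' p N.
Proof.
  intros h l s t hs ht; destruct (h s t hs ht) as (a & b & c); repeat split; try lra.
  pose proof (pow2_ge_0 (Cmod (t - s))); nra.
Qed.

Lemma HB_ext f f' g g' p M : HB f f' p M ->
  (forall s, Cmod (s - p)%C <= 1/4 -> f s = g s) -> (forall s, Cmod (s - p)%C <= 1/4 -> f' s = g' s) -> HB g g' p M.
Proof.
  intros h e e' s t hs ht. rewrite <- !e, <- !e' by assumption. apply h; assumption.
Qed.

Lemma Cmod_close p s t : Cmod (s - p)%C <= 1/4 -> Cmod (t - p)%C <= 1/4 -> Cmod (t - s)%C <= 1/2.
Proof.
  intros a b. replace (t - s)%C with ((t - p) + - (s - p))%C by ring.
  eapply Rle_trans; [apply Cmod_triangle|]. rewrite Cmod_opp; lra.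
Qed.

Lemma HB_const c p : HB (fun _ => c) (fun _ => 0%C) p (Cmod c).
Proof.
  intros s t _ _. rewrite Cmod_0. repeat split; try lra; try apply Cmod_ge_0.
  replace (c - c - (t - s) * 0)%C with (RtoC 0) by ring. rewrite Cmod_0.
  apply Rmult_le_pos; [apply Cmod_ge_0 | apply pow2_ge_0].
Qed.

Lemma HB_id p : HB (fun s => s) (fun _ => 1%C) p (Cmod p + 1).
Proof.
  intros s t hs _. pose proof (Cmod_ge_0 p). rewrite Cmod_1. repeat split.
  - replace s with ((s - p) + p)%C at 1 by ring. eapply Rle_trans; [apply Cmod_triangle | lra].
  - lra.
  - replace (t - s - (t - s) * 1)%C with (RtoC 0) by ring. rewrite Cmod_0.
    apply Rmult_le_pos; [lra | apply pow2_ge_0].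
Qed.

Lemma HB_plus f f' g g' p M N : HB f f' p M -> HB g g' p N ->
  HB (fun s => f s + g s)%C (fun s => f' s + g' s)%C p (M + N).
Proof.
  intros hf hg s t hs ht. destruct (hf s t hs ht) as (a & b & c), (hg s t hs ht) as (d & e & i).
  repeat split; try (eapply Rle_trans; [apply Cmod_triangle|]; lra).
  replace (f t + g t - (f s + g s) - (t - s) * (f' s + g' s))%C with
    ((f t - f s - (t - s) * f' s) + (g t - g s - (t - s) * g' s))%C by ring.
  eapply Rle_trans; [apply Cmod_triangle|]; lra.
Qed.

(** The increment splits into a Taylor remainder of each factor and a product of increments,
    contributing [1 + 1 + 2] to the constant [4]. The bound [2 N |t - s|] on an increment of [g]
    uses that two points of the disc are at distance at most [1/2]. *)
Lemma HB_mult f f' g g' p M N : HB f f' p M -> HB g g' p N ->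
  HB (fun s => f s * g s)%C (fun s => f' s * g s + f s * g' s)%C p (4 * (M * N)).
Proof.
  intros hf hg s t hs ht. destruct (hf s t hs ht) as (a & b & c), (hg s t hs ht) as (d & e & i).
  destruct (hg t s ht hs) as (d' & _).
  pose proof (HB_pos _ _ _ _ hf) as hM; pose proof (HB_pos _ _ _ _ hg) as hN.
  assert (hMN : 0 <= M * N) by (apply Rmult_le_pos; assumption).
  assert (m1 : forall x y, Cmod x <= M -> Cmod y <= N -> Cmod (x * y)%C <= M * N).
  { intros; rewrite Cmod_mult; apply Rmult_le_compat; auto using Cmod_ge_0. }
  repeat split.
  - eapply Rle_trans; [apply m1; assumption | lra].
  - eapply Rle_trans; [apply Cmod_triangle|].
    pose proof (m1 _ _ b d); pose proof (m1 _ _ a e); lra.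
  - replace (f t * g t - f s * g s - (t - s) * (f' s * g s + f s * g' s))%C with
      ((f t - f s - (t - s) * f' s) * g t + ((t - s) * f' s) * (g t - g s) + f s * (g t - g s - (t - s) * g' s))%C by ring.
    assert (q : Cmod (g t - g s)%C <= 2 * N * Cmod (t - s)%C).
    { replace (g t - g s)%C with ((g t - g s - (t - s) * g' s) + (t - s) * g' s)%C by ring.
      eapply Rle_trans; [apply Cmod_triangle|]. rewrite Cmod_mult.
      pose proof (Cmod_close p s t hs ht). pose proof (Cmod_ge_0 (t - s)).
      assert (Cmod (t - s) * Cmod (g' s) <= Cmod (t - s) * N) by (apply Rmult_le_compat_l; auto).
      assert (N * Cmod (t - s) ^ 2 <= N * Cmod (t - s)) by (apply Rmult_le_compat_l; nra). lra. }
    pose proof (Cmod_ge_0 (t - s)) as h0; set (x := Cmod (t - s)) in *.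
    eapply Rle_trans; [eapply Rle_trans; [apply Cmod_triangle | apply Rplus_le_compat_r, Cmod_triangle]|].
    rewrite !Cmod_mult; fold x.
    assert (q1 : Cmod (f t - f s - (t - s) * f' s) * Cmod (g t) <= (M * x ^ 2) * N)
      by (apply Rmult_le_compat; auto using Cmod_ge_0).
    assert (q2 : x * Cmod (f' s) * Cmod (g t - g s) <= (x * M) * (2 * N * x)).
    { apply Rmult_le_compat; auto using Cmod_ge_0. apply Rmult_le_pos; auto using Cmod_ge_0.
      apply Rmult_le_compat_l; auto. }
    assert (q3 : Cmod (f s) * Cmod (g t - g s - (t - s) * g' s) <= M * (N * x ^ 2))
      by (apply Rmult_le_compat; auto using Cmod_ge_0).
    lra.
Qed.

Lemma HB_Cmult c f f' p M : HB f f' p M -> HB (fun s => c * f s)%C (fun s => c * f' s)%C p (Cmod c * M).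
Proof.
  intros hf s t hs ht. destruct (hf s t hs ht) as (a & b & d). pose proof (Cmod_ge_0 c).
  rewrite !Cmod_mult. repeat split; try (apply Rmult_le_compat_l; assumption).
  replace (c * f t - c * f s - (t - s) * (c * f' s))%C with (c * (f t - f s - (t - s) * f' s))%C by ring.
  rewrite Cmod_mult, Rmult_assoc. apply Rmult_le_compat_l; assumption.
Qed.

Lemma HB_shift c f f' p M : HB f f' (p + c)%C M -> HB (fun s => f (s + c)%C) (fun s => f' (s + c)%C) p M.
Proof.
  intros h s t hs ht. replace (t - s)%C with ((t + c) - (s + c))%C by ring.
  apply h; [replace (s + c - (p + c))%C with (s - p)%C by ring
           |replace (t + c - (p + c))%C with (t - p)%C by ring]; assumption.
Qed.

(** The quadratic remainder is [o(|t - s|)]; the strict inequality leaves room for a neighbourhood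
    of [s] inside the disc. *)
Lemma HB_derive f f' p M s : HB f f' p M -> Cmod (s - p)%C < 1/4 ->
  @is_derive C_AbsRing C_NormedModule f s (f' s).
Proof.
  intros h hs.
  pose proof (HB_pos _ _ _ _ h) as hM.
  split; [apply is_linear_scal_l|].
  intros x hx; apply (is_filter_lim_locally_unique (K := C_AbsRing) (V := AbsRing_NormedModule C_AbsRing)) in hx; subst x. intros eps.
  assert (hd : 0 < Rmin (1/4 - Cmod (s - p)%C) (eps / (M + 1))).
  { apply Rmin_pos; [lra|]. apply Rdiv_lt_0_compat; [apply cond_pos | lra]. }
  exists (mkposreal _ hd). intros t ht. change (Cmod (t - s)%C < Rmin (1/4 - Cmod (s - p)) (eps / (M + 1))) in ht.
  change (Cmod (f t - f s - (t - s) * f' s)%C <= eps * Cmod (t - s)%C).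
  assert (t1 : Cmod (t - p)%C <= 1/4).
  { replace (t - p)%C with ((t - s) + (s - p))%C by ring. eapply Rle_trans; [apply Cmod_triangle|].
    pose proof (Rmin_l (1/4 - Cmod (s - p)%C) (eps / (M + 1))); lra. }
  destruct (h s t) as (_ & _ & k); [lra | assumption|].
  eapply Rle_trans; [apply k|].
  assert (t2 : Cmod (t - s)%C <= eps / (M + 1)).
  { pose proof (Rmin_r (1/4 - Cmod (s - p)%C) (eps / (M + 1))); lra. }
  pose proof (Cmod_ge_0 (t - s)).
  assert (t3 : Cmod (t - s)%C * (M + 1) <= eps).
  { apply (Rmult_le_compat_r (M + 1)) in t2; [|lra]. unfold Rdiv in t2. rewrite Rmult_assoc, Rinv_l in t2; lra. }
  nra.
Qed.

Lemma HB_CInt (f f' : R -> C -> C) p M :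
  (forall t, 0 <= t <= 1 -> HB (f t) (f' t) p M) ->
  (forall s t, 0 <= t <= 1 -> Ccont (fun t => f t s) t) ->
  (forall s t, 0 <= t <= 1 -> Ccont (fun t => f' t s) t) ->
  HB (fun s => CInt (fun t => f t s) 0 1) (fun s => CInt (fun t => f' t s) 0 1) p (2 * M).
Proof.
  intros h c c' s t hs ht.
  assert (i : forall s, is_CInt (fun t => f t s) 0 1 (CInt (fun t => f t s) 0 1)).
  { intros; apply CInt_correct. rewrite Rmin_left, Rmax_right by lra. auto. }
  assert (i' : forall s, is_CInt (fun t => f' t s) 0 1 (CInt (fun t => f' t s) 0 1)).
  { intros; apply CInt_correct. rewrite Rmin_left, Rmax_right by lra. auto. }
  split; [|split].
  - eapply Rle_trans; [refine (is_CInt_bound _ 0 1 _ M _ _ (i s)); [lra|] | lra]. intros x hx; apply (h x hx s t hs ht).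
  - eapply Rle_trans; [refine (is_CInt_bound _ 0 1 _ M _ _ (i' s)); [lra|] | lra]. intros x hx; apply (h x hx s t hs ht).
  - pose proof (is_CInt_plus _ _ _ _ _ _ (is_CInt_plus _ _ _ _ _ _ (i t) (is_CInt_opp _ _ _ _ (i s)))
      (is_CInt_Cmult _ _ _ _ (- (t - s))%C (i' s))) as j.
    match type of j with is_CInt _ _ _ ?l => match goal with |- Cmod ?r <= _ => replace r with l by ring end end.
    eapply Rle_trans; [refine (is_CInt_bound _ 0 1 _ (M * Cmod (t - s)%C ^ 2) _ _ j); [lra|] | lra].
    intros x hx; cbv beta. destruct (h x hx s t hs ht) as (_ & _ & k).
    replace (f x t + - f x s + - (t - s) * f' x s)%C with (f x t - f x s - (t - s) * f' x s)%C by ring. exact k.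
Qed.

(** The three quantities bounded in [HB] are linear in the pair [f, f'], so the bounds add up. The
    derivative obtained is the termwise one, which later allows derivatives of sums at [0] to be
    computed term by term. *)
Lemma HB_Cser (f f' : nat -> C -> C) p b B :
  (forall k, HB (f k) (f' k) p (b k)) -> is_series b B ->
  HB (fun s => Cser (fun k => f k s)) (fun s => Cser (fun k => f' k s)) p (2 * B).
Proof.
  intros h hb s t hs ht.
  assert (eb : ex_series b) by (eexists; apply hb).
  assert (i : forall s, Cmod (s - p)%C <= 1/4 -> is_Cser (fun k => f k s) (Cser (fun k => f k s))).
  { intros u hu; apply Cser_correct with b; auto. intros k; apply (h k u u hu hu). }
  assert (i' : forall s, Cmod (s - p)%C <= 1/4 -> is_Cser (fun k => f' k s) (Cser (fun k => f' k s))).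
  { intros u hu; apply Cser_correct with b; auto. intros k; apply (h k u u hu hu). }
  split; [|split].
  - refine (is_Cser_bound _ b _ _ _ (i s hs) hb). intros k; apply (h k s t hs ht).
  - refine (is_Cser_bound _ b _ _ _ (i' s hs) hb). intros k; apply (h k s t hs ht).
  - pose proof (is_Cser_plus _ _ _ _ (is_Cser_plus _ _ _ _ (i t ht) (is_Cser_opp _ _ (i s hs)))
      (is_Cser_Cmult _ _ (- (t - s))%C (i' s hs))) as j.
    match type of j with is_Cser _ ?l => match goal with |- Cmod ?r <= _ => replace r with l by ring end end.
    rewrite Rmult_assoc. refine (is_Cser_bound _ (fun k => b k * Cmod (t - s)%C ^ 2) _ _ _ j _).
    + intros k; cbv beta. destruct (h k s t hs ht) as (_ & _ & q).
      replace (f k t + - f k s + - (t - s) * f' k s)%C with (f k t - f k s - (t - s) * f' k s)%C by ring. exact q.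
    + apply is_series_scal_r, hb.
Qed.

Lemma ln_le_root x : 1 <= x -> ln x <= 4 * exp (ln x / 4).
Proof. intros; pose proof (ln_ge_0 x H). pose proof (exp_ineq1_le (ln x / 4)). lra. Qed.

(** On the disc [Re s >= q + 1], and the one power of [x] beyond [x^q] absorbs the logarithms
    together with [x^|t - s| <= x^(1/2)]: with [E = x^(1/4)] one has [(ln x)^2 <= 16 E^2] and
    [E^2 E^2 = x]. The constant is [64 = 4 * 16], with the [4] of [Cexp_taylor2]. *)
Lemma HB_pw x q p : 1 <= x -> INR q + 5/4 <= Re p ->
  HB (pw x) (fun s => - RtoC (ln x) * pw x s)%C p (64 / x ^ q).
Proof.
  intros hx hp s t hs ht.
  pose proof (ln_ge_0 x hx) as hL. pose proof (ln_le_root x hx) as hr.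
  set (L := ln x) in *.
  assert (hR : INR q + 1 <= Re s).
  { pose proof (re_le_Cmod (s - p)%C) as r; rewrite Re_minus in r.
    pose proof (Rle_abs (- (Re s - Re p))) as r'; rewrite Rabs_Ropp in r'. lra. }
  set (E := exp (L / 4)) in *.
  assert (hE : x = E ^ 4).
  { unfold E; rewrite <- (exp_ln x) at 1 by lra. fold L.
    replace (exp (L / 4) ^ 4) with (exp (L/4) * exp (L/4) * (exp (L/4) * exp (L/4))) by ring.
    rewrite <- !exp_plus. f_equal. field. }
  assert (hE1 : 1 <= E) by (unfold E; rewrite <- exp_0; apply exp_le_compat; lra).
  assert (hq : 0 < x ^ q) by (apply pow_lt; lra).
  assert (hpw : Cmod (pw x s) * x <= / x ^ q).
  { assert (h : Cmod (pw x s) <= / x ^ (S q)) by (apply Cmod_pw_le; [assumption | rewrite S_INR; assumption]).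
    simpl in h. rewrite Rinv_mult in h. apply (Rmult_le_compat_r x) in h; [|lra].
    replace (/ x * / x ^ q * x) with (/ x ^ q) in h by (field; split; lra). exact h. }
  pose proof (Cmod_ge_0 (pw x s)) as h0. set (P := Cmod (pw x s)) in *.
  assert (hP : P <= / x ^ q) by nra.
  unfold Rdiv. split; [|split].
  - fold P. pose proof (Rinv_0_lt_compat _ hq); lra.
  - rewrite Cmod_mult, Cmod_opp, Cmod_R, Rabs_pos_eq by assumption. fold L; fold P.
    assert (E <= x) by (rewrite hE; pose proof (pow_R1_Rle E 3 hE1); simpl in *; nra).
    assert (L * P <= 4 * (P * x)) by nra. lra.
  - fold L. set (d := (t - s)%C).
    replace (pw x t - pw x s - d * (- RtoC L * pw x s))%C
      with (pw x s * (Cexp (- (d * RtoC L)) - 1 - - (d * RtoC L)))%C.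
    2:{ replace (pw x t) with (pw x s * Cexp (- (d * RtoC L)))%C. ring.
        replace t with (s + d)%C by (unfold d; ring). rewrite pw_plus, (pw_exp x d). reflexivity. }
    rewrite Cmod_mult; fold P.
    eapply Rle_trans; [apply Rmult_le_compat_l; [assumption | apply Cexp_taylor2]|].
    rewrite Cmod_opp, Cmod_mult, Cmod_R, Rabs_pos_eq by assumption.
    pose proof (Cmod_close p s t hs ht) as hd; fold d in hd.
    pose proof (Cmod_ge_0 d). set (D := Cmod d) in *.
    assert (hx2 : exp (D * L) <= E * E).
    { unfold E; rewrite <- exp_plus. apply exp_le_compat. nra. }
    assert (hL2 : L * L <= 16 * (E * E)) by nra.
    assert (hxE : x = (E * E) * (E * E)) by (rewrite hE; ring).
    assert (k1 : (L * L) * exp (D * L) <= (16 * (E * E)) * (E * E)).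
    { apply Rmult_le_compat; try nra. left; apply exp_pos. }
    replace (P * (4 * ((D * L) ^ 2 * exp (D * L)))) with (4 * D ^ 2 * (P * ((L * L) * exp (D * L)))) by ring.
    replace (64 * / x ^ q * D ^ 2) with (4 * D ^ 2 * (16 * / x ^ q)) by ring.
    apply Rmult_le_compat_l; [pose proof (pow2_ge_0 D); lra|].
    eapply Rle_trans; [apply Rmult_le_compat_l; [assumption | apply k1]|]. nra.
Qed.

(** * Integrals of powers over unit cells *)

Definition cell (P : R -> R) (h : R -> R) (s : C) : C := CInt (fun t => RtoC (P t) * pw (h t) s)%C 0 1.

Definition dcell (P : R -> R) (h : R -> R) (s : C) : C :=
  CInt (fun t => RtoC (P t) * (- RtoC (ln (h t)) * pw (h t) s))%C 0 1.

Section Cells.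
Variables (P : R -> R) (K : R) (h : nat -> R -> R) (q : nat) (b : nat -> R).
Hypothesis hPc : forall t, 0 <= t <= 1 -> continuous P t.
Hypothesis hPb : forall t, 0 <= t <= 1 -> Rabs (P t) <= K.
Hypothesis hhc : forall k t, 0 <= t <= 1 -> continuous (h k) t.
Hypothesis hh1 : forall k t, 0 <= t <= 1 -> 1 <= h k t.
Hypothesis hhb : forall k t, 0 <= t <= 1 -> / h k t ^ q <= b k.

Lemma weight_bound_nonneg : 0 <= K.
Proof. pose proof (hPb 0 ltac:(lra)); pose proof (Rabs_pos (P 0)); lra. Qed.

Lemma cell_cont k s t : 0 <= t <= 1 -> Ccont (fun t => RtoC (P t) * pw (h k t) s)%C t.
Proof.
  intros ht. apply Ccont_mult. apply Ccont_RtoC; auto. apply Ccont_pw; auto.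
  pose proof (hh1 k t ht); lra.
Qed.

Lemma cell_is k s : is_CInt (fun t => RtoC (P t) * pw (h k t) s)%C 0 1 (cell P (h k) s).
Proof. apply CInt_correct. rewrite Rmin_left, Rmax_right by lra. intros; apply cell_cont; assumption. Qed.

Lemma cell_bound k s : INR q <= Re s -> Cmod (cell P (h k) s) <= 2 * K * b k.
Proof.
  intros hs. eapply Rle_trans; [refine (is_CInt_bound _ 0 1 _ (K * b k) _ _ (cell_is k s)); [lra|] | lra].
  intros t ht. rewrite Cmod_mult, Cmod_R. apply Rmult_le_compat; auto using Rabs_pos, Cmod_ge_0.
  eapply Rle_trans; [apply Cmod_pw_le with (q := q); auto | auto].
Qed.

Lemma cells_is s : ex_series b -> INR q <= Re s -> is_Cser (fun k => cell P (h k) s) (Cser (fun k => cell P (h k) s)).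
Proof.
  intros hb hs; apply Cser_correct with (fun k => 2 * K * b k).
  - intros; apply cell_bound, hs.
  - apply (ex_series_scal (K := R_AbsRing) (V := R_NormedModule) (2 * K) b hb).
Qed.

(** The constant is [256 = 2 * 2 * 64]: a factor [2] from the integral over a cell, another from the
    series, and the [64] of [HB_pw]. *)
Lemma HB_cells p Bd : is_series b Bd -> INR q + 5/4 <= Re p ->
  HB (fun s => Cser (fun k => cell P (h k) s)) (fun s => Cser (fun k => dcell P (h k) s)) p (256 * K * Bd).
Proof.
  intros hb hp.
  apply HB_le with (2 * ((2 * K * 64) * Bd)); [| lra].
  apply HB_Cser with (fun k => (2 * K * 64) * b k).
  - intros k. apply HB_le with (2 * (K * (64 * b k))); [|lra].
    apply (HB_CInt (fun t s => RtoC (P t) * pw (h k t) s)%C (fun t s => RtoC (P t) * (- RtoC (ln (h k t)) * pw (h k t) s))%C).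
    + intros t ht. pose proof weight_bound_nonneg.
      apply HB_le with (Cmod (RtoC (P t)) * (64 / h k t ^ q)).
      * apply HB_Cmult. apply HB_pw; auto.
      * rewrite Cmod_R. apply Rmult_le_compat; auto using Rabs_pos.
        apply Rmult_le_pos; [lra|]. left; apply Rinv_0_lt_compat, pow_lt. pose proof (hh1 k t ht); lra.
        unfold Rdiv. apply Rmult_le_compat_l; [lra | auto].
    + intros; apply cell_cont; assumption.
    + intros s t ht. apply Ccont_mult. apply Ccont_RtoC; auto.
      apply Ccont_mult; [apply Ccont_opp, Ccont_RtoC | apply Ccont_pw; auto; pose proof (hh1 k t ht); lra].
      apply (continuous_comp (h k) ln); auto.
      apply (ex_derive_continuous (K := R_AbsRing) (V := R_NormedModule)). eexists; apply is_derive_ln.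
      pose proof (hh1 k t ht); lra.
  - apply (is_series_scal (K := R_AbsRing) (V := R_NormedModule) (2 * K * 64) b Bd hb).
Qed.
End Cells.

(** * Bernoulli polynomials and integration by parts *)

(* The Bernoulli polynomial [B_p] divided by [p!]. *)
Fixpoint bern (p : nat) : R -> R :=
  match p with
  | O => fun _ => 1
  | S p => fun t => RInt (bern p) 0 t - RInt (fun u => RInt (bern p) 0 u) 0 1
  end.

Lemma is_derive_RInt_cont (f : R -> R) t : (forall x, continuous f x) -> is_derive (fun t => RInt f 0 t) t (f t).
Proof.
  intros h. apply (is_derive_RInt (V := R_NormedModule) f (fun t => RInt f 0 t) 0).
  - exists (mkposreal 1 Rlt_0_1); intros y _. apply (RInt_correct (V := R_CompleteNormedModule)).
    apply (ex_RInt_continuous (V := R_CompleteNormedModule)); auto.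
  - apply h.
Qed.

Lemma bern_cont_der p : (forall t, continuous (bern p) t) /\ (forall t, is_derive (bern (S p)) t (bern p t)).
Proof.
  induction p as [|p [IH1 IH2]].
  - assert (h : forall t, continuous (bern 0) t) by (intros; apply continuous_const).
    split; auto. intros t. simpl bern. evar_last.
    apply (is_derive_minus (V := R_NormedModule)); [apply is_derive_RInt_cont, h | apply (is_derive_const (V := R_NormedModule))].
    unfold minus, plus, opp, zero; simpl; Rring.
  - assert (h : forall t, continuous (bern (S p)) t).
    { intros; apply (ex_derive_continuous (K := R_AbsRing) (V := R_NormedModule)); eexists; apply IH2. }
    split; auto. intros t. change (bern (S (S p))) with (fun t => RInt (bern (S p)) 0 t - RInt (fun u => RInt (bern (S p)) 0 u) 0 1).
    evar_last.
    apply (is_derive_minus (V := R_NormedModule)); [apply is_derive_RInt_cont, h | apply (is_derive_const (V := R_NormedModule))].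
    unfold minus, plus, opp, zero; simpl; Rring.
Qed.

Lemma bern_cont p t : continuous (bern p) t. Proof. apply bern_cont_der. Qed.
Lemma bern_der p t : is_derive (bern (S p)) t (bern p t). Proof. apply bern_cont_der. Qed.

Lemma ex_RInt_cont (f : R -> R) a b : (forall x, continuous f x) -> ex_RInt f a b.
Proof. intros; apply (ex_RInt_continuous (V := R_CompleteNormedModule)); auto. Qed.

Lemma bern_prim_cont p t : continuous (fun u => RInt (bern p) 0 u) t.
Proof.
  apply (ex_derive_continuous (K := R_AbsRing) (V := R_NormedModule)).
  eexists; apply is_derive_RInt_cont, bern_cont.
Qed.

Lemma bern_mean p : RInt (bern (S p)) 0 1 = 0.
Proof.
  change (bern (S p)) with (fun t => RInt (bern p) 0 t - RInt (fun u => RInt (bern p) 0 u) 0 1).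
  assert (h := RInt_minus (V := R_CompleteNormedModule) (fun t => RInt (bern p) 0 t)
     (fun _ => RInt (fun u => RInt (bern p) 0 u) 0 1) 0 1).
  unfold minus, plus, opp in h; simpl in h. unfold Rminus. rewrite h.
  - rewrite RInt_const. unfold scal; simpl; unfold mult; simpl. ring.
  - apply ex_RInt_cont, bern_prim_cont.
  - apply ex_RInt_const.
Qed.

(** The difference of the end values is the mean of [bern (S p)], which vanishes; the index starts
    at [2] because [bern 0] has mean [1]. Equal end values are what makes the boundary terms of
    neighbouring cells telescope. *)
Lemma bern_01 p : bern (S (S p)) 1 = bern (S (S p)) 0.
Proof.
  assert (h := is_RInt_derive (V := R_CompleteNormedModule) (bern (S (S p))) (bern (S p)) 0 1
     (fun t _ => bern_der _ t) (fun t _ => bern_cont _ t)).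
  apply is_RInt_unique in h. rewrite bern_mean in h. unfold minus, plus, opp in h; simpl in h.
  change (0 = bern (S (S p)) 1 + - bern (S (S p)) 0) in h. lra.
Qed.

(** Each step at most doubles the bound, since an antiderivative from [0] and its mean are both
    controlled by the previous bound. *)
Lemma bern_bound p t : 0 <= t <= 1 -> Rabs (bern p t) <= 2 ^ p.
Proof.
  revert t; induction p as [|p IH]; intros t ht.
  - simpl; rewrite Rabs_R1; lra.
  - assert (h : forall u, 0 <= u <= 1 -> Rabs (RInt (bern p) 0 u) <= 2 ^ p).
    { intros u hu. eapply Rle_trans; [apply abs_RInt_le_const with (M := 2 ^ p); try lra|].
      apply ex_RInt_cont, bern_cont. intros; apply IH; lra.
      assert (0 < 2 ^ p) by (apply pow_lt; lra). nra. }
    change (bern (S p) t) with (RInt (bern p) 0 t - RInt (fun u => RInt (bern p) 0 u) 0 1).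
    unfold Rminus. eapply Rle_trans; [apply Rabs_triang|]. rewrite Rabs_Ropp.
    pose proof (h t ht).
    assert (Rabs (RInt (fun u => RInt (bern p) 0 u) 0 1) <= (1 - 0) * 2 ^ p).
    { apply abs_RInt_le_const; [lra | apply ex_RInt_cont, bern_prim_cont | intros; apply h; lra]. }
    simpl; lra.
Qed.

Lemma bern_1 t : bern 1 t = t - 1/2.
Proof.
  simpl. rewrite RInt_const. unfold scal; simpl; unfold mult; simpl.
  rewrite (RInt_ext (fun u => RInt (fun _ => 1) 0 u) (fun u => u)).
  2:{ intros; rewrite RInt_const; unfold scal; simpl; unfold mult; simpl. Rring. }
  replace (RInt (fun u => u) 0 1) with (1/2). lra.
  symmetry; apply is_RInt_unique. evar_last.
  apply (is_RInt_derive (V := R_CompleteNormedModule) (fun u => u ^ 2 / 2) (fun u => u)).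
  - intros; auto_derive; auto; field.
  - intros; apply continuous_id.
  - unfold minus, plus, opp; simpl; eqR; field.
Qed.

Lemma bern_2 t : bern 2 t = t ^ 2 / 2 - t / 2 + 1/12.
Proof.
  change (bern 2 t) with (RInt (bern 1) 0 t - RInt (fun u => RInt (bern 1) 0 u) 0 1).
  assert (h : forall u, RInt (bern 1) 0 u = u ^ 2 / 2 - u / 2).
  { intros u; apply is_RInt_unique. evar_last.
    apply (is_RInt_derive (V := R_CompleteNormedModule) (fun u => u ^ 2 / 2 - u / 2) (bern 1)).
    - intros; rewrite bern_1; auto_derive; auto; field.
    - intros; apply bern_cont.
    - unfold minus, plus, opp; simpl; eqR; field. }
  rewrite h, (RInt_ext _ (fun u => u ^ 2 / 2 - u / 2)) by (intros; apply h).
  replace (RInt (fun u => u ^ 2 / 2 - u / 2) 0 1) with (- (1/12)). lra.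
  symmetry; apply is_RInt_unique. evar_last.
  apply (is_RInt_derive (V := R_CompleteNormedModule) (fun u => u ^ 3 / 6 - u ^ 2 / 4) (fun u => u ^ 2 / 2 - u / 2)).
  - intros; auto_derive; auto; field.
  - intros; apply (ex_derive_continuous (K := R_AbsRing) (V := R_NormedModule)); auto_derive; auto.
  - unfold minus, plus, opp; simpl; eqR; field.
Qed.

(** [CI 0] is the integral over a cell; for larger [p] these are, up to sign, the successive
    Euler-Maclaurin remainders. *)
Definition CI (p : nat) (phi : R -> C) : C := CInt (fun t => RtoC (bern p t) * phi t)%C 0 1.

Lemma CI_parts p phi phi' :
  (forall t, 0 <= t <= 1 -> Cder phi t (phi' t)) -> (forall t, 0 <= t <= 1 -> Ccont phi' t) ->
  (CI (S p) phi' = RtoC (bern (S p) 1) * phi 1 - RtoC (bern (S p) 0) * phi 0 - CI p phi)%C.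
Proof.
  intros h c. unfold CI.
  apply (is_CInt_parts (fun t => RtoC (bern (S p) t)) (fun t => RtoC (bern p t)));
  rewrite Rmin_left, Rmax_right by lra; auto; intros.
  - apply Cder_RtoC, bern_der.
  - apply Ccont_RtoC, bern_cont.
Qed.

Lemma CI_lin p phi psi a b : (forall t, 0 <= t <= 1 -> Ccont phi t) -> (forall t, 0 <= t <= 1 -> Ccont psi t) ->
  CI p (fun t => a * phi t + b * psi t)%C = (a * CI p phi + b * CI p psi)%C.
Proof.
  intros h1 h2; unfold CI. apply is_CInt_unique.
  eapply is_CInt_ext; [|apply is_CInt_plus; apply is_CInt_Cmult; apply CInt_correct;
    rewrite Rmin_left, Rmax_right by lra; intros; apply Ccont_mult; auto; apply Ccont_RtoC, bern_cont].
  intros; simpl; ring.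
Qed.

Lemma CI_ext p phi psi : (forall t, 0 <= t <= 1 -> phi t = psi t) -> CI p phi = CI p psi.
Proof.
  intros e; apply CInt_ext. rewrite Rmin_left, Rmax_right by lra. intros; rewrite e by lra; reflexivity.
Qed.

(** * Telescoping series *)

Lemma sum_n_tel (u : nat -> R) n : sum_n (fun k => u (S k) - u k) n = u (S n) - u 0%nat.
Proof.
  induction n as [|n IH]; [rewrite sum_O; reflexivity|].
  rewrite sum_Sn, IH; unfold plus; simpl; ring.
Qed.

Lemma is_series_tel (u : nat -> R) (l : R) : is_lim_seq u l -> is_series (fun k => u (S k) - u k) (l - u 0%nat).
Proof.
  intros h. change (is_lim_seq (sum_n (fun k => u (S k) - u k)) (l - u 0%nat)).
  apply is_lim_seq_ext with (fun n => u (S n) - u 0%nat).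
  - intros; symmetry; apply sum_n_tel.
  - apply is_lim_seq_minus'; [apply (is_lim_seq_incr_1 u), h | apply is_lim_seq_const].
Qed.

Lemma lim_0_le (u v : nat -> R) : (forall n, Rabs (u n) <= v n) -> is_lim_seq v 0 -> is_lim_seq u 0.
Proof.
  intros h hv. apply is_lim_seq_abs_0.
  apply is_lim_seq_le_le with (fun _ => 0) v; auto.
  - intros; split; [apply Rabs_pos | apply h].
  - apply is_lim_seq_const.
Qed.

Lemma lim_Re (u : nat -> C) : is_lim_seq (fun n => Cmod (u n)) 0 -> is_lim_seq (fun n => Re (u n)) 0.
Proof. intros; eapply lim_0_le; [intros; apply re_le_Cmod | assumption]. Qed.

Lemma lim_Im (u : nat -> C) : is_lim_seq (fun n => Cmod (u n)) 0 -> is_lim_seq (fun n => Im (u n)) 0.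
Proof. intros; eapply lim_0_le; [intros; apply im_le_Cmod | assumption]. Qed.

Lemma is_Cser_tel (u : nat -> C) : is_lim_seq (fun n => Cmod (u n)) 0 ->
  is_Cser (fun k => u (S k) - u k)%C (- u 0%nat)%C.
Proof.
  intros h; split.
  - apply is_series_eq with (0 - Re (u 0%nat)); [apply (is_series_tel (fun k => Re (u k))), lim_Re, h | rewrite Re_opp; Rring].
  - apply is_series_eq with (0 - Im (u 0%nat)); [apply (is_series_tel (fun k => Im (u k))), lim_Im, h | rewrite Im_opp; Rring].
Qed.

Lemma lim_inv_S C : is_lim_seq (fun n => C / (INR n + 1)) 0.
Proof.
  replace (Finite 0) with (Rbar_mult C 0) by (simpl; f_equal; ring).
  apply (is_lim_seq_scal_l (fun n => / (INR n + 1))).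
  apply is_lim_seq_ext with (fun n => / INR (S n)). intros; rewrite S_INR; reflexivity.
  apply (is_lim_seq_incr_1 (fun n => / INR n)).
  replace (Finite 0) with (Rbar_inv p_infty) by reflexivity.
  apply is_lim_seq_inv; [apply is_lim_seq_INR | discriminate].
Qed.

(** * The Riemann zeta function *)

Definition hJ (k : nat) (t : R) : R := INR k + 1 + t.

(** The cells are [[k + 1, k + 2]]: this is the integral of [x^(-s)] over [[1, oo)] against the
    periodised [bern p]. *)
Definition J (p : nat) (s : C) : C := Cser (fun k => cell (bern p) (hJ k) s).

Lemma hJ_cont k t : continuous (hJ k) t.
Proof. apply (ex_derive_continuous (K := R_AbsRing) (V := R_NormedModule)); unfold hJ; auto_derive; auto. Qed.

Lemma hJ_ge k t : 0 <= t -> INR k + 1 <= hJ k t /\ 1 <= hJ k t.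
Proof. intros; unfold hJ; pose proof (pos_INR k); lra. Qed.

Lemma hJ_inv k t : 0 <= t <= 1 -> / hJ k t ^ 2 <= / (INR k + 1) ^ 2.
Proof.
  intros. pose proof (pos_INR k). destruct (hJ_ge k t); [lra|]. apply Rinv_le_contravar; [apply pow_lt; lra|].
  apply pow_incr; lra.
Qed.

Lemma is_series_le_tel (b : nat -> R) (u : nat -> R) : (forall k, 0 <= b k <= u k - u (S k)) -> is_lim_seq u 0 -> ex_series b.
Proof.
  intros h hu. apply (ex_series_le (V := R_CompleteNormedModule) _ (fun k => u k - u (S k))).
  - intros n; unfold norm; simpl; unfold abs; simpl. rewrite Rabs_pos_eq; apply h.
  - exists (- (0 - u 0%nat)).
    apply (is_series_ext (fun k => opp (u (S k) - u k))). { intros; unfold opp; simpl; ring. }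
    apply (is_series_opp (V := R_NormedModule)). apply is_series_tel, hu.
Qed.

Lemma ex_series_inv2 : ex_series (fun k => / (INR k + 1) ^ 2).
Proof.
  apply (is_series_le_tel _ (fun k => 2 / (INR k + 1))); [| apply lim_inv_S].
  intros k; pose proof (pos_INR k). rewrite S_INR. split.
  - left; apply Rinv_0_lt_compat, pow_lt; lra.
  - replace (2 / (INR k + 1) - 2 / (INR k + 1 + 1)) with (/ (INR k + 1) ^ 2 * (2 * (INR k + 1) / (INR k + 2))) by (field; lra).
    rewrite <- (Rmult_1_r (/ _)) at 1. apply Rmult_le_compat_l. left; apply Rinv_0_lt_compat, pow_lt; lra.
    apply Rmult_le_reg_r with (INR k + 2); [lra|]. unfold Rdiv. rewrite (Rmult_assoc (2 * _)), Rinv_l; lra.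
Qed.

Lemma J_is p s : 2 <= Re s -> is_Cser (fun k => cell (bern p) (hJ k) s) (J p s).
Proof.
  intros hs. apply (cells_is (bern p) (2 ^ p) hJ 2 (fun k => / (INR k + 1) ^ 2)); auto.
  - intros; apply bern_cont.
  - intros; apply bern_bound; assumption.
  - intros; apply hJ_cont.
  - intros; apply hJ_ge; lra.
  - intros; apply hJ_inv; lra.
  - apply ex_series_inv2.
Qed.

(** [13/4 = 2 + 5/4]: the exponent [2] of the dominating series plus the margin required by
    [HB_pw]. *)
Lemma HB_J p s0 : 13/4 <= Re s0 -> exists f' M, HB (J p) f' s0 M.
Proof.
  intros hs. destruct ex_series_inv2 as [Bd hB].
  eexists; eexists; apply (HB_cells (bern p) (2 ^ p) hJ 2 (fun k => / (INR k + 1) ^ 2)); auto.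
  - intros; apply bern_cont.
  - intros; apply bern_bound; assumption.
  - intros; apply hJ_cont.
  - intros; apply hJ_ge; lra.
  - intros; apply hJ_inv; lra.
  - apply hB.
  - simpl; lra.
Qed.

Lemma Cder_pw_hJ k s t : 0 <= t -> Cder (fun t => pw (hJ k t) s) t (- s * pw (hJ k t) (s + 1))%C.
Proof.
  intros ht. eapply Cder_eq. apply Cder_pw with (d := 1).
  - unfold hJ; auto_derive; auto; ring.
  - destruct (hJ_ge k t); lra.
  - ring.
Qed.

Lemma Ccont_pw_hJ k s t : 0 <= t -> Ccont (fun t => pw (hJ k t) s) t.
Proof. intros; eapply Cder_cont, Cder_pw_hJ; assumption. Qed.

Lemma cell_parts_hJ p k s :
  (- s * cell (bern (S p)) (hJ k) (s + 1) =
   RtoC (bern (S p) 1) * pw (INR k + 2) s - RtoC (bern (S p) 0) * pw (INR k + 1) s - cell (bern p) (hJ k) s)%C.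
Proof.
  assert (h := CI_parts p (fun t => pw (hJ k t) s) (fun t => - s * pw (hJ k t) (s + 1))%C).
  replace (INR k + 2) with (hJ k 1) by (unfold hJ; ring).
  replace (INR k + 1) with (hJ k 0) by (unfold hJ; ring).
  change (cell (bern p) (hJ k) s) with (CI p (fun t => pw (hJ k t) s)). rewrite <- h.
  - change (cell (bern (S p)) (hJ k) (s + 1)) with (CI (S p) (fun t => pw (hJ k t) (s + 1))).
    (* A second term with coefficient zero, so that the two-term linearity [CI_lin] serves for a
       single scalar. *)
    transitivity (CI (S p) (fun t => - s * pw (hJ k t) (s + 1) + 0 * pw (hJ k t) (s + 1)))%C.
    + rewrite CI_lin by (intros; apply Ccont_pw_hJ; lra). ring.
    + apply CI_ext; intros; ring.
  - intros; apply Cder_pw_hJ; lra.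
  - intros; apply Ccont_mult; [apply Ccont_const | apply Ccont_pw_hJ; lra].
Qed.

Lemma lim_pw_nat s : 0 < Re s -> is_lim_seq (fun n => Cmod (pw (INR n + 1) s)) 0.
Proof.
  intros hs.
  apply is_lim_seq_ext with (fun n => exp (- (Re s * ln (INR n + 1)))).
  { intros; rewrite Cmod_pw; reflexivity. }
  apply (is_lim_comp_seq exp (fun n => - (Re s * ln (INR n + 1))) m_infty 0).
  - apply is_lim_exp_m.
  - exists 0%nat; discriminate.
  - replace m_infty with (Rbar_opp p_infty) by reflexivity. apply is_lim_seq_opp.
    replace (Rbar_opp (Rbar_opp p_infty)) with p_infty by reflexivity.
    apply is_lim_seq_ext with (fun n => Re s * ln (INR (S n))).
    { intros; rewrite S_INR; ring. }
    evar_last. apply is_lim_seq_scal_l.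
    apply (is_lim_comp_seq ln (fun n => INR (S n)) p_infty p_infty).
    + apply is_lim_ln_p.
    + exists 0%nat; discriminate.
    + apply (is_lim_seq_incr_1 INR), is_lim_seq_INR.
    + simpl. destruct (Rle_dec 0 (Re s)) as [r|r]; [|lra]. destruct (Rle_lt_or_eq_dec 0 (Re s) r); [reflexivity | lra].
Qed.

Lemma is_Cser_tel_pw s : 0 < Re s -> is_Cser (fun k => pw (INR k + 2) s - pw (INR k + 1) s)%C (- (1))%C.
Proof.
  intros hs. pose proof (is_Cser_tel _ (lim_pw_nat s hs)) as h.
  eapply is_Cser_ext; [| eapply is_Cser_eq; [apply h|]].
  - intros k; cbv beta. rewrite S_INR. do 2 f_equal; ring.
  - cbv beta. replace (INR 0 + 1) with 1 by (simpl; ring). now rewrite pw_one.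
Qed.

(** Integration by parts on every cell: equal end values of [bern (S (S p))] let the boundary terms
    telescope, and only the one at [x = 1] is left. *)
Lemma J_step p s : 2 <= Re s -> (J (S p) s = - RtoC (bern (S (S p)) 0) + s * J (S (S p)) (s + 1))%C.
Proof.
  intros hs.
  assert (h1 := is_Cser_plus _ _ _ _ (is_Cser_Cmult _ _ (RtoC (bern (S (S p)) 0)) (is_Cser_tel_pw s ltac:(lra)))
     (is_Cser_Cmult _ _ s (J_is (S (S p)) (s + 1)%C ltac:(rewrite Re_plus; simpl; lra)))).
  replace (- RtoC (bern (S (S p)) 0) + s * J (S (S p)) (s + 1))%C with (RtoC (bern (S (S p)) 0) * - (1) + s * J (S (S p)) (s + 1))%C by ring.
  apply is_Cser_unique. eapply is_Cser_ext; [| apply h1].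
  intros k; cbv beta. pose proof (cell_parts_hJ (S p) k s) as e. rewrite bern_01 in e.
  set (X := cell (bern (S p)) (hJ k) s) in *.
  set (Y := cell (bern (S (S p))) (hJ k) (s + 1)) in *.
  replace (s * Y)%C with (- (- s * Y))%C by ring. rewrite e. ring.
Qed.

(** The values [1/2] and [- 1/2] of [bern 1] at the ends produce a trapezoidal sum; half of a
    telescoping series turns it into the plain sum and leaves the term [1/2]. The term [1 / (s - 1)]
    is the integral of [x^(-s)] over [[1, oo)], telescoped cell by cell. *)
Lemma zeta_is_Cser s : 1 < Re s ->
  is_Cser (fun k => pw (INR k + 1) s) (1 / (s - 1) + 1/2 - s * J 1 (s + 1))%C.
Proof.
  intros hs.
  assert (hs1 : (s - 1)%C <> 0%C).
  { intros e. apply (f_equal Re) in e. rewrite Re_minus in e. simpl in e. lra. }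
  assert (h1 := is_Cser_plus _ _ _ _ (is_Cser_plus _ _ _ _
     (is_Cser_Cmult _ _ (- (1/2))%C (is_Cser_tel_pw s ltac:(lra)))
     (is_Cser_Cmult _ _ (- / (s - 1))%C (is_Cser_tel_pw (s - 1)%C ltac:(rewrite Re_minus; simpl; lra))))
     (is_Cser_Cmult _ _ (- s)%C (J_is 1 (s + 1)%C ltac:(rewrite Re_plus; simpl; lra)))).
  eapply is_Cser_ext; [| eapply is_Cser_eq; [apply h1|]].
  - intros k; cbv beta. rewrite (cell_parts_hJ 0 k s).
    rewrite !bern_1. replace (1 - 1/2) with (1/2) by field. replace (0 - 1/2) with (- (1/2)) by field.
    assert (e0 : cell (bern 0) (hJ k) s = (- / (s - 1) * (pw (INR k + 2) (s - 1) - pw (INR k + 1) (s - 1)))%C).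
    { replace (INR k + 2) with (hJ k 1) by (unfold hJ; ring).
      replace (INR k + 1) with (hJ k 0) by (unfold hJ; ring).
      apply is_CInt_unique. eapply is_CInt_ext; [| apply is_CInt_Cmult, (is_CInt_der (fun t => pw (hJ k t) (s - 1)))].
      2:{ rewrite Rmin_left, Rmax_right by lra. intros; apply Cder_pw_hJ; lra. }
      - intros; cbv beta. replace (s - 1 + 1)%C with s by ring. simpl bern. field; assumption.
      - rewrite Rmin_left, Rmax_right by lra. intros; apply Ccont_mult; [apply Ccont_const | apply Ccont_pw_hJ; lra]. }
    rewrite e0, RtoC_opp, RtoC_div by lra. field; assumption.
  - field; assumption.
Qed.

(* [N] integrations by parts continue [J p] to [Re s > 2 - N]. *)
Fixpoint Jext (N p : nat) (s : C) : C :=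
  match N with
  | O => J p s
  | S N => (- RtoC (bern (S p) 0) + s * Jext N (S p) (s + 1))%C
  end.

(** The index is at least [1]: a step from [bern 0] would meet the unequal end values of
    [bern 1]. *)
Lemma Jext_S N : forall p s, 2 - INR N <= Re s -> Jext N (S p) s = Jext (S N) (S p) s.
Proof.
  induction N as [|N IH]; intros p s hs.
  - simpl in *. apply J_step; lra.
  - rewrite S_INR in hs. change (Jext (S N) (S p) s) with (- RtoC (bern (S (S p)) 0) + s * Jext N (S (S p)) (s + 1))%C.
    rewrite IH by (rewrite Re_plus; simpl; lra). reflexivity.
Qed.

Lemma HB_Jext N : forall p s0, 13/4 - INR N <= Re s0 -> exists f' M, HB (Jext N p) f' s0 M.
Proof.
  induction N as [|N IH]; intros p s0 hs.
  - apply HB_J. simpl in hs; lra.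
  - rewrite S_INR in hs. destruct (IH (S p) (s0 + 1)%C) as (f' & M & h); [rewrite Re_plus; simpl; lra|].
    eexists; eexists. simpl Jext. apply HB_plus; [apply HB_const | apply HB_mult; [apply HB_id|]].
    apply (HB_shift 1%C _ _ _ _ h).
Qed.

(* The Riemann zeta function on [Re s > 1 - N]. *)
Definition zeta (N : nat) (s : C) : C := (1 / (s - 1) + 1/2 - s * Jext N 1 (s + 1))%C.

Lemma zeta_S N s : 1 - INR N <= Re s -> zeta N s = zeta (S N) s.
Proof. intros; unfold zeta. rewrite Jext_S; [reflexivity | rewrite Re_plus; simpl; lra]. Qed.

(** * Rows of the Epstein zeta function *)

(* The row [n] of the lattice sum has terms [n^(-2s) G(k, m - nA)^(-s)] with [k = 1 / (nB)]. *)
Definition G (k x : R) : R := 1 + k ^ 2 * x ^ 2.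

Definition fp (k : R) (s : C) (x : R) : C := pw (G k x) s.

Definition fp1 (k : R) (s : C) (x : R) : C := (- 2 * s * RtoC (k ^ 2) * (RtoC x * fp k (s + 1) x))%C.

(** The second derivative of [G^(-s)], freed of [x] by means of [k^2 x^2 = G k x - 1], so that the
    family of powers is closed under two integrations by parts. *)
Definition fp2 (k : R) (s : C) (x : R) : C :=
  (2 * s * RtoC (k ^ 2) * (2 * s + 1) * fp k (s + 1) x + - (2 * s * RtoC (k ^ 2) * (2 * (s + 1))) * fp k (s + 2) x)%C.

Lemma G_ge1 k x : 1 <= G k x.
Proof. unfold G. pose proof (pow2_ge_0 k); pose proof (pow2_ge_0 x). nra. Qed.

Lemma G_pos k x : 0 < G k x.
Proof. pose proof (G_ge1 k x); lra. Qed.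

Lemma G_der k x : is_derive (G k) x (2 * k ^ 2 * x).
Proof. unfold G; auto_derive; auto; ring. Qed.

Lemma Cder_fp k s x : Cder (fp k s) x (fp1 k s x).
Proof.
  eapply Cder_eq. apply Cder_pw; [apply G_der | apply G_pos].
  unfold fp1, fp. rewrite !RtoC_mult. ring.
Qed.

Lemma Ccont_fp k s x : Ccont (fp k s) x. Proof. eapply Cder_cont, Cder_fp. Qed.

Lemma fp_S k s x : (RtoC (G k x) * fp k (s + 1) x)%C = fp k s x.
Proof.
  unfold fp. rewrite pw_plus1 by apply G_pos.
  rewrite Cmult_assoc, <- RtoC_mult, Rinv_r by (pose proof (G_pos k x); lra). ring.
Qed.

Lemma Cder_fp1 k s x : Cder (fp1 k s) x (fp2 k s x).
Proof.
  eapply Cder_eq. unfold fp1 at 1. apply Cder_mult. apply Cder_const.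
  apply Cder_mult. apply Cder_RtoC, (is_derive_id (K := R_AbsRing)). apply Cder_fp.
  unfold fp2, fp1. change (@one R_AbsRing) with 1.
  rewrite <- (fp_S k (s + 1) x). replace (s + 1 + 1)%C with (s + 2)%C by ring.
  unfold G. rewrite !RtoC_plus, !RtoC_mult, !RtoC_pow. ring.
Qed.

Lemma Ccont_fp1 k s x : Ccont (fp1 k s) x. Proof. eapply Cder_cont, Cder_fp1. Qed.

Lemma Ccont_fp2 k s x : Ccont (fp2 k s) x.
Proof. apply Ccont_plus; apply Ccont_mult; try apply Ccont_const; apply Ccont_fp. Qed.

(* Summed over [j], the integral over the line of [phi x] against the periodised [bern p (x + a)]; the cells [j] and [-1 - j] are paired. *)
Definition termZ (p : nat) (phi : R -> C) (a : R) (j : nat) : C :=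
  (CI p (fun t => phi (INR j - a + t)%R) + CI p (fun t => phi (- 1 - INR j - a + t)%R))%C.

Lemma Cder_shift f x y l : Cder f (y + x) l -> Cder (fun t => f (y + t)) x l.
Proof.
  intros. eapply Cder_eq. apply (Cder_comp f (fun t => y + t)); [eassumption|].
  auto_derive; auto. ring.
Qed.

Lemma Ccont_shift f x y : Ccont f (y + x) -> Ccont (fun t => f (y + t)) x.
Proof.
  intros. apply (Ccont_comp f (fun t => y + t)); auto.
  apply (ex_derive_continuous (K := R_AbsRing) (V := R_NormedModule)); auto_derive; auto.
Qed.

Lemma termZ_parts p phi phi' a j : (forall x, Cder phi x (phi' x)) -> (forall x, Ccont phi' x) ->
  (termZ (S p) phi' a j =
   RtoC (bern (S p) 1) * (phi (INR (S j) - a)%R + phi (- INR j - a)%R) -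
   RtoC (bern (S p) 0) * (phi (INR j - a)%R + phi (- INR (S j) - a)%R) - termZ p phi a j)%C.
Proof.
  intros h c. unfold termZ.
  rewrite (CI_parts p (fun t => phi (INR j - a + t)%R) (fun t => phi' (INR j - a + t)%R)).
  rewrite (CI_parts p (fun t => phi (- 1 - INR j - a + t)%R) (fun t => phi' (- 1 - INR j - a + t)%R)).
  - rewrite S_INR. replace (INR j + 1 - a) with (INR j - a + 1) by ring.
    replace (- (INR j + 1) - a) with (- 1 - INR j - a + 0) by ring.
    replace (- INR j - a) with (- 1 - INR j - a + 1) by ring.
    replace (INR j - a + 0) with (INR j - a) by ring. ring.
  - intros; apply Cder_shift, h.
  - intros; apply Ccont_shift, c.
  - intros; apply Cder_shift, h.
  - intros; apply Ccont_shift, c.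
Qed.

Lemma termZ_lin p phi psi a x y j : (forall t, Ccont phi t) -> (forall t, Ccont psi t) ->
  termZ p (fun t => x * phi t + y * psi t)%C a j = (x * termZ p phi a j + y * termZ p psi a j)%C.
Proof.
  intros h1 h2; unfold termZ.
  rewrite (CI_lin p (fun t => phi (INR j - a + t)%R) (fun t => psi (INR j - a + t)%R))
    by (intros; apply Ccont_shift; auto).
  rewrite (CI_lin p (fun t => phi (- 1 - INR j - a + t)%R) (fun t => psi (- 1 - INR j - a + t)%R))
    by (intros; apply Ccont_shift; auto).
  ring.
Qed.

Definition vanish (phi : R -> C) (a : R) : Prop :=
  is_lim_seq (fun j => Cmod (phi (INR j - a)%R)) 0 /\ is_lim_seq (fun j => Cmod (phi (- INR j - a)%R)) 0.

(** The boundary terms telescope in both directions; the two inner ends both sit at [x = - a] and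
    cancel, and the outer ones tend to zero by [vanish]. *)
Lemma termZ_step p phi phi' a l : (forall x, Cder phi x (phi' x)) -> (forall x, Ccont phi' x) -> vanish phi a ->
  is_Cser (termZ (S (S p)) phi' a) l -> is_Cser (termZ (S p) phi a) (- l)%C.
Proof.
  intros h c [v1 v2] hl.
  assert (h1 := is_Cser_plus _ _ _ _ (is_Cser_Cmult _ _ (RtoC (bern (S (S p)) 0)) (is_Cser_plus _ _ _ _ (is_Cser_tel _ v1)
    (is_Cser_opp _ _ (is_Cser_tel _ v2)))) (is_Cser_opp _ _ hl)).
  eapply is_Cser_ext; [| eapply is_Cser_eq; [apply h1|]].
  - intros j; cbv beta. rewrite (termZ_parts (S p) phi phi' a j) by assumption. rewrite bern_01. ring.
  - cbv beta. simpl INR. replace (-0) with 0 by ring. ring.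
Qed.

(** From [(1 - k |x|)^2 >= 0]; the summand [|a| + 1] is absorbed because [G >= 1]. *)
Lemma lin_le_G k a : 0 < k -> exists D, forall x, Rabs x + Rabs a + 1 <= D * G k x.
Proof.
  intros hk. exists (/ (2 * k) + Rabs a + 1). intros x.
  assert (h1 : Rabs x <= / (2 * k) * G k x).
  { unfold G. rewrite <- (pow2_abs x). set (y := Rabs x).
    apply Rmult_le_reg_l with (2 * k); [lra|]. rewrite <- Rmult_assoc, Rinv_r by lra.
    pose proof (pow2_ge_0 (1 - k * y)). nra. }
  pose proof (G_ge1 k x). pose proof (Rabs_pos a). nra.
Qed.

(** With [|a|] in the denominator one bound serves both points: [|x| + |a| >= n] at [x = n - a] and
    at [x = - n - a]. *)
Lemma vanish_le phi a C : (forall x, Cmod (phi x) <= C / (Rabs x + Rabs a + 1)) -> vanish phi a.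
Proof.
  intros h.
  assert (hC : 0 <= C).
  { pose proof (h 0) as h0. pose proof (Cmod_ge_0 (phi 0)). rewrite Rabs_R0 in h0. pose proof (Rabs_pos a).
    apply Rmult_le_reg_r with (/ (0 + Rabs a + 1)); [apply Rinv_0_lt_compat; lra|]. unfold Rdiv in h0. lra. }
  assert (k : forall (n : nat) x, INR n <= Rabs x + Rabs a -> Rabs (Cmod (phi x)) <= C / (INR n + 1)).
  { intros n x hx. rewrite Rabs_pos_eq by apply Cmod_ge_0. eapply Rle_trans; [apply h|].
    apply Rmult_le_compat_l; [assumption|]. pose proof (pos_INR n). apply Rinv_le_contravar; lra. }
  split; (eapply lim_0_le; [| apply (lim_inv_S C)]); intros n; apply k.
  - replace (INR n) with ((INR n - a) + a) at 1 by ring. pose proof (Rabs_triang (INR n - a) a). pose proof (Rle_abs (INR n - a + a)). lra.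
  - pose proof (Rabs_triang (- INR n - a) a) as t. replace (- INR n - a + a) with (- INR n) in t by ring.
    rewrite Rabs_Ropp in t. pose proof (Rle_abs (INR n)). lra.
Qed.

Lemma Cmod_fp_le k s x : 1 <= Re s -> Cmod (fp k s x) <= / G k x.
Proof.
  intros hs. replace (/ G k x) with (/ G k x ^ 1) by (simpl; f_equal; ring).
  apply Cmod_pw_le; [apply G_ge1 | simpl; assumption].
Qed.

Lemma inv_G_le k a : 0 < k -> exists D, 0 <= D /\ forall x, / G k x <= D / (Rabs x + Rabs a + 1).
Proof.
  intros hk. destruct (lin_le_G k a hk) as [D hD]. exists D. split.
  - pose proof (hD 0). pose proof (Rabs_pos 0); pose proof (Rabs_pos a). pose proof (G_ge1 k 0). nra.
  - intros x. pose proof (hD x). pose proof (G_pos k x). pose proof (Rabs_pos x); pose proof (Rabs_pos a).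
    apply Rmult_le_reg_r with (G k x); [assumption|]. rewrite Rinv_l by lra.
    apply Rmult_le_reg_r with (Rabs x + Rabs a + 1); [lra|].
    unfold Rdiv. replace (D * / (Rabs x + Rabs a + 1) * G k x * (Rabs x + Rabs a + 1)) with (D * G k x) by (field; lra). lra.
Qed.

Lemma vanish_fp k s a : 0 < k -> 1 <= Re s -> vanish (fp k s) a.
Proof.
  intros hk hs. destruct (inv_G_le k a hk) as (D & hD0 & hD). apply vanish_le with D.
  intros x; eapply Rle_trans; [apply Cmod_fp_le, hs | apply hD].
Qed.

(** The derivative decays like [G^(-2)] times [x]: one power of [G] absorbs the factor [x], the
    other gives the decay. *)
Lemma vanish_fp1 k s a : 0 < k -> 1 <= Re s -> vanish (fp1 k s) a.
Proof.
  intros hk hs. destruct (inv_G_le k a hk) as (D & hD0 & hD). destruct (lin_le_G k a hk) as [D' hD'].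
  set (Q := Cmod (- 2 * s * RtoC (k ^ 2))). assert (hQ : 0 <= Q) by apply Cmod_ge_0.
  apply vanish_le with (Q * D' * D).
  intros x. unfold fp1. rewrite Cmod_mult. fold Q. rewrite Cmod_mult, Cmod_R.
  pose proof (G_pos k x) as hG. pose proof (Rabs_pos x); pose proof (Rabs_pos a).
  assert (h1 : Cmod (fp k (s + 1) x) <= / G k x * / G k x).
  { unfold fp. rewrite pw_plus1, Cmod_mult, Cmod_R, Rabs_pos_eq by (try assumption; left; apply Rinv_0_lt_compat, hG).
    apply Rmult_le_compat_l; [left; apply Rinv_0_lt_compat, hG | apply Cmod_fp_le, hs]. }
  assert (h2 : Rabs x * Cmod (fp k (s + 1) x) <= D' * / G k x).
  { eapply Rle_trans; [apply Rmult_le_compat_l; [apply Rabs_pos | apply h1]|].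
    rewrite <- Rmult_assoc. apply Rmult_le_compat_r; [left; apply Rinv_0_lt_compat, hG|].
    apply Rmult_le_reg_r with (G k x); [assumption|]. rewrite Rmult_assoc, Rinv_l by lra. pose proof (hD' x). lra. }
  assert (hD'0 : 0 <= D') by (pose proof (hD' x); nra).
  unfold Rdiv. rewrite !Rmult_assoc. apply Rmult_le_compat_l; [assumption|].
  eapply Rle_trans; [apply h2|]. apply Rmult_le_compat_l; [assumption | apply hD].
Qed.

Definition hp (k a : R) (j : nat) (t : R) : R := G k (INR j - a + t).
Definition hm (k a : R) (j : nat) (t : R) : R := G k (- 1 - INR j - a + t).

(** Two one-sided series instead of the paired [termZ], so that the results on cells apply to each.
    [tau 0] is the integral of [(1 + k^2 x^2)^(-s)] over the whole line. *)
Definition tau (p : nat) (k a : R) (s : C) : C :=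
  (Cser (fun j => cell (bern p) (hp k a j) s) + Cser (fun j => cell (bern p) (hm k a j) s))%C.

(* The increment of [atan (k x)] over a unit cell dominates [1 / G] there, with a constant that makes the sum over the cells telescope. *)
Definition bq (k y : R) : R := (2 + 2 * k ^ 2) / k * (atan (k * (y + 1)) - atan (k * y)).

(** By the mean value theorem the increment of [atan (k x)] is [k / G k xi], and [|xi - x| <= 1]
    gives [G k xi <= (2 + 2 k^2) G k x]. *)
Lemma inv_G_atan k y x : 0 < k -> y <= x <= y + 1 -> / G k x ^ 1 <= bq k y.
Proof.
  intros hk hx. unfold bq.
  destruct (MVT_gen (fun u => atan (k * u)) y (y + 1) (fun u => k / G k u)) as (xi & h1 & h2).
  - intros u _. auto_derive; auto. unfold G. unfold Rsqr. field; pose proof (pow2_ge_0 (k * u)); repeat split; nra.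
  - intros u _. apply continuity_pt_filterlim.
    apply (ex_derive_continuous (K := R_AbsRing) (V := R_NormedModule) (fun u => atan (k * u))); auto_derive; auto.
  - rewrite Rmin_left, Rmax_right in h1 by lra. rewrite h2. replace (y + 1 - y) with 1 by ring.
    pose proof (G_pos k x); pose proof (G_pos k xi).
    rewrite pow_1. apply Rmult_le_reg_r with (G k x * G k xi); [apply Rmult_lt_0_compat; assumption|].
    replace (/ G k x * (G k x * G k xi)) with (G k xi) by (field; lra).
    replace ((2 + 2 * k ^ 2) / k * (k / G k xi * 1) * (G k x * G k xi)) with ((2 + 2 * k ^ 2) * G k x) by (field; lra).
    assert (xi ^ 2 <= 2 * x ^ 2 + 2).
    { assert ((xi - x) ^ 2 <= 1) by nra. pose proof (pow2_ge_0 (xi - 2 * x)). nra. } unfold G. pose proof (pow2_ge_0 k). pose proof (pow2_ge_0 x). nra.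
Qed.

Lemma lim_atan_lin k c : 0 < k -> is_lim_seq (fun j => atan (k * (INR j + c))) (PI / 2).
Proof.
  intros hk.
  assert (h : is_lim_seq (fun j => k * (INR j + c)) p_infty).
  { evar_last. apply is_lim_seq_scal_l. apply is_lim_seq_plus with p_infty c. apply is_lim_seq_INR.
    apply is_lim_seq_const. reflexivity.
    simpl. destruct (Rle_dec 0 k) as [r|r]; [|lra]. destruct (Rle_lt_or_eq_dec 0 k r); [reflexivity | lra]. }
  apply is_lim_seq_ext_loc with (fun j => PI / 2 - atan (/ (k * (INR j + c)))).
  - destruct (proj2 (is_lim_seq_spec _ _) h 0) as [n hn]. exists n; intros m hm.
    rewrite atan_inv by (apply hn, hm). ring.
  - replace (PI / 2) with (PI / 2 - atan 0) at 1 by (rewrite atan_0; ring).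
    apply is_lim_seq_minus'; [apply is_lim_seq_const|].
    apply is_lim_seq_continuous.
    + apply continuity_pt_filterlim, (ex_derive_continuous (K := R_AbsRing) (V := R_NormedModule)). auto_derive; auto.
    + replace (Finite 0) with (Rbar_inv p_infty) by reflexivity. apply is_lim_seq_inv; [assumption | discriminate].
Qed.

Lemma bq_series_p k a : 0 < k -> is_series (fun j => bq k (INR j - a)) ((2 + 2 * k ^ 2) / k * (PI / 2 + atan (k * a))).
Proof.
  intros hk. apply (is_series_scal (K := R_AbsRing) (V := R_NormedModule)).
  apply is_series_ext with (fun j => (fun j => atan (k * (INR j + - a))) (S j) - (fun j => atan (k * (INR j + - a))) j).
  - intros j. cbv beta. rewrite S_INR.
    replace (k * (INR j + 1 + - a)) with (k * (INR j - a + 1)) by ring.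
    replace (k * (INR j + - a)) with (k * (INR j - a)) by ring. reflexivity.
  - apply is_series_eq with (PI / 2 - atan (k * (INR 0 + - a))); [apply (is_series_tel (fun j => atan (k * (INR j + - a)))), lim_atan_lin, hk|].
    simpl. replace (k * (0 + - a)) with (- (k * a)) by ring. rewrite atan_opp. Rring.
Qed.

Lemma bq_series_m k a : 0 < k -> is_series (fun j => bq k (- 1 - INR j - a)) ((2 + 2 * k ^ 2) / k * (PI / 2 - atan (k * a))).
Proof.
  intros hk. apply (is_series_scal (K := R_AbsRing) (V := R_NormedModule)).
  apply is_series_ext with (fun j => (fun j => atan (k * (INR j + a))) (S j) - (fun j => atan (k * (INR j + a))) j).
  - intros j. cbv beta. rewrite S_INR.
    replace (k * (- 1 - INR j - a + 1)) with (- (k * (INR j + a))) by ring.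
    replace (k * (- 1 - INR j - a)) with (- (k * (INR j + 1 + a))) by ring. rewrite !atan_opp. Rring.
  - apply is_series_eq with (PI / 2 - atan (k * (INR 0 + a))); [apply (is_series_tel (fun j => atan (k * (INR j + a)))), lim_atan_lin, hk|].
    simpl. replace (k * (0 + a)) with (k * a) by ring. Rring.
Qed.

Lemma tau_is p k a s : 0 < k -> 1 <= Re s -> is_Cser (termZ p (fp k s) a) (tau p k a s).
Proof.
  intros hk hs. apply is_Cser_plus.
  - apply (cells_is (bern p) (2 ^ p) (hp k a) 1 (fun j => bq k (INR j - a))).
    + intros; apply bern_cont.
    + intros; apply bern_bound; assumption.
    + intros; unfold hp, G; apply (ex_derive_continuous (K := R_AbsRing) (V := R_NormedModule)); auto_derive; auto.
    + intros; apply G_ge1.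
    + intros; apply inv_G_atan; [assumption | lra].
    + eexists; apply bq_series_p, hk.
    + simpl; assumption.
  - apply (cells_is (bern p) (2 ^ p) (hm k a) 1 (fun j => bq k (- 1 - INR j - a))).
    + intros; apply bern_cont.
    + intros; apply bern_bound; assumption.
    + intros; unfold hm, G; apply (ex_derive_continuous (K := R_AbsRing) (V := R_NormedModule)); auto_derive; auto.
    + intros; apply G_ge1.
    + intros; apply inv_G_atan; [assumption | lra].
    + eexists; apply bq_series_m, hk.
    + simpl; assumption.
Qed.

(** The two one-sided totals add up to a multiple of [PI], the full variation of [atan]. Hence the
    bound does not involve the shift [a], which is essential because the shifts [n A] are unbounded
    over the rows. *)
Lemma HB_tau p k a s0 : 0 < k -> 9/4 <= Re s0 ->
  exists f', HB (tau p k a) f' s0 (256 * 2 ^ p * ((2 + 2 * k ^ 2) / k * PI)).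
Proof.
  intros hk hs. eexists.
  replace (256 * 2 ^ p * ((2 + 2 * k ^ 2) / k * PI)) with
   (256 * 2 ^ p * ((2 + 2 * k ^ 2) / k * (PI / 2 + atan (k * a))) + 256 * 2 ^ p * ((2 + 2 * k ^ 2) / k * (PI / 2 - atan (k * a)))) by (field; lra).
  unfold tau; apply HB_plus.
  - apply (HB_cells (bern p) (2 ^ p) (hp k a) 1 (fun j => bq k (INR j - a))).
    + intros; apply bern_cont.
    + intros; apply bern_bound; assumption.
    + intros; unfold hp, G; apply (ex_derive_continuous (K := R_AbsRing) (V := R_NormedModule)); auto_derive; auto.
    + intros; apply G_ge1.
    + intros; apply inv_G_atan; [assumption | lra].
    + apply bq_series_p, hk.
    + simpl; lra.
  - apply (HB_cells (bern p) (2 ^ p) (hm k a) 1 (fun j => bq k (- 1 - INR j - a))).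
    + intros; apply bern_cont.
    + intros; apply bern_bound; assumption.
    + intros; unfold hm, G; apply (ex_derive_continuous (K := R_AbsRing) (V := R_NormedModule)); auto_derive; auto.
    + intros; apply G_ge1.
    + intros; apply inv_G_atan; [assumption | lra].
    + apply bq_series_m, hk.
    + simpl; lra.
Qed.

(* [fp2] is the second derivative of [fp], so two integrations by parts turn [tau p] into [tau_up] of [tau (p + 2)]; the factor [k ^ 2] is what makes the sum over the rows converge after continuation. *)
Definition tau_up (F : C -> C) (k : R) (s : C) : C :=
  (2 * s * RtoC (k ^ 2) * (2 * s + 1) * F (s + 1) + - (2 * s * RtoC (k ^ 2) * (2 * (s + 1))) * F (s + 2))%C.

Lemma fp2_is p k a s : 0 < k -> 0 <= Re s -> is_Cser (termZ p (fp2 k s) a) (tau_up (tau p k a) k s).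
Proof.
  intros hk hs. unfold fp2, tau_up.
  eapply is_Cser_ext; [| apply is_Cser_plus; apply is_Cser_Cmult; apply tau_is; auto].
  - intros j; cbv beta. rewrite termZ_lin; [reflexivity | apply Ccont_fp | apply Ccont_fp].
  - rewrite Re_plus; simpl; lra.
  - rewrite Re_plus; simpl; lra.
Qed.

Lemma fp1_is p k a s : 0 < k -> 1 <= Re s ->
  is_Cser (termZ (S p) (fp1 k s) a) (- tau_up (tau (S (S p)) k a) k s)%C.
Proof.
  intros hk hs. eapply termZ_step; [apply Cder_fp1 | apply Ccont_fp2 | apply vanish_fp1; assumption | apply fp2_is; lra].
Qed.

(** Two integrations by parts, from [fp] through [fp1] to [fp2]. As for [J], the index has to be at
    least [1]. *)
Lemma tau_step p k a s : 0 < k -> 1 <= Re s -> tau (S p) k a s = tau_up (tau (S (S (S p))) k a) k s.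
Proof.
  intros hk hs. pose proof (is_Cser_unique _ _ (tau_is (S p) k a s hk hs)) as <-.
  apply is_Cser_unique.
  eapply is_Cser_eq. eapply termZ_step; [apply Cder_fp | apply Ccont_fp1 | apply vanish_fp; assumption | apply fp1_is; assumption].
  ring.
Qed.

(** At index [0] the unequal end values of [bern 1] do not telescope but produce the trapezoidal
    sums of the row: integral plus remainder. *)
Lemma row_trapezoid k a s : 0 < k -> 1 <= Re s ->
  is_Cser (fun j => 1/2 * (fp k s (INR j - a) + fp k s (INR (S j) - a) + fp k s (- INR j - a) + fp k s (- INR (S j) - a)))%C
    (tau 0 k a s - tau_up (tau 2 k a) k s)%C.
Proof.
  intros hk hs.
  eapply is_Cser_ext; [| apply (is_Cser_plus _ _ _ _ (tau_is 0 k a s hk hs) (fp1_is 0 k a s hk hs))].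
  intros j; cbv beta. rewrite (termZ_parts 0 (fp k s) (fp1 k s)); [| apply Cder_fp | apply Ccont_fp1].
  rewrite !bern_1. replace (1 - 1/2) with (1/2) by field. replace (0 - 1/2) with (- (1/2)) by field.
  rewrite RtoC_opp, RtoC_div by lra. ring.
Qed.

(** The counterpart of [Jext] for a row: each level moves the exponent at least [1] to the right,
    into the range of [tau], and brings a factor [k^2]. *)
Fixpoint Text (N p : nat) (k a : R) (s : C) : C :=
  match N with
  | O => tau p k a s
  | S N => tau_up (Text N (S (S p)) k a) k s
  end.

Lemma Text_S N : forall p k a s, 0 < k -> 1 - INR N <= Re s -> Text N (S p) k a s = Text (S N) (S p) k a s.
Proof.
  induction N as [|N IH]; intros p k a s hk hs.
  - simpl in *. apply tau_step; lra.
  - rewrite S_INR in hs. change (tau_up (Text N (S (S (S p))) k a) k s = tau_up (Text (S N) (S (S (S p))) k a) k s).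
    unfold tau_up. rewrite (IH _ _ _ (s + 1)%C), (IH _ _ _ (s + 2)%C); auto; rewrite Re_plus; simpl; lra.
Qed.

(** [C] is displayed explicitly because it has to be seen to depend on [p0] alone: a merely existing
    constant could vary with [k] and [F], and uniformity over the rows would be lost. *)
Lemma HB_tau_up F k p0 F1 F2 M : HB F F1 (p0 + 1)%C M -> HB F F2 (p0 + 2)%C M ->
  exists C, (0 <= C) /\ (C = 64 * ((Cmod p0 + 1) * (2 * (Cmod p0 + 1) + 2))) /\
  exists f', HB (tau_up F k) f' p0 (k ^ 2 * (C * M)).
Proof.
  intros h1 h2. eexists. split; [|split; [reflexivity|]].
  { pose proof (Cmod_ge_0 p0). nra. }
  pose proof (HB_id p0) as hi.
  pose proof (HB_shift _ _ _ _ _ h1) as s1. pose proof (HB_shift _ _ _ _ _ h2) as s2.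
  pose proof (HB_pos _ _ _ _ h1) as hM. pose proof (Cmod_ge_0 p0) as h0.
  pose proof (HB_mult _ _ _ _ _ _ _ (HB_mult _ _ _ _ _ _ _ hi (HB_plus _ _ _ _ _ _ _ (HB_Cmult 2%C _ _ _ _ hi) (HB_const 1%C p0))) s1) as q1.
  pose proof (HB_mult _ _ _ _ _ _ _ (HB_mult _ _ _ _ _ _ _ hi (HB_plus _ _ _ _ _ _ _ (HB_Cmult 2%C _ _ _ _ hi) (HB_const 2%C p0))) s2) as q2.
  pose proof (HB_Cmult (2 * RtoC (k ^ 2))%C _ _ _ _ (HB_plus _ _ _ _ _ _ _ q1 (HB_Cmult (- (1))%C _ _ _ _ q2))) as q.
  eexists. eapply HB_le; [eapply HB_ext; [apply q | | intros; reflexivity]|].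
  - intros s _; unfold tau_up; cbv beta. ring.
  - rewrite Cmod_mult, Cmod_m1, Cmod_1, !Cmod_R, (Rabs_pos_eq 2), Rabs_pos_eq by (try lra; apply pow2_ge_0).
    pose proof (pow2_ge_0 k). set (c := Cmod p0 + 1) in *.
    assert (0 <= c * M) by (apply Rmult_le_pos; unfold c; lra).
    replace (2 * k ^ 2 * (4 * (4 * (c * (2 * c + 1)) * M) + 1 * (4 * (4 * (c * (2 * c + 2)) * M))))
     with (k ^ 2 * (32 * ((2 * c + 1) + (2 * c + 2)) * (c * M))) by ring.
    apply Rmult_le_compat_l; [assumption|].
    replace (64 * (c * (2 * c + 2)) * M) with (64 * (2 * c + 2) * (c * M)) by ring. apply Rmult_le_compat_r; [assumption | lra].
Qed.

(** The constant is uniform in the shift [a] and in [0 < k <= k0]; the power of [k] is what will be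
    weighed against [n^(-2s)] when [k = 1 / (n B)]. *)
Lemma HB_Text k0 N : forall p s0, 9/4 - INR N <= Re s0 ->
  exists C, 0 <= C /\ forall k a, 0 < k <= k0 -> exists f', HB (Text N p k a) f' s0 (C * k ^ (2 * N) / k).
Proof.
  induction N as [|N IH]; intros p s0 hs.
  - exists (256 * 2 ^ p * ((2 + 2 * k0 ^ 2) * PI)). pose proof PI_RGT_0.
    assert (h2 : 0 < 2 ^ p) by (apply pow_lt; lra).
    split. { apply Rmult_le_pos; [lra|]. apply Rmult_le_pos; [|lra]. pose proof (pow2_ge_0 k0); lra. }
    intros k a hk. destruct (HB_tau p k a s0) as [f' h]; [lra | simpl in hs; lra|]. exists f'.
    eapply HB_le; [apply h|]. simpl (k ^ (2 * 0)).
    replace (256 * 2 ^ p * ((2 + 2 * k ^ 2) / k * PI)) with (256 * 2 ^ p * PI * / k * (2 + 2 * k ^ 2)) by (field; lra).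
    replace (256 * 2 ^ p * ((2 + 2 * k0 ^ 2) * PI) * 1 / k) with (256 * 2 ^ p * PI * / k * (2 + 2 * k0 ^ 2)) by (field; lra).
    apply Rmult_le_compat_l.
    + apply Rmult_le_pos; [apply Rmult_le_pos; lra|]. left; apply Rinv_0_lt_compat; lra.
    + assert (k ^ 2 <= k0 ^ 2) by (apply pow_incr; lra). lra.
  - rewrite S_INR in hs.
    destruct (IH (S (S p)) (s0 + 1)%C) as (C1 & p1 & h1); [rewrite Re_plus; simpl; lra|].
    destruct (IH (S (S p)) (s0 + 2)%C) as (C2 & p2 & h2); [rewrite Re_plus; simpl; lra|].
    set (D := 64 * ((Cmod s0 + 1) * (2 * (Cmod s0 + 1) + 2))).
    assert (hD : 0 <= D) by (unfold D; pose proof (Cmod_ge_0 s0); nra).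
    exists (D * (C1 + C2)). split; [apply Rmult_le_pos; lra|].
    intros k a hk. destruct (h1 k a hk) as [f1 g1], (h2 k a hk) as [f2 g2].
    assert (hp : 0 <= k ^ (2 * N) / k) by (apply Rmult_le_pos; [apply pow_le; lra | left; apply Rinv_0_lt_compat; lra]).
    destruct (HB_tau_up (Text N (S (S p)) k a) k s0 f1 f2 ((C1 + C2) * k ^ (2 * N) / k)) as (C & hC & e & f' & h).
    + eapply HB_le; [apply g1|]. unfold Rdiv in *. rewrite !Rmult_assoc. apply Rmult_le_compat_r; lra.
    + eapply HB_le; [apply g2|]. unfold Rdiv in *. rewrite !Rmult_assoc. apply Rmult_le_compat_r; lra.
    + exists f'. eapply HB_le; [apply h|]. right. rewrite e. fold D.
      replace (2 * S N)%nat with (2 + 2 * N)%nat by lia. rewrite pow_add. field. lra.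
Qed.

(** * Row integrals over the whole line *)

Definition Clim (u : nat -> C) (l : C) : Prop :=
  is_lim_seq (fun n => Re (u n)) (Re l) /\ is_lim_seq (fun n => Im (u n)) (Im l).

Lemma Clim_unique u l m : Clim u l -> Clim u m -> l = m.
Proof.
  intros [a b] [c d].
  apply is_lim_seq_unique in a, b, c, d. apply Ceq; congruence.
Qed.

Lemma Clim_plus u v l m : Clim u l -> Clim v m -> Clim (fun n => u n + v n)%C (l + m)%C.
Proof. intros [] []; split; apply is_lim_seq_plus'; assumption. Qed.

Lemma Clim_opp u l : Clim u l -> Clim (fun n => - u n)%C (- l)%C.
Proof. intros [a b]; split; [apply (is_lim_seq_opp _ (Re l)) in a; apply a | apply (is_lim_seq_opp _ (Im l)) in b; apply b]. Qed.

Lemma Clim_scal (c : R) u l : Clim u l -> Clim (fun n => RtoC c * u n)%C (RtoC c * l)%C.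
Proof.
  intros [a b]; split.
  - rewrite Re_scal. apply is_lim_seq_ext with (fun n => c * Re (u n)). intros; now rewrite Re_scal.
    apply (is_lim_seq_scal_l _ c (Re l)), a.
  - rewrite Im_scal. apply is_lim_seq_ext with (fun n => c * Im (u n)). intros; now rewrite Im_scal.
    apply (is_lim_seq_scal_l _ c (Im l)), b.
Qed.

Lemma Clim_ext u v l : (forall n, u n = v n) -> Clim u l -> Clim v l.
Proof.
  intros e [a b]; split; [eapply is_lim_seq_ext; [|apply a] | eapply is_lim_seq_ext; [|apply b]]; intros; cbv beta; now rewrite e.
Qed.

Lemma Clim_0 u v : (forall n, Cmod (u n) <= v n) -> is_lim_seq v 0 -> Clim u 0%C.
Proof.
  intros h hv. assert (k : is_lim_seq (fun n => Cmod (u n)) 0).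
  { eapply lim_0_le; [|apply hv]. intros n. rewrite Rabs_pos_eq by apply Cmod_ge_0. apply h. }
  split; [apply lim_Re, k | apply lim_Im, k].
Qed.

Lemma CI0_der (Phi phi : R -> C) y : (forall x, Cder Phi x (phi x)) -> (forall x, Ccont phi x) ->
  CI 0 (fun t => phi (y + t)%R) = (Phi (y + 1)%R - Phi y)%C.
Proof.
  intros h c. apply is_CInt_unique. replace y with (y + 0) at 2 by ring.
  eapply is_CInt_ext; [| apply (is_CInt_der (fun t => Phi (y + t)%R) (fun t => phi (y + t)%R))].
  - intros; simpl; ring.
  - intros; apply Cder_shift, h.
  - intros; apply Ccont_shift, c.
Qed.

(** For a primitive [Phi] this is the integral over the window from [- j - a] to [j - a], that is,
    the sum of the first [j] terms of [termZ 0]. *)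
Definition wdiff (Phi : R -> C) (a : R) (j : nat) : C := (Phi (INR j - a)%R - Phi (- INR j - a)%R)%C.

Lemma termZ0_der Phi phi a j : (forall x, Cder Phi x (phi x)) -> (forall x, Ccont phi x) ->
  termZ 0 phi a j = (wdiff Phi a (S j) - wdiff Phi a j)%C.
Proof.
  intros h c. unfold termZ, wdiff. rewrite !(CI0_der Phi phi) by assumption. rewrite S_INR.
  replace (INR j + 1 - a) with (INR j - a + 1) by ring.
  replace (- 1 - INR j - a + 1) with (- INR j - a) by ring.
  replace (- (INR j + 1) - a) with (- 1 - INR j - a) by ring. ring.
Qed.

Lemma wdiff_0 Phi a : wdiff Phi a 0 = 0%C.
Proof. unfold wdiff. simpl INR. replace (- 0) with 0 by ring. ring. Qed.

Lemma termZ0_lim Phi phi a l : (forall x, Cder Phi x (phi x)) -> (forall x, Ccont phi x) ->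
  is_Cser (termZ 0 phi a) l <-> Clim (wdiff Phi a) l.
Proof.
  intros h c.
  assert (e : forall n, sum_n (fun j => Re (termZ 0 phi a j)) n = Re (wdiff Phi a (S n))).
  { intros n. rewrite (sum_n_ext _ (fun j => Re (wdiff Phi a (S j)) - Re (wdiff Phi a j))).
    - rewrite (sum_n_tel (fun j => Re (wdiff Phi a j))). rewrite wdiff_0; simpl; ring.
    - intros; rewrite (termZ0_der Phi phi) by assumption; reflexivity. }
  assert (e' : forall n, sum_n (fun j => Im (termZ 0 phi a j)) n = Im (wdiff Phi a (S n))).
  { intros n. rewrite (sum_n_ext _ (fun j => Im (wdiff Phi a (S j)) - Im (wdiff Phi a j))).
    - rewrite (sum_n_tel (fun j => Im (wdiff Phi a j))). rewrite wdiff_0; simpl; ring.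
    - intros; rewrite (termZ0_der Phi phi) by assumption; reflexivity. }
  split; intros [h1 h2]; split.
  - apply (is_lim_seq_incr_1 (fun n => Re (wdiff Phi a n))). eapply is_lim_seq_ext; [apply e | apply h1].
  - apply (is_lim_seq_incr_1 (fun n => Im (wdiff Phi a n))). eapply is_lim_seq_ext; [apply e' | apply h2].
  - apply (is_lim_seq_incr_1 (fun n => Re (wdiff Phi a n))) in h1.
    change (is_lim_seq (sum_n (fun j => Re (termZ 0 phi a j))) (Re l)).
    apply (is_lim_seq_ext (fun n => Re (wdiff Phi a (S n)))); [intros; symmetry; apply e | exact h1].
  - apply (is_lim_seq_incr_1 (fun n => Im (wdiff Phi a n))) in h2.
    change (is_lim_seq (sum_n (fun j => Im (termZ 0 phi a j))) (Im l)).
    apply (is_lim_seq_ext (fun n => Im (wdiff Phi a (S n)))); [intros; symmetry; apply e' | exact h2].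
Qed.

(* The integral of [(1 + x^2)^(-s)] over the line, [sqrt PI * Gamma(s - 1/2) / Gamma(s)]. *)
Definition W (s : C) : C := tau 0 1 0 s.

Definition Fp (s : C) (x : R) : C := CInt (fp 1 s) 0 x.

Lemma Cder_Fp s x : Cder (Fp s) x (fp 1 s x).
Proof.
  split.
  - apply (is_derive_RInt_cont (fun t => Re (fp 1 s t))). intros y; exact (proj1 (Ccont_fp 1 s y)).
  - apply (is_derive_RInt_cont (fun t => Im (fp 1 s t))). intros y; exact (proj2 (Ccont_fp 1 s y)).
Qed.

Lemma is_CInt_bound_fun f g a b l L : a <= b -> (forall t, a <= t <= b -> Cmod (f t) <= g t) ->
  is_CInt f a b l -> is_RInt g a b L -> Cmod l <= 2 * L.
Proof.
  intros hab h [h1 h2] hg. apply Cmod_le_2.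
  - apply (norm_RInt_le (V := R_NormedModule) (fun t => Re (f t)) g a b); auto.
    intros; eapply Rle_trans; [apply re_le_Cmod | auto].
  - apply (norm_RInt_le (V := R_NormedModule) (fun t => Im (f t)) g a b); auto.
    intros; eapply Rle_trans; [apply im_le_Cmod | auto].
Qed.

Lemma is_RInt_atan a b : is_RInt (fun x => / G 1 x) a b (atan b - atan a).
Proof.
  apply (is_RInt_derive (V := R_CompleteNormedModule) atan).
  - intros. unfold G. evar_last; [apply is_derive_atan|]. unfold Rsqr. f_equal. Rring.
  - intros x _. apply continuous_Rinv_comp.
    + unfold G; apply (ex_derive_continuous (K := R_AbsRing) (V := R_NormedModule)); auto_derive; auto.
    + pose proof (G_pos 1 x); lra.
Qed.

(** The integrand is dominated by [1 / (1 + x^2)], the derivative of [atan]; this is the tool for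
    comparing integrals over different windows. *)
Lemma Fp_diff s x y : 1 <= Re s -> Cmod (Fp s x - Fp s y)%C <= 2 * Rabs (atan x - atan y).
Proof.
  intros hs.
  assert (k : forall x y, y <= x -> Cmod (Fp s x - Fp s y)%C <= 2 * (atan x - atan y)).
  { intros u v huv. apply (is_CInt_bound_fun (fp 1 s) (fun x => / G 1 x) v u); auto.
    - intros; apply Cmod_fp_le, hs.
    - apply is_CInt_der; intros; [apply Cder_Fp | apply Ccont_fp].
    - apply is_RInt_atan. }
  destruct (Rle_dec y x) as [h|h].
  - eapply Rle_trans; [apply k, h|]. apply Rmult_le_compat_l; [lra | apply Rle_abs].
  - replace (Fp s x - Fp s y)%C with (- (Fp s y - Fp s x))%C by ring. rewrite Cmod_opp, Rabs_minus_sym.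
    eapply Rle_trans; [apply k; lra|]. apply Rmult_le_compat_l; [lra | apply Rle_abs].
Qed.

Lemma W_lim s : 1 <= Re s -> Clim (wdiff (Fp s) 0) (W s).
Proof.
  intros hs. apply (termZ0_lim (Fp s) (fp 1 s)); [apply Cder_Fp | apply Ccont_fp | apply tau_is; [lra | assumption]].
Qed.

(** The substitution [x -> k x] and the shift by [a] only move the ends of the window, and by
    [Fp_diff] this does not affect the limit. *)
Lemma tau_0_W k a s : 0 < k -> 1 <= Re s -> tau 0 k a s = (RtoC (/ k) * W s)%C.
Proof.
  intros hk hs.
  set (Phi := fun x => (RtoC (/ k) * Fp s (k * x)%R)%C).
  assert (h1 : Clim (wdiff Phi a) (tau 0 k a s)).
  { apply (termZ0_lim Phi (fp k s)); [| apply Ccont_fp | apply tau_is; assumption].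
    intros x. eapply Cder_eq. apply Cder_mult; [apply Cder_const|].
    apply (Cder_comp (Fp s) (fun x => k * x)); [apply Cder_Fp|]. auto_derive; auto.
    replace (fp 1 s (k * x)) with (fp k s x) by (unfold fp, G; f_equal; ring).
    rewrite Rmult_1_r. rewrite Cmult_0_l, Cplus_0_l, Cmult_assoc, <- RtoC_mult, Rinv_l by lra. ring. }
  apply (Clim_unique _ _ _ h1).
  assert (h2 : Clim (fun n => (Fp s (k * (INR n - a)) - Fp s (INR n - 0)) + - (Fp s (k * (- INR n - a)) - Fp s (- INR n - 0)))%C (0 + - 0)%C).
  { assert (g1 := lim_atan_lin k (- a) hk). assert (g2 := lim_atan_lin k a hk). assert (g3 := lim_atan_lin 1 0 Rlt_0_1).
    apply Clim_plus; [| apply Clim_opp]; (eapply Clim_0; [intros; apply Fp_diff, hs|]).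
    - replace (Finite 0) with (Rbar_mult 2 0) by (simpl; f_equal; ring). apply is_lim_seq_scal_l.
      apply (proj1 (is_lim_seq_abs_0 _)).
      replace (Finite 0) with (Finite (PI / 2 - PI / 2)) by (f_equal; ring).
      apply is_lim_seq_minus'.
      + eapply is_lim_seq_ext; [|apply g1]. intros; reflexivity.
      + eapply is_lim_seq_ext; [|apply g3]. intros; cbv beta. f_equal; ring.
    - replace (Finite 0) with (Rbar_mult 2 0) by (simpl; f_equal; ring). apply is_lim_seq_scal_l.
      apply (proj1 (is_lim_seq_abs_0 _)).
      replace (Finite 0) with (Finite (PI / 2 - PI / 2)) by (f_equal; ring).
      eapply is_lim_seq_ext; [|apply (is_lim_seq_minus' _ _ _ _ g3 g2)].
      intros n; cbv beta. replace (k * (- INR n - a)) with (- (k * (INR n + a))) by ring.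
      replace (- INR n - 0) with (- (1 * (INR n + 0))) by ring. rewrite !atan_opp. ring. }
  assert (h3 := Clim_scal (/ k) _ _ (Clim_plus _ _ _ _ h2 (W_lim s hs))).
  replace (RtoC (/ k) * W s)%C with (RtoC (/ k) * ((0 + - 0) + W s))%C by ring.
  eapply Clim_ext; [|apply h3]. intros n; unfold wdiff, Phi. ring.
Qed.

Lemma W_1 : W 1%C = RtoC PI.
Proof.
  assert (hs : 1 <= Re 1%C) by (simpl; lra).
  assert (h1 : Clim (wdiff (fun x => RtoC (atan x)) 0) (W 1%C)).
  { apply (termZ0_lim _ (fp 1 1)); [| apply Ccont_fp | apply tau_is; [lra | assumption]].
    intros x. unfold fp. rewrite pw_1 by apply G_pos. apply Cder_RtoC.
    evar_last; [apply is_derive_atan|]. unfold Rsqr, G. f_equal. Rring. }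
  apply (Clim_unique _ _ _ h1).
  assert (g3 := lim_atan_lin 1 0 Rlt_0_1).
  apply Clim_ext with (fun n => RtoC (atan (1 * (INR n + 0)) + atan (1 * (INR n + 0)))).
  - intros n; unfold wdiff. rewrite <- RtoC_minus. f_equal.
    replace (- INR n - 0) with (- (INR n)) by ring. rewrite atan_opp. replace (1 * (INR n + 0)) with (INR n) by ring.
    replace (INR n - 0) with (INR n) by ring. ring.
  - split; [|apply is_lim_seq_const]. cbv beta. rewrite Re_RtoC.
    replace PI with (PI / 2 + PI / 2) by field.
    apply (is_lim_seq_plus' (fun n => atan (1 * (INR n + 0))) (fun n => atan (1 * (INR n + 0)))); exact g3.
Qed.

(** The derivative of [x (1 + x^2)^(-s)], which vanishes at both ends, has integral zero. Here
    [fp 1 s] is [fp] with [k = 1], not the derivative [fp1]. *)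
Lemma W_step s : 1 <= Re s -> (s * W (s + 1) = (s - 1/2) * W s)%C.
Proof.
  intros hs.
  set (Phi := fun x => (RtoC x * fp 1 s x)%C).
  set (phi := fun x => ((1 - 2 * s) * fp 1 s x + 2 * s * fp 1 (s + 1) x)%C).
  assert (hd : forall x, Cder Phi x (phi x)).
  { intros x. eapply Cder_eq. apply Cder_mult; [apply Cder_RtoC, (is_derive_id (K := R_AbsRing)) | apply Cder_fp].
    change (@one R_AbsRing) with 1. unfold phi, fp1. rewrite <- (fp_S 1 s x). unfold G. rewrite RtoC_plus, RtoC_mult, !RtoC_pow. ring. }
  assert (hc : forall x, Ccont phi x).
  { intros; apply Ccont_plus; apply Ccont_mult; try apply Ccont_const; apply Ccont_fp. }
  assert (h1 : is_Cser (termZ 0 phi 0) ((1 - 2 * s) * W s + 2 * s * W (s + 1))%C).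
  { eapply is_Cser_ext; [| apply is_Cser_plus; apply is_Cser_Cmult; apply tau_is; try lra].
    - intros j; cbv beta. unfold phi. rewrite termZ_lin; [reflexivity | apply Ccont_fp | apply Ccont_fp].
    - rewrite Re_plus; simpl; lra. }
  assert (h2 : vanish Phi 0).
  { apply vanish_le with 2. intros x. unfold Phi. rewrite Cmod_mult, Cmod_R, Rabs_R0.
    pose proof (Cmod_fp_le 1 s x hs). pose proof (Rabs_pos x). pose proof (G_pos 1 x).
    apply Rle_trans with (Rabs x * / G 1 x); [apply Rmult_le_compat_l; assumption|].
    apply Rmult_le_reg_r with (G 1 x * (Rabs x + 0 + 1)); [apply Rmult_lt_0_compat; lra|].
    replace (Rabs x * / G 1 x * (G 1 x * (Rabs x + 0 + 1))) with (Rabs x * (Rabs x + 1)) by (field; lra).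
    replace (2 / (Rabs x + 0 + 1) * (G 1 x * (Rabs x + 0 + 1))) with (2 * G 1 x) by (field; lra).
    unfold G. rewrite <- (pow2_abs x). pose proof (pow2_ge_0 (Rabs x - 1)). nra. }
  apply (termZ0_lim Phi phi 0 _ hd hc) in h1.
  assert (h3 : Clim (wdiff Phi 0) (0 + - 0)%C).
  { destruct h2 as [v1 v2]. apply Clim_plus; [| apply Clim_opp]; (eapply Clim_0; [intros; apply Rle_refl|]); assumption. }
  pose proof (Clim_unique _ _ _ h1 h3) as e.
  replace (s * W (s + 1))%C with (1/2 * ((1 - 2 * s) * W s + 2 * s * W (s + 1)) + (s - 1/2) * W s)%C by field.
  rewrite e. ring.
Qed.

(* Division by zero gives [0] at the poles [1/2, -1/2, ...]. *)
Fixpoint Wext (N : nat) (s : C) : C :=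
  match N with
  | O => W s
  | S N => (s / (s - 1/2) * Wext N (s + 1))%C
  end.

Lemma Wext_S N : forall s, 1 - INR N <= Re s -> Wext N s = Wext (S N) s.
Proof.
  induction N as [|N IH]; intros s hs.
  - simpl in hs.
    assert (h : (s - 1/2)%C <> 0%C).
    { intros e. apply (f_equal Re) in e. rewrite Re_minus in e. simpl in e. lra. }
    assert (hs' : 1 <= Re s) by lra. pose proof (W_step s hs') as e. simpl Wext.
    set (d := (s - 1/2)%C) in *.
    replace (s / d * W (s + 1))%C with (/ d * (s * W (s + 1)))%C by (field; assumption).
    rewrite e. field; assumption.
  - rewrite S_INR in hs. change (s / (s - 1 / 2) * Wext N (s + 1) = s / (s - 1 / 2) * Wext (S N) (s + 1))%C.
    rewrite IH by (rewrite Re_plus; simpl; lra). reflexivity.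
Qed.

Lemma HB_W s0 : 9/4 <= Re s0 -> exists f' M, HB W f' s0 M.
Proof. intros hs. destruct (HB_tau 0 1 0 s0 Rlt_0_1 hs) as [f' h]. exists f'; eexists; apply h. Qed.

(** * The sum of the row remainders *)

(** Exponents further to the left are reached by pulling out [m] powers: [x^(-s) = x^m x^(-s-m)]. *)
Lemma HB_pw_gen x q m p : 1 <= x -> INR q + 5/4 <= Re p + INR m ->
  exists f', HB (pw x) f' p (x ^ m * (64 / x ^ q)).
Proof.
  intros hx hp.
  assert (h : HB (pw x) (fun s => - RtoC (ln x) * pw x s)%C (p + RtoC (INR m))%C (64 / x ^ q)).
  { apply HB_pw; [assumption|]. rewrite Re_plus, Re_RtoC. lra. }
  eexists. eapply HB_ext; [eapply HB_le; [apply (HB_Cmult (RtoC (x ^ m)) _ _ _ _ (HB_shift _ _ _ _ _ h))|] | | intros; reflexivity].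
  - rewrite Cmod_R, Rabs_pos_eq by (apply pow_le; lra). lra.
  - intros s _. cbv beta. rewrite pw_plus.
    replace (pw x (RtoC (INR m))) with (RtoC (/ x ^ m)).
    + rewrite (Cmult_comm (pw x s)), Cmult_assoc, <- RtoC_mult, Rinv_r by (apply pow_nonzero; lra). ring.
    + rewrite pw_exp, <- RtoC_mult, <- RtoC_opp, Cexp_RtoC, exp_Ropp, exp_INR by lra. reflexivity.
Qed.

Section EpsteinRows.
Variables (A B : R) (hB : 0 < B).

Definition kB (j : nat) : R := / (B * (INR j + 1)).

(** The two shifts belong to the rows [n] and [- n] with [n = j + 1]. Starting at [Text (S N) 0]
    forces one [tau_up], so that the term is a remainder in the sense of [row_trapezoid] and never
    the integral [tau 0], even for [N = 0]. *)
Definition Eterm (N j : nat) (s : C) : C :=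
  (pw ((INR j + 1) ^ 2) s * (Text (S N) 0 (kB j) ((INR j + 1) * A) s + Text (S N) 0 (kB j) (- ((INR j + 1) * A)) s))%C.

(* Up to sign, the Euler-Maclaurin remainders of all the rows [n <> 0]. *)
Definition E (N : nat) (s : C) : C := Cser (fun j => Eterm N j s).

Lemma kB_pos j : 0 < kB j <= / B.
Proof.
  pose proof (pos_INR j). unfold kB. split.
  - apply Rinv_0_lt_compat, Rmult_lt_0_compat; lra.
  - apply Rinv_le_contravar; [assumption|]. nra.
Qed.

Lemma Eterm_S N j s : - INR N <= Re s -> Eterm N j s = Eterm (S N) j s.
Proof.
  intros hs. unfold Eterm. f_equal.
  assert (h : forall a, Text (S N) 0 (kB j) a s = Text (S (S N)) 0 (kB j) a s).
  { intros a. change (tau_up (Text N 2 (kB j) a) (kB j) s = tau_up (Text (S N) 2 (kB j) a) (kB j) s).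
    unfold tau_up. rewrite (Text_S N 1 _ _ (s + 1)%C), (Text_S N 1 _ _ (s + 2)%C); try apply kB_pos; auto; rewrite Re_plus; simpl; lra. }
  rewrite !h. reflexivity.
Qed.

Lemma E_S N s : - INR N <= Re s -> E N s = E (S N) s.
Proof. intros; apply Cser_ext; intros; apply Eterm_S; assumption. Qed.

(** With [n = j + 1], the power contributes [n^(2N - 2)] and the remainder [n^(-2N - 1)]; of the
    resulting [n^(-3)] only [n^(-2)] is kept. *)
Lemma HB_Eterm N s0 : 9/4 - INR N <= Re s0 ->
  exists C, forall j, exists f', HB (Eterm N j) f' s0 (C * / (INR j + 1) ^ 2).
Proof.
  intros hs.
  destruct (HB_Text (/ B) (S N) 0 s0) as (C & hC & h); [rewrite S_INR; lra|].
  exists (512 * C * (/ B) ^ (2 * N + 1)). intros j.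
  pose proof (pos_INR j) as hj. set (n := INR j + 1) in *.
  destruct (h (kB j) (n * A) (kB_pos j)) as [f1 h1]. destruct (h (kB j) (- (n * A)) (kB_pos j)) as [f2 h2].
  destruct (HB_pw_gen (n ^ 2) 1 N s0) as [f0 h0].
  { replace 1 with (1 ^ 2) by ring. apply pow_incr; unfold n; lra. }
  { simpl; lra. }
  pose proof (HB_mult _ _ _ _ _ _ _ h0 (HB_plus _ _ _ _ _ _ _ h1 h2)) as hh.
  eexists. eapply HB_le; [apply hh|].
  unfold kB; fold n. assert (hn : 1 <= n) by (unfold n; lra).
  replace (2 * S N)%nat with (S (2 * N + 1)) by lia.
  rewrite <- pow_mult. rewrite Rinv_mult, Rpow_mult_distr.
  replace ((/ n) ^ S (2 * N + 1)) with (/ n ^ (2 * N) * (/ n * / n)).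
  2:{ rewrite pow_inv. replace (S (2 * N + 1)) with (2 * N + 2)%nat by lia. rewrite pow_add. simpl. field. split; [lra|]. apply pow_nonzero; lra. }
  simpl ((/ B) ^ S _).
  assert (hnp : n ^ (2 * N) <> 0) by (apply pow_nonzero; lra).
  set (b := (/ B) ^ (2 * N + 1)). assert (hb : 0 <= b) by (apply pow_le; left; apply Rinv_0_lt_compat, hB).
  replace (4 * _) with ((512 * C * b * / n ^ 2) * / n).
  2:{ replace (N + (N + 0) + 1)%nat with (2 * N + 1)%nat by lia. fold b.
      set (X := n ^ (2 * N)) in *. rewrite pow_1. field. repeat split; lra. }
  rewrite <- (Rmult_1_r (512 * C * b * / n ^ 2)) at 2. apply Rmult_le_compat_l.
  - apply Rmult_le_pos; [apply Rmult_le_pos; [lra|assumption] |]. left; apply Rinv_0_lt_compat, pow_lt; lra.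
  - rewrite <- Rinv_1. apply Rinv_le_contravar; lra.
Qed.

(** Besides the bound, the termwise derivatives and the convergence of both series are exported, so
    that the derivative at [0] can be computed row by row. *)
Lemma HB_E N s0 : 9/4 - INR N <= Re s0 ->
  exists f' M, HB (E N) (fun s => Cser (fun j => f' j s)) s0 M /\
   (forall j, exists M, HB (Eterm N j) (f' j) s0 M) /\
   forall s, Cmod (s - s0)%C <= 1/4 -> is_Cser (fun j => Eterm N j s) (E N s) /\ is_Cser (fun j => f' j s) (Cser (fun j => f' j s)).
Proof.
  intros hs. destruct (HB_Eterm N s0 hs) as [C h].
  (* The derivatives are given by an existential statement for each [j]; choice collects them into
     one sequence. *)
  apply functional_choice in h. destruct h as [f' h].
  destruct ex_series_inv2 as [Bd hBd].
  assert (hb : is_series (fun j => C * / (INR j + 1) ^ 2) (C * Bd)) by (apply (is_series_scal (K := R_AbsRing) (V := R_NormedModule)), hBd).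
  exists f', (2 * (C * Bd)). split; [|split].
  - apply HB_Cser with (fun j => C * / (INR j + 1) ^ 2); assumption.
  - intros j; eexists; apply h.
  - intros s hs'. split; apply Cser_correct with (fun j => C * / (INR j + 1) ^ 2); try (eexists; apply hb); intros j; apply (h j s s); assumption.
Qed.
End EpsteinRows.

(** * The logarithm of |1 - q| *)

Fixpoint csum (f : nat -> C) (n : nat) : C :=
  match n with O => 0%C | S n => (csum f n + f n)%C end.

Lemma csum_ext f g n : (forall k, (k < n)%nat -> f k = g k) -> csum f n = csum g n.
Proof.
  induction n as [|n IH]; intros h; [reflexivity|]. simpl. rewrite IH, h; auto.
Qed.

Lemma csum_plus f g n : csum (fun k => f k + g k)%C n = (csum f n + csum g n)%C.
Proof. induction n as [|n IH]; simpl; [ring | rewrite IH; ring]. Qed.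

Lemma csum_Cmult c f n : csum (fun k => c * f k)%C n = (c * csum f n)%C.
Proof. induction n as [|n IH]; simpl; [ring | rewrite IH; ring]. Qed.

Lemma csum_tel f n : csum (fun k => f (S k) - f k)%C n = (f n - f 0%nat)%C.
Proof. induction n as [|n IH]; simpl; [ring | rewrite IH; ring]. Qed.

Lemma csum_first f n : csum f (S n) = (f 0%nat + csum (fun k => f (S k)) n)%C.
Proof. induction n as [|n IH]; [simpl; ring|]. change (csum f (S (S n))) with (csum f (S n) + f (S n))%C. rewrite IH. simpl. ring. Qed.

Lemma csum_pair f n : csum f (2 * n) = csum (fun k => f (2 * k)%nat + f (2 * k + 1)%nat)%C n.
Proof.
  induction n as [|n IH]; [reflexivity|].
  replace (2 * S n)%nat with (S (S (2 * n))) by lia.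
  change (csum f (S (S (2 * n)))) with (csum f (2 * n) + f (2 * n)%nat + f (S (2 * n)))%C. rewrite IH.
  change (csum (fun k => f (2 * k)%nat + f (2 * k + 1)%nat)%C (S n)) with
    (csum (fun k => f (2 * k)%nat + f (2 * k + 1)%nat)%C n + (f (2 * n)%nat + f (2 * n + 1)%nat))%C.
  replace (f (2 * n + 1)%nat) with (f (S (2 * n))) by (f_equal; lia). ring.
Qed.

Lemma csum_le f n M : (forall k, (k < n)%nat -> Cmod (f k) <= M) -> Cmod (csum f n) <= INR n * M.
Proof.
  induction n as [|n IH]; intros h.
  - simpl. rewrite Cmod_0; lra.
  - rewrite S_INR. simpl csum. eapply Rle_trans; [apply Cmod_triangle|].
    assert (Cmod (csum f n) <= INR n * M) by (apply IH; auto). pose proof (h n ltac:(lia)). lra.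
Qed.

(** A run of [2 M] consecutive cells is rearranged from the middle outwards, to match the pairing in
    [termZ]. *)
Lemma csum_sym (f : R -> C) a M :
  csum (fun m => f (- INR M - a + INR m)%R) (2 * M) = csum (fun j => f (INR j - a)%R + f (- 1 - INR j - a)%R)%C M.
Proof.
  induction M as [|M IH]; [reflexivity|].
  replace (2 * S M)%nat with (S (S (2 * M))) by lia. rewrite csum_first.
  change (csum ?g (S (2 * M))) with (csum g (2 * M) + g (2 * M)%nat)%C.
  change (csum (fun j => f (INR j - a)%R + f (- 1 - INR j - a)%R)%C (S M))
    with (csum (fun j => f (INR j - a)%R + f (- 1 - INR j - a)%R)%C M + (f (INR M - a)%R + f (- 1 - INR M - a)%R))%C.
  rewrite <- IH. cbv beta.
  replace (f (- INR (S M) - a + INR 0)%R) with (f (- 1 - INR M - a)%R) by (f_equal; rewrite S_INR; simpl; ring).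
  replace (f (- INR (S M) - a + INR (S (2 * M)))%R) with (f (INR M - a)%R) by (f_equal; rewrite !S_INR, mult_INR; simpl; ring).
  rewrite (csum_ext (fun k => f (- INR (S M) - a + INR (S k))%R) (fun m => f (- INR M - a + INR m)%R)).
  - ring.
  - intros k _; f_equal. rewrite !S_INR; ring.
Qed.

(* [ln |1 - exp (- 2 PI (b - i a))|], see [Cmod_eta]. *)
Definition lnq (a b : R) : R := ln 2 - PI * b + ln (sinh (PI * b) ^ 2 + sin (PI * a) ^ 2) / 2.

Lemma sinh_pos u : 0 < u -> 0 < sinh u.
Proof. intros; unfold sinh. pose proof (exp_increasing (- u) u ltac:(lra)). lra. Qed.

Lemma cosh2 u : cosh u ^ 2 = 1 + sinh u ^ 2.
Proof.
  unfold cosh, sinh. pose proof (exp_plus u (- u)) as e. rewrite Rplus_opp_r, exp_0 in e.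
  set (x := exp u) in *; set (y := exp (- u)) in *. nra.
Qed.

Lemma sinh_2 u : sinh (2 * u) ^ 2 = 4 * sinh u ^ 2 * (1 + sinh u ^ 2).
Proof.
  rewrite <- cosh2. unfold sinh, cosh. replace (2 * u) with (u + u) by ring.
  replace (- (u + u)) with (- u + - u) by ring. rewrite !exp_plus. field.
Qed.

Lemma Qpos u v : 0 < u -> 0 < sinh u ^ 2 + sin v ^ 2.
Proof. intros h. pose proof (sinh_pos u h). pose proof (pow2_ge_0 (sin v)). pose proof (pow_lt _ 2 H). lra. Qed.

(** Replacing [a / 2] by [(a + 1) / 2] changes the sign of [q]; for the sine this is the shift by a
    quarter turn that exchanges [sin v] and [cos v]. *)
Lemma lnq_double a b : 0 < b -> lnq a b = lnq (a / 2) (b / 2) + lnq ((a + 1) / 2) (b / 2).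
Proof.
  intros hb. unfold lnq. pose proof PI_RGT_0.
  set (u := PI * (b / 2)). set (v := PI * (a / 2)).
  assert (hu : 0 < u) by (unfold u; apply Rmult_lt_0_compat; lra).
  replace (PI * ((a + 1) / 2)) with (PI / 2 + v) by (unfold v; field).
  replace (sin (PI / 2 + v)) with (cos v) by (rewrite cos_sin; f_equal; ring).
  replace (PI * b) with (2 * u) by (unfold u; field). replace (PI * a) with (2 * v) by (unfold v; field).
  rewrite sinh_2, sin_2a.
  assert (e : 4 * sinh u ^ 2 * (1 + sinh u ^ 2) + (2 * sin v * cos v) ^ 2 =
    2 * 2 * ((sinh u ^ 2 + sin v ^ 2) * (sinh u ^ 2 + cos v ^ 2))).
  { pose proof (sin2_cos2 v) as t. unfold Rsqr in t.
    replace (1 + sinh u ^ 2) with (sin v * sin v + cos v * cos v + sinh u ^ 2) by (rewrite t; ring). ring. }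
  rewrite e. assert (q1 := Qpos u v hu).
  assert (q2 : 0 < sinh u ^ 2 + cos v ^ 2).
  { pose proof (sinh_pos u hu) as p. pose proof (pow2_ge_0 (cos v)). pose proof (pow_lt _ 2 p). lra. }
  assert (0 < (sinh u ^ 2 + sin v ^ 2) * (sinh u ^ 2 + cos v ^ 2)) by (apply Rmult_lt_0_compat; assumption).
  rewrite !ln_mult by lra. field.
Qed.

Lemma lnq_opp a b : lnq (- a) b = lnq a b.
Proof. unfold lnq. replace (PI * - a) with (- (PI * a)) by ring. rewrite sin_neg. do 3 f_equal. ring. Qed.

Lemma lnq_plus1 a b : lnq (a + 1) b = lnq a b.
Proof. unfold lnq. replace (PI * (a + 1)) with (PI * a + PI) by ring. rewrite neg_sin. do 3 f_equal. ring. Qed.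

Lemma lnq_plus_nat a b n : lnq (a + INR n) b = lnq a b.
Proof.
  induction n as [|n IH]; [simpl; rewrite Rplus_0_r; reflexivity|].
  rewrite S_INR, <- Rplus_assoc, lnq_plus1. exact IH.
Qed.

(** Even and odd [m] separate into the sums belonging to the two terms of [lnq_double]. *)
Lemma lnq_sum b r : 0 < b -> forall y,
  csum (fun m => RtoC (lnq ((y + INR m) / 2 ^ r) (b / 2 ^ r))) (2 ^ r) = RtoC (lnq y b).
Proof.
  revert b; induction r as [|r IH]; intros b hb y.
  - simpl. rewrite !Rdiv_1_r, Rplus_0_r. ring.
  - assert (h2 : 2 ^ r <> 0) by (apply pow_nonzero; lra).
    change (2 ^ S r)%nat with (2 * 2 ^ r)%nat. rewrite csum_pair, csum_plus.
    rewrite (lnq_double y b hb), RtoC_plus.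
    rewrite <- (IH (b / 2) ltac:(lra) (y / 2)), <- (IH (b / 2) ltac:(lra) ((y + 1) / 2)).
    f_equal; apply csum_ext; intros k _.
    + f_equal. f_equal; [rewrite mult_INR|]; simpl; field; assumption.
    + f_equal. f_equal; [rewrite plus_INR, mult_INR|]; simpl; field; assumption.
Qed.

Definition lnq1 (c b x : R) : R := c * (sin (c * x) * cos (c * x)) / (sinh (PI * b) ^ 2 + sin (c * x) ^ 2).

(* The second derivative of [ln (S^2 + sin v ^ 2) / 2] in [v], with [Q = S^2 + sin v ^ 2]. *)
Definition lnq2_shape (S Q : R) : R := - (1 + 2 * S ^ 2) / Q + 2 * S ^ 2 * (1 + S ^ 2) / Q ^ 2.

Definition lnq2 (c b x : R) : R := c ^ 2 * lnq2_shape (sinh (PI * b)) (sinh (PI * b) ^ 2 + sin (c * x) ^ 2).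

Lemma lnq_der N b x : 0 < b -> 0 < N -> is_derive (fun x => lnq (x / N) b) x (lnq1 (PI / N) b x).
Proof.
  intros hb hN. pose proof PI_RGT_0. assert (hu : 0 < PI * b) by (apply Rmult_lt_0_compat; lra).
  apply is_derive_ext with (fun x => ln 2 - PI * b + ln (sinh (PI * b) ^ 2 + sin (PI / N * x) ^ 2) / 2).
  { intros t. unfold lnq. replace (PI * (t / N)) with (PI / N * t) by (field; lra). reflexivity. }
  pose proof (Qpos (PI * b) (PI / N * x) hu) as q. unfold lnq1. set (S := sinh (PI * b)) in *.
  auto_derive; [simpl in *; lra | field; split; simpl in *; lra].
Qed.

Lemma lnq1_der c b x : 0 < b -> is_derive (lnq1 c b) x (lnq2 c b x).
Proof.
  intros hb. pose proof PI_RGT_0. assert (hu : 0 < PI * b) by (apply Rmult_lt_0_compat; lra).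
  pose proof (Qpos (PI * b) (c * x) hu) as q. unfold lnq1, lnq2, lnq2_shape. set (S := sinh (PI * b)) in *.
  evar_last. { auto_derive; [simpl in *; lra | reflexivity]. }
  pose proof (sin2_cos2 (c * x)) as t; unfold Rsqr in t. eqR.
  set (s := sin (c * x)) in *. set (k := cos (c * x)) in *.
  assert (hk : k ^ 2 = 1 - s ^ 2) by (simpl; lra).
  apply Rmult_eq_reg_r with ((S ^ 2 + s ^ 2) ^ 2); [| apply pow_nonzero; lra].
  transitivity (c ^ 2 * ((k ^ 2 - s ^ 2) * (S ^ 2 + s ^ 2) - 2 * s ^ 2 * k ^ 2)).
  - field. simpl in *; lra.
  - rewrite hk. field. simpl in *; lra.
Qed.

Lemma lnq2_cont c b x : 0 < b -> continuous (lnq2 c b) x.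
Proof.
  intros hb. pose proof PI_RGT_0. assert (hu : 0 < PI * b) by (apply Rmult_lt_0_compat; lra).
  pose proof (Qpos (PI * b) (c * x) hu) as q. unfold lnq2, lnq2_shape. set (S := sinh (PI * b)) in *.
  apply (ex_derive_continuous (K := R_AbsRing) (V := R_NormedModule)). auto_derive.
  simpl in *. repeat split; nra.
Qed.

(** [1/12] is the common end value of [bern 2], and the half sum comes from the end values of
    [bern 1]. *)
Lemma CI2_EM (phi phi' phi'' : R -> R) y :
  (forall x, is_derive phi x (phi' x)) -> (forall x, is_derive phi' x (phi'' x)) -> (forall x, continuous phi'' x) ->
  CI 2 (fun t => RtoC (phi'' (y + t)%R)) =
  (RtoC (1/12) * (RtoC (phi' (y + 1)%R) - RtoC (phi' y)) - 1/2 * (RtoC (phi y) + RtoC (phi (y + 1)%R))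
    + CI 0 (fun t => RtoC (phi (y + t)%R)))%C.
Proof.
  intros h1 h2 h3.
  assert (s : forall (f f' : R -> R), (forall x, is_derive f x (f' x)) -> forall t, Cder (fun t => RtoC (f (y + t))) t (RtoC (f' (y + t)))).
  { intros f f' h t. apply (Cder_shift (fun x => RtoC (f x))). apply Cder_RtoC, h. }
  rewrite (CI_parts 1 (fun t => RtoC (phi' (y + t)%R))).
  - rewrite (CI_parts 0 (fun t => RtoC (phi (y + t)%R))).
    + rewrite !bern_1, !bern_2. replace (y + 0) with y by ring.
      replace (1 ^ 2 / 2 - 1 / 2 + 1 / 12) with (1/12) by field. replace (0 ^ 2 / 2 - 0 / 2 + 1 / 12) with (1/12) by field.
      replace (1 - 1/2) with (1/2) by field. replace (0 - 1/2) with (- (1/2)) by field.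
      rewrite RtoC_opp, (RtoC_div 1 2) by lra. ring.
    + intros; apply s, h1.
    + intros; eapply Cder_cont, s, h2.
  - intros; apply s, h2.
  - intros; apply (Ccont_shift (fun x => RtoC (phi'' x))), Ccont_RtoC, h3.
Qed.

Lemma CI_csum p (f : nat -> R -> C) n : (forall k t, Ccont (f k) t) ->
  CI p (fun t => csum (fun k => f k t) n) = csum (fun k => CI p (f k)) n.
Proof.
  intros h. induction n as [|n IH].
  - simpl. transitivity (CI p (fun t => 0 * f 0%nat t + 0 * f 0%nat t)%C).
    + apply CI_ext; intros; ring.
    + rewrite CI_lin by auto. ring.
  - simpl. rewrite <- IH. transitivity (CI p (fun t => 1 * csum (fun k => f k t) n + 1 * f n t)%C).
    + apply CI_ext; intros; ring.
    + rewrite CI_lin; auto; [ring|]. intros t _. clear IH. induction n as [|n IH]; simpl; [apply Ccont_const | apply Ccont_plus; auto].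
Qed.

Lemma lnq_cont b x : 0 < b -> continuous (fun x => lnq x b) x.
Proof.
  intros hb. apply (continuous_ext (fun x => lnq (x / 1) b)); [intros; now rewrite Rdiv_1_r|].
  apply (ex_derive_continuous (K := R_AbsRing) (V := R_NormedModule)). eexists; apply lnq_der; lra.
Qed.

(* Euler-Maclaurin over a full period: the first derivatives at the end points cancel. *)
Lemma lnq2_sum b r y : 0 < b ->
  csum (fun m => CI 2 (fun t => RtoC (lnq2 (PI / 2 ^ r) (b / 2 ^ r) (y + INR m + t)))) (2 ^ r) =
  (CI 0 (fun t => RtoC (lnq (y + t) b)) - RtoC (lnq y b))%C.
Proof.
  intros hb. set (N := 2 ^ r).
  assert (hN : 0 < N) by (apply pow_lt; lra).
  assert (hbN : 0 < b / N) by (apply Rdiv_lt_0_compat; assumption).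
  set (phi := fun x => lnq (x / N) (b / N)). set (phi' := lnq1 (PI / N) (b / N)).
  rewrite (csum_ext _ (fun m => (RtoC (1/12) * (RtoC (phi' (y + INR (S m))%R) - RtoC (phi' (y + INR m)%R))
     + - (1/2) * (RtoC (phi (y + INR (S m))%R) - RtoC (phi (y + INR m)%R))) + ((-1) * RtoC (phi (y + INR m)%R) + CI 0 (fun t => RtoC (phi (y + INR m + t)%R))))%C).
  2:{ intros m _. rewrite (CI2_EM phi phi' _ (y + INR m)).
    - rewrite S_INR, <- Rplus_assoc. field.
    - intros; apply lnq_der; assumption.
    - intros; apply lnq1_der; assumption.
    - intros; apply lnq2_cont; assumption. }
  rewrite !csum_plus, !csum_Cmult.
  rewrite (csum_tel (fun m => RtoC (phi' (y + INR m)%R))), (csum_tel (fun m => RtoC (phi (y + INR m)%R))).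
  assert (e0 : csum (fun k => RtoC (phi (y + INR k)%R)) (2 ^ r) = RtoC (lnq y b)) by apply (lnq_sum b r hb y).
  rewrite e0.
  assert (e1 : phi (y + INR (2 ^ r))%R = phi (y + INR 0)%R).
  { unfold phi. rewrite pow_INR. simpl INR. change (1 + 1) with 2. fold N.
    replace ((y + N) / N) with ((y + 0) / N + 1) by (field; lra). apply lnq_plus1. }
  assert (e2 : phi' (y + INR (2 ^ r))%R = phi' (y + INR 0)%R).
  { unfold phi', lnq1. rewrite pow_INR. simpl INR. change (1 + 1) with 2. fold N.
    replace (PI / N * (y + N)) with (PI / N * (y + 0) + PI) by (field; lra).
    rewrite neg_sin, neg_cos. f_equal; ring. }
  rewrite e1, e2.
  rewrite <- (CI_csum 0 (fun m t => RtoC (phi (y + INR m + t)%R))).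
  - rewrite (CI_ext 0 _ (fun t => RtoC (lnq (y + t) b))). ring.
    intros t _. rewrite <- (lnq_sum b r hb (y + t)). apply csum_ext; intros k _. unfold phi. do 3 f_equal. ring.
  - intros m t. apply Ccont_RtoC.
    apply (ex_derive_continuous (K := R_AbsRing) (V := R_NormedModule)).
    eexists. apply (is_derive_comp phi (fun t => y + INR m + t)); [apply lnq_der; assumption|].
    auto_derive; auto; reflexivity.
Qed.

(** * Comparison of the sine kernel with its rational limit *)

Lemma mono0 (f f' : R -> R) c : (forall x, 0 <= x <= c -> is_derive f x (f' x)) -> (forall x, 0 <= x <= c -> 0 <= f' x) ->
  0 <= f 0 -> forall x, 0 <= x <= c -> 0 <= f x.
Proof.
  intros h1 h2 h3 x hx.
  destruct (MVT_gen f 0 x f') as (xi & k1 & k2).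
  - rewrite Rmin_left, Rmax_right by lra. intros; apply h1; lra.
  - rewrite Rmin_left, Rmax_right by lra. intros y hy. apply continuity_pt_filterlim.
    apply (ex_derive_continuous (K := R_AbsRing) (V := R_NormedModule) f). eexists; apply h1; lra.
  - rewrite Rmin_left, Rmax_right in k1 by lra. pose proof (h2 xi ltac:(lra)). nra.
Qed.

Lemma is_derive_sinh x : is_derive sinh x (cosh x).
Proof. unfold sinh, cosh. auto_derive; auto. field. Qed.

Lemma is_derive_cosh x : is_derive cosh x (sinh x).
Proof. unfold sinh, cosh. auto_derive; auto. field. Qed.

Lemma cosh_le_2 x : 0 <= x <= 1 -> cosh x <= 2.
Proof.
  intros h. unfold cosh. pose proof exp_le_3. pose proof (exp_le_compat x 1 ltac:(lra)).
  pose proof (exp_le_compat (- x) 0 ltac:(lra)). rewrite exp_0 in *. lra.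
Qed.

Lemma sinh_bounds u : 0 <= u <= 1 -> u <= sinh u <= 2 * u /\ sinh u <= u + u ^ 3.
Proof.
  intros hu.
  assert (h1 : forall x, 0 <= x <= 1 -> 0 <= sinh x - x).
  { apply (mono0 (fun x => sinh x - x) (fun x => cosh x - 1)).
    - intros; apply (is_derive_minus (V := R_NormedModule)); [apply is_derive_sinh | apply (is_derive_id (K := R_AbsRing))].
    - intros x hx. pose proof (cosh2 x). pose proof (pow2_ge_0 (sinh x)).
      assert (0 < cosh x) by (unfold cosh; pose proof (exp_pos x); pose proof (exp_pos (- x)); lra). nra.
    - rewrite sinh_0; lra. }
  assert (h2 : forall x, 0 <= x <= 1 -> 0 <= 2 * x - sinh x).
  { apply (mono0 (fun x => 2 * x - sinh x) (fun x => 2 - cosh x)).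
    - intros; apply (is_derive_minus (V := R_NormedModule)); [auto_derive; auto; ring | apply is_derive_sinh].
    - intros x hx. pose proof (cosh_le_2 x hx). lra.
    - rewrite sinh_0; lra. }
  assert (h3 : forall x, 0 <= x <= 1 -> 0 <= 1 + x ^ 2 - cosh x).
  { apply (mono0 (fun x => 1 + x ^ 2 - cosh x) (fun x => 2 * x - sinh x)).
    - intros; apply (is_derive_minus (V := R_NormedModule)); [auto_derive; auto; ring | apply is_derive_cosh].
    - apply h2.
    - rewrite cosh_0; lra. }
  assert (h4 : forall x, 0 <= x <= 1 -> 0 <= x + x ^ 3 - sinh x).
  { apply (mono0 (fun x => x + x ^ 3 - sinh x) (fun x => 1 + 3 * x ^ 2 - cosh x)).
    - intros; apply (is_derive_minus (V := R_NormedModule)); [auto_derive; auto; ring | apply is_derive_sinh].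
    - intros x hx. pose proof (h3 x hx). nra.
    - rewrite sinh_0; lra. }
  pose proof (h1 u hu); pose proof (h2 u hu); pose proof (h4 u hu). lra.
Qed.

(** The range is [2] and not [PI / 2] because the shift [a] pushes the outermost rescaled nodes
    slightly beyond half a period. Up to [2] one has [v - v^3 / 6 >= v / 3]. *)
Lemma sin_bounds v : 0 <= v <= 2 -> v / 3 <= sin v <= v /\ v - sin v <= v ^ 3 / 6.
Proof.
  intros hv.
  assert (h0 : forall x, 0 <= x <= 2 -> 0 <= x - sin x).
  { apply (mono0 (fun x => x - sin x) (fun x => 1 - cos x)).
    - intros; auto_derive; auto; ring.
    - intros x _. pose proof (COS_bound x); lra.
    - rewrite sin_0; lra. }
  assert (h1 : forall x, 0 <= x <= 2 -> 0 <= cos x - (1 - x ^ 2 / 2)).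
  { apply (mono0 (fun x => cos x - (1 - x ^ 2 / 2)) (fun x => x - sin x)).
    - intros; auto_derive; auto; field.
    - apply h0.
    - rewrite cos_0; lra. }
  assert (h2 : forall x, 0 <= x <= 2 -> 0 <= sin x - (x - x ^ 3 / 6)).
  { apply (mono0 (fun x => sin x - (x - x ^ 3 / 6)) (fun x => cos x - (1 - x ^ 2 / 2))).
    - intros; auto_derive; auto; field.
    - apply h1.
    - rewrite sin_0; lra. }
  pose proof (h0 v hv); pose proof (h2 v hv). split; [split|]; try lra.
  assert (v ^ 2 <= 4) by nra. assert (v ^ 3 <= 4 * v) by (simpl in *; nra). lra.
Qed.

Lemma sin2_bounds v : Rabs v <= 2 -> v ^ 2 / 9 <= sin v ^ 2 <= v ^ 2 /\ v ^ 2 - sin v ^ 2 <= v ^ 4 / 3.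
Proof.
  intros hv.
  assert (h : forall w, 0 <= w <= 2 -> w ^ 2 / 9 <= sin w ^ 2 <= w ^ 2 /\ w ^ 2 - sin w ^ 2 <= w ^ 4 / 3).
  { intros w hw. destruct (sin_bounds w hw) as ((a & b) & c). set (s := sin w) in *.
    split; [split|]; try nra. }
  destruct (Rle_dec 0 v) as [p|p].
  - rewrite Rabs_pos_eq in hv by assumption. apply h; lra.
  - rewrite Rabs_left in hv by lra. specialize (h (- v) ltac:(lra)). rewrite sin_neg in h.
    replace ((- v) ^ 2) with (v ^ 2) in h by ring. replace ((- v) ^ 4) with (v ^ 4) in h by ring.
    replace ((- sin v) ^ 2) with (sin v ^ 2) in h by ring. exact h.
Qed.

(** Both expressions may blow up like [1 / q] with [q = u^2 + v^2], yet their difference stays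
    bounded: [Q] differs from [q] by [O(q^2)], hence [1 / Q - 1 / q] is bounded. The pieces add up
    to less than [1100], so [2000] is generous. *)
Lemma lnq2_shape_bound u v : 0 < u <= 1 -> Rabs v <= 2 ->
  Rabs (lnq2_shape (sinh u) (sinh u ^ 2 + sin v ^ 2) - (u ^ 2 - v ^ 2) / (u ^ 2 + v ^ 2) ^ 2) <= 2000.
Proof.
  intros hu hv. destruct (sinh_bounds u ltac:(lra)) as ((a & b) & c). destruct (sin2_bounds v hv) as ((d & e) & f).
  set (S := sinh u) in *. set (s2 := sin v ^ 2) in *. unfold lnq2_shape.
  set (Q := S ^ 2 + s2). set (q := u ^ 2 + v ^ 2).
  pose proof (pow2_ge_0 v) as hv2.
  assert (hu2 : 0 < u ^ 2) by (apply pow_lt; lra).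
  assert (hq : 0 < q) by (unfold q; lra).
  assert (hS : u ^ 2 <= S ^ 2) by (apply pow_incr; lra).
  assert (hX : S ^ 2 - u ^ 2 <= 3 * (u ^ 2 * u ^ 2)).
  { assert (S ^ 2 <= (u + u ^ 3) ^ 2) by (apply pow_incr; lra).
    assert (u ^ 2 <= 1) by nra. assert (u ^ 2 * u ^ 2 * u ^ 2 <= u ^ 2 * u ^ 2) by nra.
    replace ((u + u ^ 3) ^ 2) with (u ^ 2 + 2 * (u ^ 2 * u ^ 2) + u ^ 2 * u ^ 2 * u ^ 2) in * by ring. lra. }
  assert (hY : v ^ 2 - s2 <= v ^ 2 * v ^ 2) by (replace (v ^ 4) with (v ^ 2 * v ^ 2) in f by ring; nra).
  assert (hQ : q / 9 <= Q) by (unfold q, Q; lra).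
  assert (hQ0 : 0 < Q) by lra.
  set (U := u ^ 2) in *. set (V := v ^ 2) in *. set (T := S ^ 2) in *.
  assert (hT0 : 0 <= T) by lra.
  assert (hdq : Rabs (Q - q) <= 3 * (q * q)).
  { unfold Q, q. apply Rabs_le. split; nra. }
  assert (hiq : 0 < / q) by (apply Rinv_0_lt_compat; assumption).
  assert (hiQ : 0 < / Q) by (apply Rinv_0_lt_compat; assumption).
  assert (hiQ9 : / Q <= 9 * / q).
  { replace (9 * / q) with (/ (q / 9)) by (field; lra). apply Rinv_le_contravar; lra. }
  assert (k1 : Rabs (/ Q - / q) <= 27).
  { replace (/ Q - / q) with (- ((Q - q) * (/ Q * / q))) by (field; lra).
    rewrite Rabs_Ropp, Rabs_mult, (Rabs_pos_eq (/ Q * / q)) by (apply Rmult_le_pos; lra).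
    apply Rle_trans with ((3 * (q * q)) * (9 * / q * / q)).
    - apply Rmult_le_compat; auto using Rabs_pos. apply Rmult_le_pos; lra. apply Rmult_le_compat_r; lra.
    - right; field; lra. }
  assert (k2 : 0 <= T * / Q <= 1).
  { split; [apply Rmult_le_pos; lra|]. apply Rmult_le_reg_r with Q; [assumption|]. rewrite Rmult_assoc, Rinv_l by lra. unfold Q, s2; pose proof (pow2_ge_0 (sin v)); lra. }
  assert (kU : 0 <= U * / q <= 1).
  { split; [apply Rmult_le_pos; lra|]. apply Rmult_le_reg_r with q; [assumption|]. rewrite Rmult_assoc, Rinv_l by lra. unfold q; lra. }
  assert (k3 : 0 <= (T - U) * (/ Q * / Q) <= 243).
  { split. apply Rmult_le_pos; [lra | apply Rmult_le_pos; lra].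
    apply Rle_trans with ((3 * (U * U)) * ((9 * / q) * (9 * / q))).
    - apply Rmult_le_compat; try lra. apply Rmult_le_pos; lra. apply Rmult_le_compat; lra.
    - replace (3 * (U * U) * (9 * / q * (9 * / q))) with (243 * ((U * / q) * (U * / q))) by ring. nra. }
  assert (k4 : Rabs (U * ((/ Q - / q) * (/ Q + / q))) <= 270).
  { rewrite !Rabs_mult, (Rabs_pos_eq U), (Rabs_pos_eq (/ Q + / q)) by lra.
    apply Rle_trans with (U * (27 * (10 * / q))).
    - apply Rmult_le_compat_l; [lra|]. apply Rmult_le_compat; auto using Rabs_pos; lra.
    - replace (U * (27 * (10 * / q))) with (270 * (U * / q)) by ring. lra. }
  (* Regrouped so that every singular factor appears inside one of the bounded quantities
     [1/Q - 1/q], [T/Q], [(T - U)/Q^2] and [U (1/Q^2 - 1/q^2)]. *)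
  replace (- (1 + 2 * T) / Q + 2 * T * (1 + T) / Q ^ 2 - (U - V) / q ^ 2) with
    (- (/ Q - / q) - 2 * (T * / Q) + 2 * ((T - U) * (/ Q * / Q)) + 2 * (U * ((/ Q - / q) * (/ Q + / q))) + 2 * ((T * / Q) * (T * / Q))).
  2:{ replace V with (q - U) by (unfold q; ring). field. split; lra. }
  assert (k5 : 0 <= (T * / Q) * (T * / Q) <= 1) by nra.
  apply Rabs_le_between in k1. apply Rabs_le_between in k4. apply Rabs_le. lra.
Qed.

(** * The mean over a period *)

Lemma lnq_ex_RInt b x y : 0 < b -> ex_RInt (fun x => lnq x b) x y.
Proof. intros; apply ex_RInt_cont; intros; apply lnq_cont; assumption. Qed.

Definition lnq_mean (y b : R) : R := RInt (fun x => lnq x b) y (y + 1).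

(** After halving the variable, the two terms of [lnq_double] run over adjacent halves of one full
    period at height [b / 2]. *)
Lemma lnq_mean_double y b : 0 < b -> lnq_mean y b = 2 * lnq_mean (y / 2) (b / 2).
Proof.
  intros hb. unfold lnq_mean.
  assert (hb2 : 0 < b / 2) by lra.
  set (f := fun x => lnq x (b / 2)).
  assert (e1 := RInt_comp_lin (V := R_CompleteNormedModule) f (1/2) 0 y (y + 1) (lnq_ex_RInt _ _ _ hb2)).
  assert (e2 := RInt_comp_lin (V := R_CompleteNormedModule) f (1/2) (1/2) y (y + 1) (lnq_ex_RInt _ _ _ hb2)).
  assert (c : forall v x, continuous (fun t => scal (1/2) (f (1/2 * t + v))) x).
  { intros v x. apply (continuous_scal_r (V := R_NormedModule) (1/2)).
    apply (continuous_comp (fun t => 1/2 * t + v) f).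
    - apply (ex_derive_continuous (K := R_AbsRing) (V := R_NormedModule)); auto_derive; auto.
    - apply lnq_cont, hb2. }
  match type of e1 with ?l = _ => match type of e2 with ?m = _ => transitivity (2 * (l + m)) end end.
  - rewrite (RInt_ext _ (fun x => scal 2 (plus (scal (1/2) (f (1/2 * x + 0))) (scal (1/2) (f (1/2 * x + 1/2)))))).
    + rewrite (RInt_scal (V := R_CompleteNormedModule)).
      * rewrite (RInt_plus (V := R_CompleteNormedModule)); [reflexivity | apply ex_RInt_cont, c | apply ex_RInt_cont, c].
      * apply (ex_RInt_plus (V := R_NormedModule)); apply ex_RInt_cont, c.
    + intros x _. rewrite (lnq_double x b hb). unfold scal, plus, f; simpl; unfold mult; simpl.
      replace (1/2 * x + 0) with (x / 2) by field. replace (1/2 * x + 1/2) with ((x + 1) / 2) by field. eqR; field.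
  - rewrite e1, e2. f_equal.
    assert (e3 := RInt_Chasles (V := R_CompleteNormedModule) f (y / 2) (y / 2 + 1/2) (y / 2 + 1) (lnq_ex_RInt _ _ _ hb2) (lnq_ex_RInt _ _ _ hb2)).
    rewrite <- e3. unfold plus; simpl. f_equal; f_equal; field.
Qed.

(** [sinh^2 + sin^2] lies between [sinh^2] and [cosh^2], both of size [e^(2 PI b)]; the linear term
    of [lnq] cancels this growth, uniformly for [b >= b0]. *)
Lemma lnq_bound b0 : 0 < b0 -> exists C, forall x b, b0 <= b -> Rabs (lnq x b) <= C.
Proof.
  intros h0. pose proof PI_RGT_0.
  assert (hE : 0 < 1 - exp (- (2 * (PI * b0)))).
  { pose proof (exp_increasing (- (2 * (PI * b0))) 0) as e. rewrite exp_0 in e.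
    assert (0 < PI * b0) by (apply Rmult_lt_0_compat; lra). lra. }
  exists (ln 2 + Rabs (ln (1 - exp (- (2 * (PI * b0)))))). intros x b hb.
  assert (hub : PI * b0 <= PI * b) by (apply Rmult_le_compat_l; lra).
  assert (hu : 0 < PI * b0) by (apply Rmult_lt_0_compat; lra).
  unfold lnq. set (u := PI * b) in *. pose proof (sinh_pos u ltac:(lra)) as hS.
  pose proof (pow_lt _ 2 hS) as hS2. pose proof (pow2_ge_0 (sin (PI * x))) as hs.
  assert (hs1 : sin (PI * x) ^ 2 <= 1) by (pose proof (SIN_bound (PI * x)); nra).
  assert (hc : 0 < cosh u) by (unfold cosh; pose proof (exp_pos u); pose proof (exp_pos (- u)); lra).
  assert (lo : ln (sinh u ^ 2) <= ln (sinh u ^ 2 + sin (PI * x) ^ 2)) by (apply ln_le; lra).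
  assert (hi : ln (sinh u ^ 2 + sin (PI * x) ^ 2) <= ln (cosh u ^ 2)).
  { apply ln_le; [lra|]. rewrite cosh2; lra. }
  rewrite !ln_pow in * by assumption. simpl INR in *.
  assert (hi2 : ln (cosh u) <= u).
  { rewrite <- (ln_exp u) at 2. apply ln_le; [assumption|]. unfold cosh. pose proof (exp_le_compat (- u) u ltac:(lra)). lra. }
  assert (lo2 : u - ln 2 + ln (1 - exp (- (2 * (PI * b0)))) <= ln (sinh u)).
  { rewrite <- (ln_exp u) at 1. rewrite <- ln_div, <- ln_mult; try lra; try apply exp_pos.
    2:{ pose proof (exp_pos u); lra. }
    apply ln_le. { apply Rmult_lt_0_compat; [pose proof (exp_pos u); lra | assumption]. }
    unfold sinh.
    assert (exp (- u) <= exp u * exp (- (2 * (PI * b0)))) by (rewrite <- exp_plus; apply exp_le_compat; lra). lra. }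
  assert (l2 : 0 < ln 2) by (rewrite <- ln_1; apply ln_increasing; lra).
  set (L := ln (1 - exp (- (2 * (PI * b0))))) in *.
  pose proof (Rle_abs (- L)) as hL; rewrite Rabs_Ropp in hL. pose proof (Rabs_pos L).
  apply Rabs_le. lra.
Qed.

(* Doubling [r] times multiplies the mean by [2 ^ r] while [lnq] stays bounded. *)
Lemma lnq_mean_zero y b : 0 < b -> lnq_mean y b = 0.
Proof.
  intros hb. destruct (lnq_bound b hb) as [C hC].
  assert (hr : forall r, lnq_mean (2 ^ r * y) (2 ^ r * b) = 2 ^ r * lnq_mean y b).
  { induction r as [|r IH]; [rewrite !pow_O, !Rmult_1_l; reflexivity|].
    assert (0 < 2 ^ r) by (apply pow_lt; lra).
    rewrite lnq_mean_double by (simpl; apply Rmult_lt_0_compat; lra).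
    replace (2 ^ S r * y / 2) with (2 ^ r * y) by (simpl; field). replace (2 ^ S r * b / 2) with (2 ^ r * b) by (simpl; field).
    rewrite IH. simpl; ring. }
  assert (hb' : forall r, 2 ^ r * Rabs (lnq_mean y b) <= C).
  { intros r. assert (h1 : 1 <= 2 ^ r) by (apply pow_R1_Rle; lra).
    rewrite <- (Rabs_pos_eq (2 ^ r)), <- Rabs_mult, <- hr by lra. unfold lnq_mean.
    eapply Rle_trans; [apply abs_RInt_le_const with (M := C)|].
    - lra.
    - apply lnq_ex_RInt. nra.
    - intros; apply hC. nra.
    - right; ring. }
  destruct (Req_dec (lnq_mean y b) 0) as [e|e]; [assumption|exfalso].
  apply Rabs_pos_lt in e. set (q := Rabs (lnq_mean y b)) in *.
  destruct (Pow_x_infinity 2 ltac:(rewrite Rabs_pos_eq; lra) (C / q + 1)) as [n hn].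
  specialize (hn n (le_n _)). rewrite Rabs_pos_eq in hn by (apply pow_le; lra).
  specialize (hb' n). apply Rge_le in hn.
  apply (Rmult_le_compat_r q) in hn; [|lra]. replace ((C / q + 1) * q) with (C + q) in hn by (field; lra). lra.
Qed.

Lemma CI0_RtoC (f : R -> R) : (forall t, continuous f t) -> CI 0 (fun t => RtoC (f t)) = RtoC (RInt f 0 1).
Proof.
  intros h. apply is_CInt_unique. split.
  - rewrite Re_RtoC. apply (is_RInt_ext f). { intros; simpl; ring. }
    apply (RInt_correct (V := R_CompleteNormedModule)), ex_RInt_cont, h.
  - rewrite Im_RtoC. apply (is_RInt_ext (fun _ => 0)). { intros; simpl; ring. }
    evar_last; [apply (is_RInt_const (V := R_NormedModule))|]. unfold scal; simpl; unfold mult; simpl. Rring.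
Qed.

Lemma CI0_lnq y b : 0 < b -> CI 0 (fun t => RtoC (lnq (y + t) b)) = 0%C.
Proof.
  intros hb. rewrite (CI0_RtoC (fun t => lnq (y + t) b)).
  - transitivity (RtoC (lnq_mean y b)); [f_equal; unfold lnq_mean | now rewrite lnq_mean_zero].
    assert (e := RInt_comp_lin (V := R_CompleteNormedModule) (fun x => lnq x b) 1 y 0 1 (lnq_ex_RInt _ _ _ hb)).
    replace (1 * 0 + y) with y in e by ring. replace (1 * 1 + y) with (y + 1) in e by ring.
    etransitivity; [| exact e]. apply RInt_ext. intros x _. unfold scal; simpl; unfold mult; simpl. rewrite Rmult_1_l. f_equal. ring.
  - intros t. apply (continuous_comp (fun t => y + t) (fun x => lnq x b)); [|apply lnq_cont, hb].
    apply (ex_derive_continuous (K := R_AbsRing) (V := R_NormedModule)); auto_derive; auto.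
Qed.

(** Strictness provides the margin [2 - PI / 2 > 0] for the shift [a]. If [PI] were [4], [sin 1]
    would have square [1/2], against [sin 1 >= 5/6]. *)
Lemma PI_lt_4 : PI < 4.
Proof.
  destruct PI_4 as [h|h]; [assumption|exfalso].
  destruct (sin_bounds 1 ltac:(lra)) as [_ h1].
  assert (e : sin 1 = 1 / sqrt 2) by (rewrite <- sin_PI4; f_equal; lra).
  pose proof (sqrt_sqrt 2 ltac:(lra)) as q. pose proof (sqrt_lt_R0 2 ltac:(lra)) as q0.
  assert (e2 : sin 1 * sin 1 = 1 / 2).
  { rewrite e. replace (1 / 2) with (1 / (sqrt 2 * sqrt 2)) by (rewrite q; reflexivity). field. lra. }
  simpl in h1. nra.
Qed.

(** * The row remainder at zero *)

(** The cofactor of [2 s k^2] in [fp2], taken at [s = 0]. With [b = 1 / k], the function [k^2 phi2]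
    is minus the second derivative of [ln (x^2 + b^2) / 2]. *)
Definition phi2 (k x : R) : C := (1 * fp k 1 x + (- (2)) * fp k 2 x)%C.

Lemma phi2_is k a : 0 < k -> is_Cser (termZ 2 (phi2 k) a) (tau 2 k a 1 - 2 * tau 2 k a 2)%C.
Proof.
  intros hk. unfold phi2.
  eapply is_Cser_ext; [| eapply is_Cser_eq; [apply is_Cser_plus; apply is_Cser_Cmult; apply (tau_is 2 k a)|]].
  - intros j; cbv beta. rewrite termZ_lin; [reflexivity | apply Ccont_fp | apply Ccont_fp].
  - assumption.
  - simpl; lra.
  - assumption.
  - simpl; lra.
  - ring.
Qed.

Lemma phi2_eq b x : 0 < b -> (RtoC ((/ b) ^ 2) * phi2 (/ b) x)%C = RtoC ((x ^ 2 - b ^ 2) / (x ^ 2 + b ^ 2) ^ 2).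
Proof.
  intros hb. unfold phi2, fp. replace (RtoC 2) with (1 + 1)%C at 2 by (rewrite <- RtoC_plus; f_equal; ring).
  rewrite pw_plus1, pw_1 by apply G_pos.
  replace (RtoC ((/ b) ^ 2) * _)%C with (RtoC ((/ b) ^ 2 * (/ G (/ b) x - 2 * (/ G (/ b) x * / G (/ b) x)))).
  2:{ rewrite RtoC_mult, RtoC_minus, !RtoC_mult. ring. }
  f_equal. unfold G. assert (0 < x ^ 2 + b ^ 2) by (pose proof (pow2_ge_0 x); pose proof (pow_lt b 2 hb); lra).
  field. simpl in *; repeat split; nra.
Qed.

Lemma CI_bound p f M : (forall t, 0 <= t <= 1 -> Ccont f t) -> (forall t, 0 <= t <= 1 -> Cmod (f t) <= M) ->
  Cmod (CI p f) <= 2 * (2 ^ p * M).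
Proof.
  intros hc h. replace (2 * (2 ^ p * M)) with (2 * ((1 - 0) * (2 ^ p * M))) by ring.
  refine (is_CInt_bound _ 0 1 _ (2 ^ p * M) _ _ (CInt_correct _ 0 1 _)); [lra| |].
  - intros t ht. rewrite Cmod_mult, Cmod_R. apply Rmult_le_compat; auto using Rabs_pos, Cmod_ge_0. apply bern_bound, ht.
  - rewrite Rmin_left, Rmax_right by lra. intros t ht. apply Ccont_mult; auto. apply Ccont_RtoC, bern_cont.
Qed.

Lemma phi2_cont k x : Ccont (phi2 k) x.
Proof. apply Ccont_plus; apply Ccont_mult; try apply Ccont_const; apply Ccont_fp. Qed.

(* The rescaled second derivative of [lnq] differs from that of [ln (x^2 + b^2) / 2] by [O(1 / N^2)] on each of the [N = 2 ^ (r + 1)] cells. *)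
Lemma phi2_csum a b r : 0 < b -> PI * b <= 2 ^ S r -> (2 - PI / 2) * 2 ^ S r >= PI * Rabs a ->
  Cmod (RtoC ((/ b) ^ 2) * csum (termZ 2 (phi2 (/ b)) a) (2 ^ r) - RtoC (lnq a b))%C <= 16000 * PI ^ 2 / 2 ^ S r.
Proof.
  intros hb hN1 hN2. pose proof PI_RGT_0 as hpi.
  set (y := - INR (2 ^ r) - a).
  assert (e1 : csum (termZ 2 (phi2 (/ b)) a) (2 ^ r) = csum (fun m => CI 2 (fun t => phi2 (/ b) (y + INR m + t))) (2 ^ S r)).
  { change (2 ^ S r)%nat with (2 * 2 ^ r)%nat. symmetry. apply (csum_sym (fun z => CI 2 (fun t => phi2 (/ b) (z + t)))). }
  assert (e2 := lnq2_sum b (S r) y hb). rewrite CI0_lnq in e2 by assumption.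
  (* [y] is [- 2^r - a], and [lnq] is even and of period [1] in its first argument. *)
  replace (lnq y b) with (lnq a b) in e2.
  2:{ unfold y. rewrite <- (lnq_plus_nat _ b (2 ^ r)), <- lnq_opp. f_equal. ring. }
  rewrite e1, <- csum_Cmult.
  set (N := 2 ^ S r) in *. assert (hN : 0 < N) by (apply pow_lt; lra).
  assert (hn : INR (2 ^ S r) = N) by (rewrite pow_INR; reflexivity).
  assert (hn2 : INR (2 ^ r) = N / 2) by (unfold N; rewrite pow_INR; change (INR 2) with 2; rewrite <- tech_pow_Rmult; field).
  set (c := PI / N). assert (hc : 0 < c) by (apply Rdiv_lt_0_compat; assumption).
  replace (csum _ _ - RtoC (lnq a b))%C with
    (csum (fun m => RtoC ((/ b) ^ 2) * CI 2 (fun t => phi2 (/ b) (y + INR m + t)) + CI 2 (fun t => RtoC (lnq2 c (b / N) (y + INR m + t))))%C (2 ^ S r)).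
  2:{ rewrite csum_plus. unfold c. rewrite e2. ring. }
  (* There are [N] cells; on each, [CI_bound] for [bern 2] gives [2 * 2^2], the rescaling gives
     [c^2], and [lnq2_shape_bound] gives [2000]. *)
  replace (16000 * PI ^ 2 / N) with (INR (2 ^ S r) * (16000 * c ^ 2)) by (rewrite hn; unfold c; field; lra).
  apply csum_le. intros m hm.
  assert (hm' : INR m + 1 <= N) by (rewrite <- hn, <- S_INR; apply le_INR; lia).
  assert (hcd : forall t, Ccont (fun t => RtoC (lnq2 c (b / N) (y + INR m + t))) t).
  { intros t. apply (Ccont_shift (fun x => RtoC (lnq2 c (b / N) x))), Ccont_RtoC, lnq2_cont. apply Rdiv_lt_0_compat; assumption. }
  replace (RtoC ((/ b) ^ 2) * CI 2 (fun t => phi2 (/ b) (y + INR m + t)) + CI 2 (fun t => RtoC (lnq2 c (b / N) (y + INR m + t))))%C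
   with (CI 2 (fun t => RtoC ((/ b) ^ 2) * phi2 (/ b) (y + INR m + t) + 1 * RtoC (lnq2 c (b / N) (y + INR m + t)))%C).
  2:{ rewrite (CI_lin 2 (fun t => phi2 (/ b) (y + INR m + t))); [ring | intros; apply Ccont_shift, phi2_cont | auto]. }
  eapply Rle_trans; [apply CI_bound with (M := c ^ 2 * 2000)|].
  - intros. apply Ccont_plus; apply Ccont_mult; try apply Ccont_const; auto. apply Ccont_shift, phi2_cont.
  - intros t ht. rewrite phi2_eq by assumption. set (x := y + INR m + t).
    rewrite Cmult_1_l, <- RtoC_plus, Cmod_R.
    assert (hv : Rabs (c * x) <= 2).
    { rewrite Rabs_mult, (Rabs_pos_eq c) by lra.
      assert (Rabs x <= N / 2 + Rabs a).
      { pose proof (pos_INR m). unfold x, y. rewrite hn2. pose proof (Rle_abs a). pose proof (Rle_abs (- a)) as z; rewrite Rabs_Ropp in z.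
        apply Rabs_le. lra. }
      apply Rle_trans with (c * (N / 2 + Rabs a)); [apply Rmult_le_compat_l; lra|].
      replace (c * (N / 2 + Rabs a)) with (PI / 2 + PI * Rabs a / N) by (unfold c; field; lra).
      assert (PI * Rabs a / N <= 2 - PI / 2).
      { apply Rmult_le_reg_r with N; [assumption|]. unfold Rdiv at 1. rewrite Rmult_assoc, Rinv_l by lra. lra. }
      lra. }
    assert (hu : 0 < c * b <= 1).
    { split; [apply Rmult_lt_0_compat; lra|]. replace (c * b) with (PI * b / N) by (unfold c; field; lra).
      apply Rmult_le_reg_r with N; [assumption|]. unfold Rdiv. rewrite Rmult_assoc, Rinv_l by lra. lra. }
    pose proof (lnq2_shape_bound (c * b) (c * x) hu hv) as hk.
    unfold lnq2. replace (PI * (b / N)) with (c * b) by (unfold c; field; lra).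
    assert (hx : 0 < x ^ 2 + b ^ 2) by (pose proof (pow2_ge_0 x); pose proof (pow_lt b 2 hb); lra).
    replace ((x ^ 2 - b ^ 2) / (x ^ 2 + b ^ 2) ^ 2) with (- (c ^ 2 * ((((c * b) ^ 2 - (c * x) ^ 2) / ((c * b) ^ 2 + (c * x) ^ 2) ^ 2)))).
    2:{ replace ((c * b) ^ 2 + (c * x) ^ 2) with (c ^ 2 * (x ^ 2 + b ^ 2)) by ring. field. split; lra. }
    rewrite Rplus_comm. change (?a + - ?b) with (a - b). rewrite <- Rmult_minus_distr_l, Rabs_mult, (Rabs_pos_eq (c ^ 2)) by apply pow2_ge_0.
    apply Rmult_le_compat_l; [apply pow2_ge_0 | exact hk].
  - right; simpl; ring.
Qed.

Lemma csum_sum_n f n : Re (csum f (S n)) = sum_n (fun k => Re (f k)) n /\ Im (csum f (S n)) = sum_n (fun k => Im (f k)) n.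
Proof.
  induction n as [|n [IH1 IH2]].
  - rewrite !sum_O. change (csum f 1) with (0 + f 0%nat)%C. rewrite Cplus_0_l. split; reflexivity.
  - rewrite !sum_Sn, <- IH1, <- IH2. split; reflexivity.
Qed.

Lemma is_Cser_csum f l : is_Cser f l -> Clim (csum f) l.
Proof.
  intros [h1 h2]; split.
  - apply (is_lim_seq_incr_1 (fun n => Re (csum f n))).
    apply (is_lim_seq_ext (sum_n (fun k => Re (f k)))); [intros; symmetry; apply csum_sum_n | exact h1].
  - apply (is_lim_seq_incr_1 (fun n => Im (csum f n))).
    apply (is_lim_seq_ext (sum_n (fun k => Im (f k)))); [intros; symmetry; apply csum_sum_n | exact h2].
Qed.

Lemma pow2_ge_n n : (n <= 2 ^ n)%nat.
Proof. induction n as [|n IH]; simpl; [lia|]. pose proof (Nat.pow_nonzero 2 n ltac:(lia)). lia. Qed.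

Lemma Clim_subseq_pow2 u l : Clim u l -> Clim (fun r => u (2 ^ r)%nat) l.
Proof.
  assert (h : filterlim (fun r => 2 ^ r)%nat eventually eventually).
  { intros P [N hN]. exists N. intros n hn. apply hN. pose proof (pow2_ge_n n). lia. }
  intros [a b]; split.
  - apply (is_lim_seq_subseq (fun n => Re (u n)) _ _ h a).
  - apply (is_lim_seq_subseq (fun n => Im (u n)) _ _ h b).
Qed.

Lemma Clim_ext_ev u v l N : (forall n, (N <= n)%nat -> u n = v n) -> Clim u l -> Clim v l.
Proof.
  intros e [a b]; split; [eapply is_lim_seq_ext_loc; [|apply a] | eapply is_lim_seq_ext_loc; [|apply b]];
  exists N; intros n hn; now rewrite e.
Qed.

(** The series of [phi2_is] converges, so its limit may be read off along the first [2^r] pairs of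
    cells, where [phi2_csum] applies. Together with the factor [2] of [tau_up], the derivative of a
    row remainder at [0] becomes [2 lnq]. *)
Lemma tau_lnq k a : 0 < k -> (RtoC (k ^ 2) * (tau 2 k a 1 - 2 * tau 2 k a 2))%C = RtoC (lnq a (/ k)).
Proof.
  intros hk. set (b := / k). assert (hb : 0 < b) by (apply Rinv_0_lt_compat; assumption).
  replace k with (/ b) by (unfold b; rewrite Rinv_inv; reflexivity). clearbody b.
  assert (hkb : 0 < / b) by (apply Rinv_0_lt_compat; assumption).
  assert (h1 := Clim_scal ((/ b) ^ 2) _ _ (Clim_subseq_pow2 _ _ (is_Cser_csum _ _ (phi2_is (/ b) a hkb)))).
  apply (Clim_unique _ _ _ h1).
  pose proof PI_RGT_0 as hpi. pose proof PI_lt_4 as hpi4.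
  destruct (Pow_x_infinity 2 ltac:(rewrite Rabs_pos_eq; lra) (PI * b + PI * Rabs a / (2 - PI / 2))) as [r0 hr0].
  set (v := fun r => (RtoC ((/ b) ^ 2) * csum (termZ 2 (phi2 (/ b)) a) (2 ^ r) - RtoC (lnq a b))%C).
  assert (hv : Clim v 0%C).
  (* Below [r0] the hypotheses of [phi2_csum] need not hold; replacing these terms by zero makes the
     bound valid for every [r]. *)
  { apply Clim_ext_ev with (fun r => if le_dec r0 r then v r else RtoC 0) r0.
    { intros n hn. destruct (le_dec r0 n); [reflexivity | contradiction]. }
    apply Clim_0 with (fun r => 16000 * PI ^ 2 / (INR r + 1)).
    - intros r. destruct (le_dec r0 r) as [hr|hr].
      + assert (hq : PI * b + PI * Rabs a / (2 - PI / 2) <= 2 ^ S r).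
        { specialize (hr0 (S r) ltac:(unfold ge; lia)). rewrite Rabs_pos_eq in hr0 by (apply pow_le; lra). lra. }
        assert (0 <= PI * Rabs a / (2 - PI / 2)).
        { apply Rmult_le_pos; [apply Rmult_le_pos; [lra | apply Rabs_pos] | left; apply Rinv_0_lt_compat; lra]. }
        assert (0 < PI * b) by (apply Rmult_lt_0_compat; assumption).
        eapply Rle_trans; [apply phi2_csum; [assumption | lra |]|].
        * apply Rle_ge. replace (PI * Rabs a) with ((2 - PI / 2) * (PI * Rabs a / (2 - PI / 2))) by (field; lra).
          apply Rmult_le_compat_l; lra.
        * apply Rmult_le_compat_l. { pose proof (pow2_ge_0 PI); lra. }
          pose proof (pos_INR r). apply Rinv_le_contravar; [lra|].
          rewrite <- S_INR. replace (2 ^ S r) with (INR (2 ^ S r)) by (rewrite pow_INR; reflexivity).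
          apply le_INR, pow2_ge_n.
      + rewrite Cmod_0. pose proof (pos_INR r). apply Rmult_le_pos; [pose proof (pow2_ge_0 PI); lra | left; apply Rinv_0_lt_compat; lra].
    - apply lim_inv_S. }
  assert (hc : Clim (fun _ => RtoC (lnq a b)) (RtoC (lnq a b))) by (split; apply is_lim_seq_const).
  replace (RtoC (lnq a b)) with (0 + RtoC (lnq a b))%C by ring.
  eapply Clim_ext; [|apply (Clim_plus _ _ _ _ hv hc)]. intros r. unfold v. ring.
Qed.

(** * Stirling's constant *)

Lemma CInt_reflect (f : R -> C) : (forall t, Ccont f t) -> CInt (fun t => f (1 - t)%R) 0 1 = CInt f 0 1.
Proof.
  intros h.
  assert (k : forall g : R -> R, (forall t, continuous g t) -> RInt (fun t => g (1 - t)) 0 1 = RInt g 0 1).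
  { intros g hg.
    assert (e := RInt_comp_lin (V := R_CompleteNormedModule) g (-1) 1 0 1 (ex_RInt_cont _ _ _ hg)).
    replace (-1 * 0 + 1) with 1 in e by ring. replace (-1 * 1 + 1) with 0 in e by ring.
    rewrite <- (opp_RInt_swap (V := R_CompleteNormedModule) g 1 0), <- e by (apply ex_RInt_cont, hg).
    rewrite <- (RInt_opp (V := R_CompleteNormedModule)).
    - apply RInt_ext. intros x _. unfold opp, scal; simpl; unfold mult; simpl. replace (-1 * x + 1) with (1 - x) by ring. Rring.
    - apply ex_RInt_cont. intros t. apply (continuous_scal_r (V := R_NormedModule) (-1)).
      apply (continuous_comp (fun t => -1 * t + 1) g); [|apply hg].
      apply (ex_derive_continuous (K := R_AbsRing) (V := R_NormedModule)); auto_derive; auto. }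
  unfold CInt. f_equal.
  - apply (k (fun t => Re (f t))). intros t; exact (proj1 (h t)).
  - apply (k (fun t => Im (f t))). intros t; exact (proj2 (h t)).
Qed.

Lemma CI2_reflect (f : R -> C) : (forall t, Ccont f t) -> CI 2 (fun t => f (1 - t)%R) = CI 2 f.
Proof.
  intros h. unfold CI. rewrite <- (CInt_reflect (fun t => RtoC (bern 2 t) * f t)%C).
  - apply CInt_ext. intros t _. rewrite !bern_2. do 2 f_equal. field.
  - intros t; apply Ccont_mult; [apply Ccont_RtoC, bern_cont | apply h].
Qed.

(* Minus the second derivative of [ln (x^2 + b^2) / 2]. *)
Definition log_curv (b x : R) : R := (x ^ 2 - b ^ 2) / (x ^ 2 + b ^ 2) ^ 2.

Lemma log_curv_cont b x : 0 < b -> continuous (log_curv b) x.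
Proof.
  intros hb. unfold log_curv. apply (ex_derive_continuous (K := R_AbsRing) (V := R_NormedModule)). auto_derive.
  pose proof (pow2_ge_0 x). pose proof (pow_lt b 2 hb). simpl in *. nra.
Qed.

Lemma Ccont_log_curv b y t : 0 < b -> Ccont (fun t => RtoC (log_curv b (y + t))) t.
Proof. intros; apply (Ccont_shift (fun x => RtoC (log_curv b x))), Ccont_RtoC, log_curv_cont; assumption. Qed.

(** The case [a = 0] of [tau_lnq]: the cells of a pair are mirror images, and [bern 2] is symmetric
    about [1/2], whence the factor [2]. *)
Lemma log_curv_is b : 0 < b -> is_Cser (fun j => 2 * CI 2 (fun t => RtoC (log_curv b (INR j + t))))%C (RtoC (lnq 0 b)).
Proof.
  intros hb. assert (hk : 0 < / b) by (apply Rinv_0_lt_compat; assumption).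
  assert (h := is_Cser_Cmult _ _ (RtoC ((/ b) ^ 2)) (phi2_is (/ b) 0 hk)).
  rewrite tau_lnq, Rinv_inv in h by assumption.
  eapply is_Cser_ext; [|apply h]. intros j; cbv beta. unfold termZ.
  assert (e : forall y, (RtoC ((/ b) ^ 2) * CI 2 (fun t => phi2 (/ b) (y + t)))%C = CI 2 (fun t => RtoC (log_curv b (y + t)))).
  { intros y. transitivity (CI 2 (fun t => RtoC ((/ b) ^ 2) * phi2 (/ b) (y + t) + 0 * phi2 (/ b) (y + t))%C).
    - rewrite (CI_lin 2 (fun t => phi2 (/ b) (y + t)) (fun t => phi2 (/ b) (y + t))) by (intros; apply Ccont_shift, phi2_cont). ring.
    - apply CI_ext. intros t _. unfold log_curv. rewrite <- phi2_eq by assumption. ring. }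
  rewrite Cmult_plus_distr_l, !e.
  replace (CI 2 (fun t => RtoC (log_curv b (-1 - INR j - 0 + t)))) with (CI 2 (fun t => RtoC (log_curv b (INR j + t)))).
  - rewrite Rminus_0_r. ring.
  - rewrite <- (CI2_reflect (fun t => RtoC (log_curv b (INR j + t)))) by (intros; apply Ccont_log_curv, hb).
    apply CI_ext. intros t _. unfold log_curv. replace ((INR j + (1 - t)) ^ 2) with ((-1 - INR j - 0 + t) ^ 2) by ring. reflexivity.
Qed.

Lemma pw_2 x : 0 < x -> pw x 2%C = RtoC (/ x ^ 2).
Proof.
  intros h. replace (RtoC 2) with (1 + 1)%C by (rewrite <- RtoC_plus; f_equal; ring).
  rewrite pw_plus1, pw_1, <- RtoC_mult by assumption. f_equal. field. lra.
Qed.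

Lemma log_curv_close b x : 0 < b <= 1 -> 1 <= x -> Rabs (log_curv b x - / x ^ 2) <= 4 * b ^ 2 * / x ^ 2.
Proof.
  intros hb hx. unfold log_curv.
  assert (hx2 : 1 <= x ^ 2) by nra. assert (hb2 : 0 < b ^ 2) by (apply pow_lt; lra). assert (b ^ 2 <= 1) by nra.
  set (X := x ^ 2) in *. set (c := b ^ 2) in *.
  replace ((X - c) / (X + c) ^ 2 - / X) with (- ((3 * c * X + c * c) / (X + c) ^ 2 * / X)) by (field; split; lra).
  rewrite Rabs_Ropp, Rabs_mult, (Rabs_pos_eq (/ X)) by (left; apply Rinv_0_lt_compat; lra).
  apply Rmult_le_compat_r; [left; apply Rinv_0_lt_compat; lra|].
  assert (hq : 0 < (X + c) ^ 2) by (apply pow_lt; lra).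
  assert (p1 : X <= (X + c) ^ 2) by nra.
  assert (p2 : c * X <= c * (X + c) ^ 2) by (apply Rmult_le_compat_l; lra).
  assert (p3 : 0 <= c * c <= c * X) by (split; [apply Rmult_le_pos; lra | apply Rmult_le_compat_l; lra]).
  rewrite Rabs_pos_eq.
  - apply Rmult_le_reg_r with ((X + c) ^ 2); [assumption|]. unfold Rdiv. rewrite Rmult_assoc, Rinv_l by lra. lra.
  - apply Rmult_le_pos; [lra | left; apply Rinv_0_lt_compat, hq].
Qed.

(** The cell at the origin has to be kept exact, because the limit [1 / x^2] of [log_curv] is not
    integrable there. Its term [ln b / 2] cancels the logarithmic singularity of [lnq 0 b]. *)
Lemma c0_value b : 0 < b -> CI 2 (fun t => RtoC (log_curv b (0 + t))) =
  RtoC (- (1/12 / (1 + b ^ 2)) + 1/2 * ln b + 1/4 * ln (1 + b ^ 2) - (1/2 * ln (1 + b ^ 2) - 1 + b * atan (/ b))).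
Proof.
  intros hb.
  set (phi := fun x => ln (x ^ 2 + b ^ 2) / 2). set (phi' := fun x => x / (x ^ 2 + b ^ 2)). set (phi'' := fun x => - log_curv b x).
  assert (hp : forall x, 0 < x ^ 2 + b ^ 2) by (intros x; pose proof (pow2_ge_0 x); pose proof (pow_lt b 2 hb); lra).
  assert (h1 : forall x, is_derive phi x (phi' x)).
  { intros x. unfold phi, phi'. pose proof (hp x). auto_derive; [simpl in *; lra | field; simpl in *; lra]. }
  assert (h2 : forall x, is_derive phi' x (phi'' x)).
  { intros x. unfold phi', phi'', log_curv. pose proof (hp x). auto_derive; [simpl in *; lra | field; simpl in *; lra]. }
  assert (h3 : forall x, continuous phi'' x).
  { intros x. apply (continuous_opp (log_curv b)), log_curv_cont, hb. }
  pose proof (CI2_EM phi phi' phi'' 0 h1 h2 h3) as e.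
  assert (hc : forall x, continuous (fun t => phi (0 + t)) x).
  { intros x. apply (continuous_ext phi); [intros; now rewrite Rplus_0_l|].
    apply (ex_derive_continuous (K := R_AbsRing) (V := R_NormedModule)). eexists; apply h1. }
  rewrite (CI0_RtoC (fun t => phi (0 + t))) in e by assumption.
  assert (ei : RInt (fun t => phi (0 + t)) 0 1 = 1/2 * ln (1 + b ^ 2) - 1 + b * atan (/ b)).
  { apply is_RInt_unique. evar_last.
    apply (is_RInt_derive (V := R_CompleteNormedModule) (fun x => x * phi x - x + b * atan (x / b)) (fun t => phi (0 + t))).
    - intros x _. rewrite Rplus_0_l. evar_last.
      apply (is_derive_plus (V := R_NormedModule)).
      apply (is_derive_minus (V := R_NormedModule)). apply Derive.is_derive_mult; [apply (is_derive_id (K := R_AbsRing)) | apply h1].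
      apply (is_derive_id (K := R_AbsRing)).
      apply is_derive_scal. apply (is_derive_comp atan (fun x => x / b)); [apply is_derive_atan | auto_derive; [auto | reflexivity]].
      unfold plus, minus, opp, one, scal; simpl; unfold mult, plus; simpl. unfold phi', Rsqr. eqR. field. pose proof (hp x). simpl in *. repeat split; nra.
    - intros x _. apply hc.
    - unfold minus, plus, opp; simpl. unfold phi. replace (1 ^ 2 + b ^ 2) with (1 + b ^ 2) by ring.
      replace (0 / b) with 0 by (field; lra). rewrite atan_0. replace (1 / b) with (/ b) by (field; lra). replace (1 + b * (b * 1)) with (1 + b ^ 2) by ring. eqR. field. }
  rewrite ei in e.
  assert (en : CI 2 (fun t => RtoC (log_curv b (0 + t))) = (- CI 2 (fun t => RtoC (phi'' (0 + t)%R)))%C).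
  { rewrite (CI_ext 2 (fun t => RtoC (phi'' (0 + t)%R)) (fun t => (- (1)) * RtoC (log_curv b (0 + t)) + 0 * RtoC (log_curv b (0 + t)))%C).
    - rewrite (CI_lin 2 (fun t => RtoC (log_curv b (0 + t))) (fun t => RtoC (log_curv b (0 + t)))) by (intros; apply Ccont_log_curv, hb). ring.
    - intros t _. unfold phi''. rewrite RtoC_opp. ring. }
  rewrite en, e. unfold phi, phi'. replace ((0 + 1) ^ 2 + b ^ 2) with (1 + b ^ 2) by ring. replace (0 ^ 2 + b ^ 2) with (b ^ 2) by ring.
  rewrite ln_pow by assumption. simpl INR.
  replace (RtoC 1 / RtoC 2)%C with (RtoC (1/2)) by (rewrite <- RtoC_div by lra; reflexivity).
  rewrite <- !RtoC_plus, <- RtoC_minus, <- !RtoC_mult, <- RtoC_minus, <- RtoC_plus, <- RtoC_opp. f_equal.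
  pose proof (pow_lt b 2 hb). field. lra.
Qed.

Lemma is_Cser_tail f l : is_Cser f l -> is_Cser (fun k => f (S k)) (l - f 0%nat)%C.
Proof.
  intros [h1 h2]; split.
  - apply (is_series_incr_1 (fun k => Re (f k))). eapply is_series_eq; [apply h1|]. rewrite Re_minus. unfold plus; simpl. Rring.
  - apply (is_series_incr_1 (fun k => Im (f k))). eapply is_series_eq; [apply h2|]. rewrite Im_minus. unfold plus; simpl. Rring.
Qed.

(** Beyond the first cell [log_curv b x] is within [4 b^2 / x^2] of [1 / x^2], and the sum of
    [1 / x^2] against [bern 2] is [J 2 2]. The constant [64] is [2 * (2 * 2^2) * 4]. *)
Lemma tail_close : exists K, forall b, 0 < b <= 1 ->
  Cmod (RtoC (lnq 0 b) - 2 * CI 2 (fun t => RtoC (log_curv b (0 + t))) - 2 * J 2 2)%C <= K * b ^ 2.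
Proof.
  destruct ex_series_inv2 as [S hS]. exists (2 * (64 * S)). intros b hb.
  assert (h := is_Cser_plus _ _ _ _ (is_Cser_tail _ _ (log_curv_is b (proj1 hb))) (is_Cser_Cmult _ _ (- (2))%C (J_is 2 2%C ltac:(simpl; lra)))).
  replace (RtoC (lnq 0 b) - 2 * CI 2 (fun t => RtoC (log_curv b (0 + t))) - 2 * J 2 2)%C with
    (RtoC (lnq 0 b) - 2 * CI 2 (fun t => RtoC (log_curv b (INR 0 + t))) + - (2) * J 2 2)%C by (simpl INR; ring).
  replace (2 * (64 * S) * b ^ 2) with (2 * (64 * b ^ 2 * S)) by ring.
  refine (is_Cser_bound _ (fun k => 64 * b ^ 2 * / (INR k + 1) ^ 2) _ _ _ h _).
  2: apply (is_series_scal (K := R_AbsRing) (V := R_NormedModule)), hS.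
  intros k; cbv beta.
  change (cell (bern 2) (hJ k) 2) with (CI 2 (fun t => pw (hJ k t) 2)).
  replace (2 * CI 2 (fun t => RtoC (log_curv b (INR (Datatypes.S k) + t))) + - (2) * CI 2 (fun t => pw (hJ k t) 2))%C with
    (2 * CI 2 (fun t => 1 * RtoC (log_curv b (INR (Datatypes.S k) + t)) + - (1) * pw (hJ k t) 2))%C.
  2:{ rewrite (CI_lin 2 (fun t => RtoC (log_curv b (INR (Datatypes.S k) + t))) (fun t => pw (hJ k t) 2)); [ring | intros; apply Ccont_log_curv; lra | intros; apply Ccont_pw_hJ; lra]. }
  rewrite Cmod_mult, Cmod_R, Rabs_pos_eq by lra.
  replace (64 * b ^ 2 * / (INR k + 1) ^ 2) with (2 * (2 * (2 ^ 2 * (4 * b ^ 2 * / (INR k + 1) ^ 2)))) by (simpl; ring).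
  apply Rmult_le_compat_l; [lra|]. apply CI_bound.
  - intros t ht. apply Ccont_plus; apply Ccont_mult; try apply Ccont_const; [apply Ccont_log_curv; lra | apply Ccont_pw_hJ; lra].
  - intros t ht. destruct (hJ_ge k t ltac:(lra)) as [g1 g2]. rewrite pw_2 by lra.
    replace (INR (Datatypes.S k) + t) with (hJ k t) by (unfold hJ; rewrite S_INR; ring).
    replace (1 * RtoC (log_curv b (hJ k t)) + - (1) * RtoC (/ hJ k t ^ 2))%C with (RtoC (log_curv b (hJ k t) - / hJ k t ^ 2)) by (rewrite RtoC_minus; ring).
    rewrite Cmod_R. eapply Rle_trans; [apply log_curv_close; lra|].
    apply Rmult_le_compat_l; [pose proof (pow2_ge_0 b); lra | apply hJ_inv; lra].
Qed.

(* Stirling's constant, read off from the limit [b -> 0] of [log_curv_is]. *)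
Lemma J_2_2 : J 2 2 = RtoC (ln (2 * PI) / 2 - 1 + 1/12).
Proof.
  destruct tail_close as [K hK].
  pose proof PI_RGT_0 as hpi. pose proof PI_lt_4 as hpi4.
  set (L := ln (2 * PI) / 2 - 1 + 1/12).
  (* The left side does not depend on [b], so a bound by a multiple of [b] forces it to vanish;
     [b <= 1/4] ensures [PI b <= 1], as [sinh_bounds] requires. *)
  assert (hx : forall b, 0 < b <= 1/4 -> Cmod (RtoC (2 * L) - 2 * J 2 2)%C <= (Rabs K + 30) * b).
  { intros b hb. pose proof (hK b ltac:(lra)) as h. rewrite c0_value in h by lra.
    set (c0 := - (1/12 / (1 + b ^ 2)) + 1/2 * ln b + 1/4 * ln (1 + b ^ 2) - (1/2 * ln (1 + b ^ 2) - 1 + b * atan (/ b))) in *.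
    replace (RtoC (2 * L) - 2 * J 2 2)%C with ((RtoC (lnq 0 b) - 2 * RtoC c0 - 2 * J 2 2) + RtoC (2 * L - (lnq 0 b - 2 * c0)))%C
      by (rewrite RtoC_minus, (RtoC_minus (lnq 0 b)), (RtoC_mult 2 c0); ring).
    eapply Rle_trans; [apply Cmod_triangle|]. rewrite Cmod_R.
    assert (hb2 : 0 < b ^ 2 <= b) by (split; [apply pow_lt; lra | simpl; nra]).
    assert (K * b ^ 2 <= Rabs K * b).
    { pose proof (Rle_abs K). pose proof (Rabs_pos K). apply Rle_trans with (Rabs K * b ^ 2); [apply Rmult_le_compat_r; lra | apply Rmult_le_compat_l; lra]. }
    assert (Rabs (2 * L - (lnq 0 b - 2 * c0)) <= 30 * b); [|lra].
    unfold lnq, c0, L. rewrite Rmult_0_r, sin_0. set (u := PI * b). assert (hu : 0 < u <= 1) by (unfold u; nra).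
    destruct (sinh_bounds u ltac:(lra)) as ((s1 & _) & s3).
    replace (sinh u ^ 2 + 0 ^ 2) with (sinh u ^ 2) by ring.
    pose proof (sinh_pos u ltac:(lra)) as sp. rewrite ln_pow by assumption. simpl INR.
    assert (l1 : ln u <= ln (sinh u)) by (apply ln_le; lra).
    assert (ex1 : forall z, 0 < z -> ln (1 + z) <= z).
    { intros z hz. rewrite <- (ln_exp z) at 2. apply ln_le; [lra | apply exp_ineq1_le]. }
    assert (l2 : ln (sinh u) <= ln u + u ^ 2).
    { apply Rle_trans with (ln (u * (1 + u ^ 2))). apply ln_le; [assumption|]. replace (u * (1 + u ^ 2)) with (u + u ^ 3) by ring. assumption.
      pose proof (pow_lt u 2 ltac:(lra)). rewrite ln_mult by lra. pose proof (ex1 (u ^ 2) ltac:(lra)). lra. }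
    assert (l3 : ln u = ln PI + ln b) by (unfold u; apply ln_mult; lra).
    assert (l4 : ln (2 * PI) = ln 2 + ln PI) by (apply ln_mult; lra).
    assert (u2 : 0 <= u ^ 2 <= 16 * b).
    { split; [apply pow2_ge_0|]. unfold u. assert (PI ^ 2 <= 16) by (simpl; nra). rewrite Rpow_mult_distr.
      apply Rle_trans with (16 * b ^ 2); [apply Rmult_le_compat_r; lra | lra]. }
    assert (u1 : 0 < u <= 4 * b) by (split; [lra | unfold u; apply Rmult_le_compat_r; lra]).
    assert (n1 : 0 <= ln (1 + b ^ 2) <= b).
    { split; [apply ln_ge_0; lra|]. pose proof (ex1 (b ^ 2) ltac:(lra)). lra. }
    assert (d1 : 1 - b <= 1 / (1 + b ^ 2) <= 1).
    { split; (apply Rmult_le_reg_r with (1 + b ^ 2); [lra|]; unfold Rdiv; rewrite Rmult_assoc, Rinv_l by lra; nra). }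
    assert (t1 : 0 <= b * atan (/ b) <= 2 * b).
    { pose proof (atan_bound (/ b)). assert (0 < atan (/ b)) by (rewrite <- atan_0; apply atan_increasing, Rinv_0_lt_compat; lra). nra. }
    replace (1 / 12 / (1 + b ^ 2)) with (1/12 * (1 / (1 + b ^ 2))) by (field; lra).
    set (d := 1 / (1 + b ^ 2)) in *. set (t := b * atan (/ b)) in *. set (n := ln (1 + b ^ 2)) in *.
    apply Rabs_le. lra. }
  assert (e : Cmod (RtoC (2 * L) - 2 * J 2 2)%C = 0).
  { apply Rle_antisym; [|apply Cmod_ge_0]. apply Rnot_lt_le. intros hlt.
    set (q := Cmod (RtoC (2 * L) - 2 * J 2 2)%C) in *. pose proof (Rabs_pos K).
    set (b := Rmin (1/4) (q / (2 * (Rabs K + 30)))).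
    assert (hb0 : 0 < b) by (apply Rmin_pos; [lra | apply Rdiv_lt_0_compat; lra]).
    assert (hb1 : b <= 1/4) by apply Rmin_l.
    assert (hb2 : b <= q / (2 * (Rabs K + 30))) by apply Rmin_r.
    pose proof (hx b ltac:(lra)) as h.
    apply (Rmult_le_compat_r (2 * (Rabs K + 30))) in hb2; [|lra]. unfold Rdiv in hb2. rewrite Rmult_assoc, Rinv_l in hb2 by lra. lra. }
  apply Cmod_eq_0 in e. rewrite RtoC_mult in e.
  replace (J 2 2) with (RtoC L - 1/2 * (2 * RtoC L - 2 * J 2 2))%C by field. rewrite e. ring.
Qed.

(** * Special values of the zeta function *)

Lemma Jext_S_value M s : (2 <= Re s) -> Jext M 2 s = J 2 s.
Proof.
  intros hs. induction M as [|M IH]; [reflexivity|]. rewrite <- IH. symmetry. apply Jext_S. pose proof (pos_INR M). lra.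
Qed.

Lemma zeta_0 N : zeta N 0%C = (- (1/2))%C.
Proof. unfold zeta. replace (0 - 1)%C with (- (1))%C by ring. field. Qed.

(** At [s = - 1] the argument of [Jext] is zero, which kills everything except the boundary term
    [bern 2 0 = 1/12]. *)
Lemma zeta_m1 N : zeta (S N) (- (1))%C = RtoC (- (1/12)).
Proof.
  unfold zeta. change (Jext (S N) 1 (- (1) + 1)) with (- RtoC (bern 2 0) + (- (1) + 1) * Jext N 2 (- (1) + 1 + 1))%C.
  rewrite bern_2. replace (- (1) + 1)%C with (RtoC 0) by ring. rewrite Cmult_0_l.
  replace (0 ^ 2 / 2 - 0 / 2 + 1 / 12) with (1/12) by field. rewrite RtoC_opp.
  replace (- (1) - 1)%C with (- (2))%C by ring. rewrite RtoC_div by lra. field.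
Qed.

(** Because of the factor [s] the derivative is [- Jext N 1 1 = 1/12 - J 2 2], and [J_2_2] supplies
    the logarithm. The condition [N >= 3] ensures [13/4 - N <= 1]. *)
Lemma zeta_der_0 N : (3 <= N)%nat -> exists M f', HB (fun s => - s * Jext N 1 (s + 1))%C f' 0%C M /\
  f' 0%C = RtoC (1 - ln (2 * PI) / 2).
Proof.
  intros hN. destruct N as [|N]; [lia|].
  destruct (HB_Jext (S N) 1 (0 + 1)%C) as (f' & M & h).
  { apply le_INR in hN. rewrite Re_plus, !Re_RtoC. replace (INR 3) with 3 in hN by (simpl; ring). lra. }
  pose proof (HB_Cmult (- (1))%C _ _ _ _ (HB_mult _ _ _ _ _ _ _ (HB_id 0%C) (HB_shift _ _ _ _ _ h))) as q.
  eexists; eexists. split.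
  - eapply HB_ext; [apply q | | intros; reflexivity]. intros; cbv beta; ring.
  - cbv beta. replace (0 + 1)%C with (RtoC 1) by ring.
    change (Jext (S N) 1 1) with (- RtoC (bern 2 0) + 1 * Jext N 2 (1 + 1))%C.
    rewrite Jext_S_value by (rewrite Re_plus; simpl; lra).
    replace (1 + 1)%C with (RtoC 2) by (rewrite <- RtoC_plus; f_equal; ring). rewrite J_2_2, bern_2.
    replace (0 ^ 2 / 2 - 0 / 2 + 1 / 12) with (1/12) by field.
    rewrite !RtoC_plus, !RtoC_minus. ring.
Qed.

(** * Complex differentiability and meromorphy *)

Definition Cd (f : C -> C) (s l : C) : Prop := @is_derive C_AbsRing C_NormedModule f s l.

(** Two normed-module structures on [C] with the same operations: the product rule is stated for the
    ring as a module over itself, the determinant for [C_NormedModule]. *)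
Lemma Cd_aux f s l : Cd f s l <-> @is_derive C_AbsRing (AbsRing_NormedModule C_AbsRing) f s l.
Proof.
  split; intros [[a b c] h2]; (split; [split; [exact a | exact b | exact c] | exact h2]).
Qed.

Lemma Cd_eq f s l m : Cd f s l -> l = m -> Cd f s m.
Proof. intros; subst; assumption. Qed.

Lemma Cd_ext f g s l : (forall t, f t = g t) -> Cd f s l -> Cd g s l.
Proof. intros e; apply is_derive_ext; assumption. Qed.

Lemma Cd_plus f g s a b : Cd f s a -> Cd g s b -> Cd (fun t => f t + g t)%C s (a + b)%C.
Proof. apply (is_derive_plus (K := C_AbsRing) (V := C_NormedModule)). Qed.

Lemma Cd_mult f g s a b : Cd f s a -> Cd g s b -> Cd (fun t => f t * g t)%C s (a * g s + f s * b)%C.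
Proof.
  intros h1 h2; apply Cd_aux. apply (is_derive_mult (K := C_AbsRing)); try (apply Cd_aux; assumption).
  intros; apply Cmult_comm.
Qed.

Lemma Cd_const c s : Cd (fun _ => c) s 0%C.
Proof. apply (is_derive_const (K := C_AbsRing) (V := C_NormedModule)). Qed.

Lemma Cd_id s : Cd (fun t => t) s 1%C.
Proof. apply Cd_aux, (is_derive_id (K := C_AbsRing)). Qed.

Lemma Cd_Cmult c f s a : Cd f s a -> Cd (fun t => c * f t)%C s (c * a)%C.
Proof. intros; eapply Cd_eq; [apply Cd_mult; [apply Cd_const | eassumption] | cbv beta; ring]. Qed.

Lemma Cd_affine f a b s l : Cd f (a * s + b)%C l -> Cd (fun t => f (a * t + b))%C s (a * l)%C.
Proof.
  intros h. apply (is_derive_comp (K := C_AbsRing) (V := C_NormedModule) f (fun t => (a * t + b)%C)); [exact h|].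
  apply Cd_aux. eapply Cd_eq; [apply Cd_plus; [apply Cd_Cmult, Cd_id | apply Cd_const] | ring].
Qed.

Lemma Cd_quad f s l d M : 0 < d -> 0 <= M ->
  (forall t, Cmod (t - s)%C < d -> Cmod (f t - f s - (t - s) * l)%C <= M * Cmod (t - s)%C ^ 2) -> Cd f s l.
Proof.
  intros hd hM h. split; [apply is_linear_scal_l|].
  intros x hx; apply (is_filter_lim_locally_unique (K := C_AbsRing) (V := AbsRing_NormedModule C_AbsRing)) in hx; subst x. intros eps.
  assert (hd' : 0 < Rmin d (eps / (M + 1))).
  { apply Rmin_pos; [lra|]. apply Rdiv_lt_0_compat; [apply cond_pos | lra]. }
  exists (mkposreal _ hd'). intros t ht. change (Cmod (t - s)%C < Rmin d (eps / (M + 1))) in ht.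
  change (Cmod (f t - f s - (t - s) * l)%C <= eps * Cmod (t - s)%C).
  pose proof (Rmin_l d (eps / (M + 1))). pose proof (Rmin_r d (eps / (M + 1))).
  eapply Rle_trans; [apply h; lra|]. pose proof (Cmod_ge_0 (t - s)).
  assert (t3 : Cmod (t - s)%C * (M + 1) <= eps).
  { apply Rle_trans with (eps / (M + 1) * (M + 1)); [apply Rmult_le_compat_r; lra | right; field; lra]. }
  nra.
Qed.

(** [HB_pw] assumes a base at least [1]; the bases [4 PI^2] and [/ B^2] of the final formula call
    for this pointwise version. *)
Lemma Cd_pw x s : 0 < x -> Cd (pw x) s (- RtoC (ln x) * pw x s)%C.
Proof.
  intros hx. set (L := ln x).
  apply Cd_quad with 1 (Cmod (pw x s) * (4 * (Rabs L ^ 2 * exp (Rabs L)))); [lra | |].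
  - apply Rmult_le_pos; [apply Cmod_ge_0|]. pose proof (pow2_ge_0 (Rabs L)). pose proof (exp_pos (Rabs L)). nra.
  - intros t ht. set (d := (t - s)%C) in *.
    replace (pw x t - pw x s - d * (- RtoC L * pw x s))%C with (pw x s * (Cexp (- (d * RtoC L)) - 1 - - (d * RtoC L)))%C.
    2:{ replace (pw x t) with (pw x s * Cexp (- (d * RtoC L)))%C. ring.
        replace t with (s + d)%C by (unfold d; ring). rewrite pw_plus, (pw_exp x d). reflexivity. }
    rewrite Cmod_mult. rewrite Rmult_assoc. apply Rmult_le_compat_l; [apply Cmod_ge_0|].
    eapply Rle_trans; [apply Cexp_taylor2|]. rewrite Cmod_opp, Cmod_mult, Cmod_R.
    pose proof (Cmod_ge_0 d). pose proof (Rabs_pos L).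
    rewrite Rmult_assoc. apply Rmult_le_compat_l; [lra|].
    replace ((Cmod d * Rabs L) ^ 2 * exp (Cmod d * Rabs L)) with (Rabs L ^ 2 * Cmod d ^ 2 * exp (Cmod d * Rabs L)) by ring.
    replace (Rabs L ^ 2 * exp (Rabs L) * Cmod d ^ 2) with (Rabs L ^ 2 * Cmod d ^ 2 * exp (Rabs L)) by ring.
    apply Rmult_le_compat_l; [apply Rmult_le_pos; apply pow2_ge_0|]. apply exp_le_compat. nra.
Qed.

Lemma Cd_inv r s : s <> r -> Cd (fun t => / (t - r))%C s (- (/ (s - r) * / (s - r)))%C.
Proof.
  intros hne. set (d := (s - r)%C).
  assert (hd : d <> 0%C). { intros e. apply hne. unfold d in e. replace s with ((s - r) + r)%C by ring. rewrite e. ring. }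
  pose proof (proj1 (Cmod_gt_0 d) hd) as hd0.
  apply Cd_quad with (Cmod d / 2) (2 / Cmod d ^ 3); [lra | left; apply Rdiv_lt_0_compat; [lra | apply pow_lt, hd0]|].
  intros t ht. cbv beta. fold d.
  assert (htr : Cmod d / 2 <= Cmod (t - r)%C).
  { assert (Cmod d <= Cmod (t - r)%C + Cmod (t - s)%C).
    { replace d with ((t - r) + - (t - s))%C by (unfold d; ring). eapply Rle_trans; [apply Cmod_triangle|]. rewrite Cmod_opp; lra. }
    lra. }
  assert (ht0 : (t - r)%C <> 0%C) by (apply Cmod_gt_0; lra).
  replace (/ (t - r) - / d - (t - s) * - (/ d * / d))%C with ((t - s) * (t - s) * (/ d * / d * / (t - r)))%C.
  2:{ unfold d. unfold d in hd. replace (t - s)%C with ((t - r) - (s - r))%C by ring. set (x := (t - r)%C) in *. set (y := (s - r)%C) in *. field. split; assumption. }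
  rewrite !Cmod_mult, !Cmod_inv by assumption.
  replace (2 / Cmod d ^ 3 * Cmod (t - s) ^ 2) with (Cmod (t - s)%C * Cmod (t - s)%C * (/ Cmod d * / Cmod d * / (Cmod d / 2))) by (field; lra).
  apply Rmult_le_compat_l; [apply Rmult_le_pos; apply Cmod_ge_0|].
  apply Rmult_le_compat_l; [apply Rmult_le_pos; left; apply Rinv_0_lt_compat; assumption|].
  apply Rinv_le_contravar; lra.
Qed.

Lemma locally_Cmod (p : C) (P : C -> Prop) : @locally C_UniformSpace p P <-> exists d, 0 < d /\ forall s, Cmod (s - p)%C < d -> P s.
Proof.
  split.
  - intros h. apply locally_C in h. destruct h as [d h]. exists d; split; [apply cond_pos|]. intros s hs. apply h, hs.
  - intros (d & hd & h). apply locally_C. exists (mkposreal d hd). intros s hs. apply h, hs.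
Qed.

Definition hol (f : C -> C) (p : C) : Prop := exists d, 0 < d /\ forall s, Cmod (s - p)%C < d -> exists l, Cd f s l.

Lemma hol_holomorphic f p : hol f p <-> holomorphic_at f p.
Proof. unfold hol, holomorphic_at. rewrite locally_Cmod. reflexivity. Qed.

Lemma hol_2 (f g h : C -> C) p : (forall s l m, Cd f s l -> Cd g s m -> exists n, Cd h s n) -> hol f p -> hol g p -> hol h p.
Proof.
  intros H (d & hd & h1) (e & he & h2). exists (Rmin d e). split; [apply Rmin_pos; assumption|].
  intros s hs. pose proof (Rmin_l d e). pose proof (Rmin_r d e).
  destruct (h1 s ltac:(lra)) as [l hl], (h2 s ltac:(lra)) as [m hm]. apply (H s l m hl hm).
Qed.

Lemma hol_plus f g p : hol f p -> hol g p -> hol (fun s => f s + g s)%C p.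
Proof. apply hol_2. intros; eexists; apply Cd_plus; eassumption. Qed.

Lemma hol_mult f g p : hol f p -> hol g p -> hol (fun s => f s * g s)%C p.
Proof. apply hol_2. intros; eexists; apply Cd_mult; eassumption. Qed.

Lemma hol_all f p : (forall s, exists l, Cd f s l) -> hol f p.
Proof. intros h; exists 1; split; [lra | intros; apply h]. Qed.

Lemma hol_const c p : hol (fun _ => c) p.
Proof. apply hol_all; intros; eexists; apply Cd_const. Qed.

Lemma hol_id p : hol (fun s => s) p.
Proof. apply hol_all; intros; eexists; apply Cd_id. Qed.

Lemma hol_pw x p : 0 < x -> hol (pw x) p.
Proof. intros; apply hol_all; intros; eexists; apply Cd_pw; assumption. Qed.

Lemma hol_inv r p : p <> r -> hol (fun s => / (s - r))%C p.
Proof.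
  intros h. exists (Cmod (p - r)%C). split.
  - apply Cmod_gt_0. intros e; apply h. replace p with ((p - r) + r)%C by ring. rewrite e; ring.
  - intros s hs. eexists; apply Cd_inv. intros e; subst s. rewrite <- Cmod_opp in hs.
    replace (- (r - p))%C with (p - r)%C in hs by ring. lra.
Qed.

Lemma hol_affine f a b p : hol f (a * p + b)%C -> hol (fun s => f (a * s + b))%C p.
Proof.
  intros (d & hd & h). exists (d / (Cmod a + 1)). pose proof (Cmod_ge_0 a).
  split; [apply Rdiv_lt_0_compat; lra|]. intros s hs.
  destruct (h (a * s + b)%C) as [l hl].
  - replace (a * s + b - (a * p + b))%C with (a * (s - p))%C by ring. rewrite Cmod_mult.
    apply (Rmult_lt_compat_r (Cmod a + 1)) in hs; [|lra]. unfold Rdiv in hs. rewrite Rmult_assoc, Rinv_l in hs by lra.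
    pose proof (Cmod_ge_0 (s - p)). nra.
  - eexists; apply Cd_affine, hl.
Qed.

Lemma hol_ext f g p : (forall s, f s = g s) -> hol f p -> hol g p.
Proof. intros e (d & hd & h). exists d; split; auto. intros s hs. destruct (h s hs) as [l hl]. exists l. eapply Cd_ext; [apply e | apply hl]. Qed.

Lemma Cd_ext_loc f g s l d : 0 < d -> (forall t, Cmod (t - s)%C < d -> f t = g t) -> Cd f s l -> Cd g s l.
Proof.
  intros hd e. apply is_derive_ext_loc. exists (mkposreal d hd). intros t ht. apply e, ht.
Qed.

Lemma hol_ext_loc f g p d : 0 < d -> (forall s, Cmod (s - p)%C < d -> f s = g s) -> hol f p -> hol g p.
Proof.
  intros hd e (d' & hd' & h). exists (Rmin d d' / 2). pose proof (Rmin_pos _ _ hd hd').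
  pose proof (Rmin_l d d'). pose proof (Rmin_r d d').
  split; [lra|]. intros s hs. destruct (h s ltac:(lra)) as [l hl]. exists l.
  apply (Cd_ext_loc f g s l (Rmin d d' / 2)); [lra | | exact hl]. intros t ht. apply e.
  replace (t - p)%C with ((t - s) + (s - p))%C by ring. eapply Rle_lt_trans; [apply Cmod_triangle | lra].
Qed.

Lemma HB_hol f f' p M : HB f f' p M -> hol f p.
Proof. intros h; exists (1/4); split; [lra|]. intros s hs. exists (f' s). apply (HB_derive _ _ _ _ _ h hs). Qed.

Lemma HB_Cd f f' p M : HB f f' p M -> Cd f p (f' p).
Proof. intros h. apply (HB_derive _ _ _ _ _ h). replace (p - p)%C with (RtoC 0) by ring. rewrite Cmod_0; lra. Qed.

Definition mero (f : C -> C) (p : C) : Prop :=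
  exists (k : nat) (g : C -> C), hol g p /\ exists d, 0 < d /\
    forall s, Cmod (s - p)%C < d -> s <> p -> ((s - p) ^ k * f s)%C = g s.

Lemma mero_meromorphic f : (forall p, mero f p) -> meromorphic f.
Proof.
  intros h p. destruct (h p) as (k & g & hg & d & hd & e). exists k, g. split; [apply hol_holomorphic, hg|].
  apply locally_Cmod. exists d; split; assumption.
Qed.

Lemma mero_hol f p : hol f p -> mero f p.
Proof. intros h. exists 0%nat, f. split; [assumption|]. exists 1; split; [lra|]. intros; simpl; ring. Qed.

Lemma hol_pow r k p : hol (fun s => (s - r) ^ k)%C p.
Proof.
  induction k as [|k IH]; [exact (hol_const 1%C p)|].
  apply (hol_mult (fun s => s - r)%C); [|exact IH]. apply (hol_plus (fun s => s)); [apply hol_id | apply hol_const].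
Qed.

Lemma Cpow_add (z : C) m n : (z ^ (m + n))%C = (z ^ m * z ^ n)%C.
Proof. induction m as [|m IH]; simpl; [ring | rewrite IH; ring]. Qed.

Lemma mero_2 (f1 f2 h : C -> C) p : mero f1 p -> mero f2 p ->
  (forall k1 k2 (g1 g2 : C -> C), hol g1 p -> hol g2 p -> exists k g, hol g p /\
     forall s, s <> p -> ((s - p) ^ k1 * f1 s = g1 s)%C -> ((s - p) ^ k2 * f2 s = g2 s)%C -> ((s - p) ^ k * h s = g s)%C) -> mero h p.
Proof.
  intros (k1 & g1 & h1 & d1 & p1 & e1) (k2 & g2 & h2 & d2 & p2 & e2) H.
  destruct (H k1 k2 g1 g2 h1 h2) as (k & g & hg & e). exists k, g. split; [assumption|].
  exists (Rmin d1 d2). split; [apply Rmin_pos; assumption|]. pose proof (Rmin_l d1 d2). pose proof (Rmin_r d1 d2).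
  intros s hs hne. apply e; [assumption | apply e1; [lra | assumption] | apply e2; [lra | assumption]].
Qed.

Lemma mero_plus f g p : mero f p -> mero g p -> mero (fun s => f s + g s)%C p.
Proof.
  intros hf hg. apply (mero_2 f g _ p hf hg). intros k1 k2 g1 g2 h1 h2.
  exists (k1 + k2)%nat, (fun s => (s - p) ^ k2 * g1 s + (s - p) ^ k1 * g2 s)%C. split.
  - apply hol_plus; apply hol_mult; auto using hol_pow.
  - intros s _ e1 e2. rewrite <- e1, <- e2, Cpow_add. ring.
Qed.

Lemma mero_mult f g p : mero f p -> mero g p -> mero (fun s => f s * g s)%C p.
Proof.
  intros hf hg. apply (mero_2 f g _ p hf hg). intros k1 k2 g1 g2 h1 h2.
  exists (k1 + k2)%nat, (fun s => g1 s * g2 s)%C. split.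
  - apply hol_mult; assumption.
  - intros s _ e1 e2. rewrite <- e1, <- e2, Cpow_add. ring.
Qed.

Lemma mero_inv r p : mero (fun s => / (s - r))%C p.
Proof.
  destruct (Req_dec (Cmod (p - r)%C) 0) as [e|e].
  - apply Cmod_eq_0 in e. assert (p = r) by (replace p with ((p - r) + r)%C by ring; rewrite e; ring). subst r.
    exists 1%nat, (fun _ => 1%C). split; [apply hol_const|]. exists 1; split; [lra|]. intros s _ hs. simpl. field.
    intros q; apply hs. replace s with ((s - p) + p)%C by ring. rewrite q; ring.
  - apply mero_hol, hol_inv. intros q; subst. apply e. replace (r - r)%C with (RtoC 0) by ring. apply Cmod_0.
Qed.

Lemma mero_ext f g p : (forall s, f s = g s) -> mero f p -> mero g p.
Proof. intros e (k & h & hh & d & hd & H). exists k, h. split; auto. exists d; split; auto. intros; rewrite <- e; auto. Qed.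

Lemma mero_ext_loc f g p d : 0 < d -> (forall s, Cmod (s - p)%C < d -> f s = g s) -> mero f p -> mero g p.
Proof.
  intros hd e (k & h & hh & d' & hd' & H). exists k, h. split; auto. exists (Rmin d d').
  pose proof (Rmin_l d d'). pose proof (Rmin_r d d').
  split; [apply Rmin_pos; assumption|]. intros; rewrite <- e by lra; apply H; [lra | assumption].
Qed.

Lemma hol_Jext N p s0 : 13/4 - INR N <= Re s0 -> hol (Jext N p) s0.
Proof. intros h. destruct (HB_Jext N p s0 h) as (f' & M & q). eapply HB_hol, q. Qed.

(** The shift [c] is carried along because each level of [Wext] moves the argument by [1]; the last
    hypothesis keeps [p] away from the poles [1/2 - c - i]. *)
Lemma hol_Wext N : forall c p, 9/4 - INR N <= Re (p + c)%C -> (forall i : nat, (p + c + RtoC (INR i))%C <> RtoC (1/2)) ->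
  hol (fun s => Wext N (s + c))%C p.
Proof.
  induction N as [|N IH]; intros c p h hn.
  - destruct (HB_W (p + c)%C) as (f' & M & q); [simpl INR in h; lra|].
    eapply hol_ext; [|apply (hol_affine W 1 c)]; [intros; simpl; f_equal; ring|].
    apply HB_hol in q. replace (1 * p + c)%C with (p + c)%C by ring. exact q.
  - rewrite S_INR in h.
    eapply hol_ext with (fun s => (s + c) * / (s - (1/2 - c)) * Wext N (s + (c + 1)))%C.
    + intros s. change (Wext (S N) (s + c)) with ((s + c) / (s + c - 1/2) * Wext N (s + c + 1))%C.
      replace (s - (1/2 - c))%C with (s + c - 1/2)%C by ring. replace (s + (c + 1))%C with (s + c + 1)%C by ring. reflexivity.
    + apply hol_mult; [apply hol_mult|].
      * apply hol_plus; [apply hol_id | apply hol_const].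
      * apply hol_inv. intros e. apply (hn 0%nat). simpl INR. rewrite e, RtoC_div by lra. ring.
      * apply IH.
        -- rewrite Cplus_assoc, Re_plus, Re_RtoC. lra.
        -- intros i e. apply (hn (S i)). rewrite S_INR, RtoC_plus. rewrite <- e. ring.
Qed.

Lemma mero_Wext N : forall c p, 9/4 - INR N <= Re (p + c)%C -> mero (fun s => Wext N (s + c))%C p.
Proof.
  induction N as [|N IH]; intros c p h.
  - apply mero_hol. destruct (HB_W (p + c)%C) as (f' & M & q); [simpl INR in h; lra|].
    eapply hol_ext; [|apply (hol_affine W 1 c)]; [intros; simpl; f_equal; ring|].
    apply HB_hol in q. replace (1 * p + c)%C with (p + c)%C by ring. exact q.
  - rewrite S_INR in h.
    eapply mero_ext with (fun s => (s + c) * / (s - (1/2 - c)) * Wext N (s + (c + 1)))%C.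
    + intros s. change (Wext (S N) (s + c)) with ((s + c) / (s + c - 1/2) * Wext N (s + c + 1))%C.
      replace (s - (1/2 - c))%C with (s + c - 1/2)%C by ring. replace (s + (c + 1))%C with (s + c + 1)%C by ring. reflexivity.
    + apply mero_mult; [apply mero_mult; [apply mero_hol, hol_plus; [apply hol_id | apply hol_const] | apply mero_inv]|].
      apply IH. rewrite Cplus_assoc, Re_plus, Re_RtoC. lra.
Qed.

(* [zeta N] along an affine line, written with the factor [/ (s - r)] as the only possible pole. *)
Lemma zeta_affine N r b p (F : forall (f : C -> C) (p : C), Prop) :
  (F = hol \/ F = mero) -> (2 * r + b = 1)%C -> 9/4 - INR N <= Re (2 * p + b)%C -> F (fun s => / (s - r))%C p ->
  F (fun s => zeta N (2 * s + b))%C p.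
Proof.
  intros hF hr h hp.
  assert (hh : hol (fun s => 1/2 + - (2 * s + b) * Jext N 1 (2 * s + (b + 1)))%C p).
  { apply hol_plus; [apply hol_const|]. apply hol_mult.
    - eapply hol_ext with (fun s => (- (2)) * s + - b)%C; [intros; ring|].
      apply hol_plus; [apply hol_mult; [apply hol_const | apply hol_id] | apply hol_const].
    - apply (hol_affine (Jext N 1) 2 (b + 1)). apply hol_Jext. rewrite Cplus_assoc, Re_plus, Re_RtoC. lra. }
  assert (e : forall s, (1/2 * / (s - r) + (1/2 + - (2 * s + b) * Jext N 1 (2 * s + (b + 1))))%C = zeta N (2 * s + b)%C).
  { intros s. unfold zeta. replace (2 * s + b - 1)%C with (2 * (s - r))%C by (rewrite <- hr; ring).
    replace (2 * s + (b + 1))%C with (2 * s + b + 1)%C by ring.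
    unfold Cdiv. destruct (Req_dec (Cmod (s - r)%C) 0) as [q|q].
    (* The identity is needed at the pole too; it holds there because the inverse of zero is zero,
       so both polar terms disappear. *)
    - apply Cmod_eq_0 in q. rewrite q. replace (2 * 0)%C with (RtoC 0) by ring.
      assert (i0 : (/ 0)%C = 0%C) by (unfold Cinv; simpl; apply Ceq; simpl; unfold Rdiv; ring). rewrite i0. ring.
    - field. intros q2. apply q. rewrite q2. apply Cmod_0. }
  destruct hF; subst F.
  - eapply hol_ext; [apply e|]. apply hol_plus; [apply hol_mult; [apply hol_const | exact hp] | exact hh].
  - eapply mero_ext; [apply e|]. apply mero_plus; [apply mero_mult; [apply mero_hol, hol_const | exact hp] | apply mero_hol, hh].
Qed.

(** * Summation over the lattice *)

Definition lsum {T : Type} (a : T -> R) (l : list T) : R := fold_right (fun p s => a p + s) 0 l.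

Lemma lsum_app {T} (a : T -> R) l1 l2 : lsum a (l1 ++ l2) = lsum a l1 + lsum a l2.
Proof. induction l1 as [|x l1 IH]; simpl; [ring | rewrite IH; ring]. Qed.

Lemma lsum_nonneg {T} (a : T -> R) l : (forall p, 0 <= a p) -> 0 <= lsum a l.
Proof. intros h; induction l as [|x l IH]; simpl; [lra | pose proof (h x); lra]. Qed.

Lemma lsum_incl {T} (a : T -> R) l1 l2 : (forall p, 0 <= a p) -> NoDup l1 -> incl l1 l2 -> lsum a l1 <= lsum a l2.
Proof.
  intros ha. revert l2; induction l1 as [|x l1 IH]; intros l2 hnd hinc; [apply lsum_nonneg, ha|].
  inversion hnd; subst. destruct (in_split x l2 (hinc x (or_introl eq_refl))) as (u & v & e). subst l2.
  assert (h : lsum a l1 <= lsum a (u ++ v)).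
  { apply IH; [assumption|]. intros y hy. pose proof (hinc y (or_intror hy)) as q. apply in_app_or in q. apply in_or_app.
    destruct q as [q|[q|q]]; auto. subst; contradiction. }
  rewrite lsum_app in *. simpl. lra.
Qed.

Lemma lsum_seq (f : nat -> R) n : lsum f (seq 0 (S n)) = sum_n f n.
Proof.
  induction n as [|n IH]; [rewrite sum_O; simpl; ring|].
  rewrite sum_Sn, <- IH, seq_S, lsum_app. simpl. unfold plus; simpl. ring.
Qed.

Lemma lsum_map {T U} (a : U -> R) (f : T -> U) l : lsum a (map f l) = lsum (fun x => a (f x)) l.
Proof. induction l as [|x l IH]; simpl; [reflexivity | rewrite IH; reflexivity]. Qed.

Lemma lsum_prod (a : nat * nat -> R) l1 l2 : lsum a (list_prod l1 l2) = lsum (fun i => lsum (fun j => a (i, j)) l2) l1.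
Proof. induction l1 as [|x l1 IH]; simpl; [reflexivity | rewrite lsum_app, IH, lsum_map; reflexivity]. Qed.

Lemma sum_n_le_series (f : nat -> R) l n : (forall k, 0 <= f k) -> is_series f l -> sum_n f n <= l.
Proof.
  intros h hs. apply (is_lim_seq_incr_compare (sum_n f)); [exact hs|].
  intros k. rewrite sum_Sn. unfold plus; simpl. pose proof (h (S k)); lra.
Qed.

Lemma nonneg_series_bounded (f : nat -> R) M : (forall k, 0 <= f k) -> (forall n, sum_n f n <= M) -> exists l, is_series f l /\ l <= M.
Proof.
  intros h hb. destruct (ex_finite_lim_seq_incr (sum_n f) M) as [l hl]; auto.
  - intros n. rewrite sum_Sn. unfold plus; simpl. pose proof (h (S n)); lra.
  - exists l. split; [exact hl|]. apply (is_lim_seq_le (sum_n f) (fun _ => M) l M hb hl), is_lim_seq_const.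
Qed.

Lemma NoDup_list_prod {T U} (l1 : list T) (l2 : list U) : NoDup l1 -> NoDup l2 -> NoDup (list_prod l1 l2).
Proof.
  intros h1 h2. induction h1 as [|x l hx h IH]; simpl; [constructor|].
  apply NoDup_app; [| exact IH |].
  - apply FinFun.Injective_map_NoDup; [intros y z e; congruence | assumption].
  - intros [y z] hy hz. apply in_map_iff in hy. destruct hy as (w & e & _). apply in_prod_iff in hz. inversion e; subst. tauto.
Qed.

(** Each inequality is an inclusion of finite sets: an initial segment of the Cantor enumeration
    lies in a square, and a rectangle lies in an initial segment. *)
Lemma fubini_nonneg (a : nat * nat -> R) r S : (forall p, 0 <= a p) -> (forall i, is_series (fun j => a (i, j)) (r i)) ->
  is_series r S -> is_series (fun k => a (Cantor.of_nat k)) S.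
Proof.
  intros ha hr hS.
  assert (hr0 : forall i, 0 <= r i).
  { intros i. eapply Rle_trans; [|apply (sum_n_le_series _ _ 0 (fun j => ha (i, j)) (hr i))]. rewrite sum_O. apply ha. }
  destruct (nonneg_series_bounded (fun k => a (Cantor.of_nat k)) S) as (l & hl & hle).
  - intros; apply ha.
  - intros n. rewrite <- lsum_seq, <- (lsum_map a Cantor.of_nat).
    apply Rle_trans with (lsum a (list_prod (seq 0 (Datatypes.S n)) (seq 0 (Datatypes.S n)))).
    + apply lsum_incl; [assumption | |].
      * apply FinFun.Injective_map_NoDup; [|apply seq_NoDup]. intros x y e. rewrite <- (cancel_to_of x), e. apply cancel_to_of.
      * intros [x y] h. apply in_map_iff in h. destruct h as (k & e & hk). apply in_seq in hk.
        pose proof (to_nat_non_decreasing x y) as q. rewrite <- e, cancel_to_of in q.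
        apply in_prod_iff. rewrite !in_seq. lia.
    + rewrite lsum_prod, lsum_seq. eapply Rle_trans; [|apply (sum_n_le_series r S n hr0 hS)].
      apply sum_n_m_le. intros i. rewrite lsum_seq. apply sum_n_le_series; [intros; apply ha | apply hr].
  - replace S with l; [assumption|]. apply Rle_antisym; [assumption|].
    apply (is_lim_seq_le (sum_n r) (fun _ => l) S l); [|exact hS | apply is_lim_seq_const].
    intros I.
    (* The number of rows stays fixed while their length tends to infinity. *)
    assert (hlim : is_lim_seq (fun J => sum_n (fun i => sum_n (fun j => a (i, j)) J) I) (sum_n r I)).
    { induction I as [|I IH].
      - rewrite sum_O. apply is_lim_seq_ext with (sum_n (fun j => a (0%nat, j))); [intros; rewrite sum_O; reflexivity | apply hr].
      - rewrite sum_Sn. apply is_lim_seq_ext with (fun J => sum_n (fun i => sum_n (fun j => a (i, j)) J) I + sum_n (fun j => a (Datatypes.S I, j)) J).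
        { intros J; rewrite sum_Sn; reflexivity. }
        apply is_lim_seq_plus'; [exact IH | apply hr]. }
    apply (is_lim_seq_le _ (fun _ => l) (sum_n r I) l) with (2 := hlim); [|apply is_lim_seq_const].
    intros J.
    set (rect := list_prod (seq 0 (Datatypes.S I)) (seq 0 (Datatypes.S J))).
    assert (hK : exists K, forall p, In p rect -> (Cantor.to_nat p <= K)%nat).
    { clear. induction rect as [|x t IHt]; [exists 0%nat; intros p []|]. destruct IHt as [K hK].
      exists (max (Cantor.to_nat x) K). intros p [e|e]; [subst; lia | specialize (hK p e); lia]. }
    destruct hK as [K hK].
    apply Rle_trans with (sum_n (fun k => a (Cantor.of_nat k)) K).
    + replace (sum_n _ I) with (lsum a rect).
      * rewrite <- lsum_seq, <- (lsum_map a Cantor.of_nat). apply lsum_incl; [assumption | |].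
        -- apply NoDup_list_prod; apply seq_NoDup.
        -- intros p hp. apply in_map_iff. exists (Cantor.to_nat p). split; [apply cancel_of_to|]. apply in_seq. specialize (hK p hp). lia.
      * unfold rect. rewrite lsum_prod, lsum_seq. apply sum_n_ext. intros i. apply lsum_seq.
    + apply sum_n_le_series; [intros; apply ha | assumption].
Qed.

(** For [g] the real or imaginary part, [|a| + g a] is non-negative, so the signed sums are
    differences of non-negative ones. *)
Lemma fubini_C (a : nat * nat -> C) r S R0 T : (forall i, is_series (fun j => Cmod (a (i, j))) (r i)) -> is_series r S ->
  (forall i, is_Cser (fun j => a (i, j)) (R0 i)) -> is_Cser R0 T ->
  ex_series (fun k => Cmod (a (Cantor.of_nat k))) /\ is_Cser (fun k => a (Cantor.of_nat k)) T.
Proof.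
  intros h1 h2 h3 [h4 h5].
  assert (k0 := fubini_nonneg (fun p => Cmod (a p)) r S (fun p => Cmod_ge_0 _) h1 h2).
  split; [eexists; apply k0|].
  assert (q : forall (g : C -> R) t, (forall z, Rabs (g z) <= Cmod z) -> (forall i, is_series (fun j => g (a (i, j))) (g (R0 i))) ->
     is_series (fun i => g (R0 i)) t -> is_series (fun k => g (a (Cantor.of_nat k))) t).
  { intros g t hg hr ht.
    assert (k1 := fubini_nonneg (fun p => Cmod (a p) + g (a p)) (fun i => r i + g (R0 i)) (S + t)).
    apply is_series_ext with (fun k => minus (Cmod (a (Cantor.of_nat k)) + g (a (Cantor.of_nat k))) (Cmod (a (Cantor.of_nat k)))).
    { intros; unfold minus, plus, opp; simpl; ring. }
    eapply is_series_eq; [apply (is_series_minus (V := R_NormedModule)); [apply k1 | apply k0]|].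
    - intros p. pose proof (hg (a p)) as u. apply Rabs_le_between in u. lra.
    - intros i. apply (is_series_plus (V := R_NormedModule)); [apply h1 | apply hr].
    - apply (is_series_plus (V := R_NormedModule)); assumption.
    - unfold minus, plus, opp; simpl. Rring. }
  split.
  - apply (q Re); [apply re_le_Cmod | intros i; apply h3 | exact h4].
  - apply (q Im); [apply im_le_Cmod | intros i; apply h3 | exact h5].
Qed.

(* The enumeration [0, 1, -1, 2, -2, ...]. *)
Definition zz (i : nat) : Z := if Nat.even i then (- Z.of_nat (i / 2))%Z else Z.of_nat (S (i / 2)).

Lemma zz_0 : zz 0 = 0%Z. Proof. reflexivity. Qed.

Lemma zz_odd j : zz (2 * j + 1) = Z.of_nat (S j).
Proof.
  unfold zz. replace (Nat.even (2 * j + 1)) with false.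
  - replace (2 * j + 1)%nat with (1 + j * 2)%nat by lia. rewrite Nat.div_add by lia. reflexivity.
  - rewrite Nat.even_add_mul_2 || (rewrite Nat.add_comm, Nat.even_add_mul_2); reflexivity.
Qed.

Lemma zz_even j : zz (2 * j + 2) = (- Z.of_nat (S j))%Z.
Proof.
  unfold zz. replace (2 * j + 2)%nat with (0 + 2 * S j)%nat by lia. rewrite Nat.even_add_mul_2. simpl Nat.even. cbv iota.
  replace (0 + 2 * S j)%nat with (0 + S j * 2)%nat by lia. rewrite Nat.div_add by lia. reflexivity.
Qed.

Lemma nat_cases i : i = 0%nat \/ (exists j, i = (2 * j + 1)%nat) \/ (exists j, i = (2 * j + 2)%nat).
Proof.
  destruct i as [|i]; [auto|]. right. destruct (Nat.Even_or_Odd i) as [[j hj]|[j hj]]; [left|right]; exists j; lia.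
Qed.

Lemma zz_inj i j : zz i = zz j -> i = j.
Proof.
  destruct (nat_cases i) as [->|[[a ->]|[a ->]]], (nat_cases j) as [->|[[b ->]|[b ->]]];
  rewrite ?zz_0, ?zz_odd, ?zz_even; lia.
Qed.

Lemma zz_surj (n : Z) : exists i, zz i = n.
Proof.
  destruct (Z.lt_trichotomy n 0) as [h|[->|h]].
  - exists (2 * (Z.to_nat (- n - 1)) + 2)%nat. rewrite zz_even. lia.
  - exists 0%nat; reflexivity.
  - exists (2 * (Z.to_nat (n - 1)) + 1)%nat. rewrite zz_odd. lia.
Qed.

Lemma sum_n_pairs (f : nat -> R) n : sum_n f (2 * n + 2) = f 0%nat + sum_n (fun j => f (2 * j + 1)%nat + f (2 * j + 2)%nat) n.
Proof.
  induction n as [|n IH].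
  - simpl. rewrite !sum_Sn, !sum_O. unfold plus; simpl. ring.
  - replace (2 * S n + 2)%nat with (S (S (2 * n + 2))) by lia. rewrite !sum_Sn, IH. unfold plus; simpl.
    replace (S (n + S (n + 0) + 1)) with (S (S (n + (n + 0) + 2 - 1))) by lia. rewrite Rplus_assoc, Rplus_assoc. do 3 f_equal; f_equal; lia.
Qed.

Lemma zser_nonneg (f : nat -> R) l : (forall i, 0 <= f i) -> is_series (fun j => f (2 * j + 1)%nat + f (2 * j + 2)%nat) l ->
  is_series f (f 0%nat + l).
Proof.
  intros h hl.
  destruct (nonneg_series_bounded f (f 0%nat + l) h) as (t & ht & hle).
  - intros n. apply Rle_trans with (sum_n f (2 * n + 2)).
    + assert (m : forall d, sum_n f n <= sum_n f (n + d)).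
      { induction d as [|d IH]; [rewrite Nat.add_0_r; lra|]. rewrite Nat.add_succ_r, sum_Sn. unfold plus; simpl. pose proof (h (S (n + d))). lra. }
      replace (2 * n + 2)%nat with (n + (n + 2))%nat by lia. apply m.
    + rewrite sum_n_pairs. apply Rplus_le_compat_l. apply sum_n_le_series; [|assumption]. intros j. pose proof (h (2 * j + 1)%nat). pose proof (h (2 * j + 2)%nat). lra.
  - replace (f 0%nat + l) with t; [assumption|].
    assert (hf : filterlim (fun n => 2 * n + 2)%nat eventually eventually).
    { intros P [N hN]. exists N. intros n hn. apply hN. lia. }
    assert (ht' : is_lim_seq (sum_n f) t) by exact ht.
    pose proof (is_lim_seq_subseq (sum_n f) _ _ hf ht') as k1.
    assert (k2 : is_lim_seq (fun n => sum_n f (2 * n + 2)) (f 0%nat + l)).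
    { eapply is_lim_seq_ext; [intros; symmetry; apply sum_n_pairs|]. apply is_lim_seq_plus'; [apply is_lim_seq_const | exact hl]. }
    apply is_lim_seq_unique in k1, k2. congruence.
Qed.

(** Domination gives convergence, and the value is read off along the partial sums that end with a
    complete pair. *)
Lemma zser_abs (f : nat -> C) b l : (forall i, Cmod (f i) <= b i) -> ex_series b ->
  is_Cser (fun j => f (2 * j + 1)%nat + f (2 * j + 2)%nat)%C l -> is_Cser f (f 0%nat + l)%C.
Proof.
  intros h hb hl. pose proof (Cser_correct f b h hb) as ht.
  replace (f 0%nat + l)%C with (Cser f); [assumption|].
  assert (hf : filterlim (fun n => 2 * n + 2)%nat eventually eventually).
  { intros P [N hN]. exists N. intros n hn. apply hN. lia. }
  destruct ht as [t1 t2], hl as [l1 l2]. apply Ceq.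
  - assert (u : is_lim_seq (sum_n (fun i => Re (f i))) (Re (Cser f))) by exact t1.
    pose proof (is_lim_seq_subseq _ _ _ hf u) as k1.
    assert (k2 : is_lim_seq (fun n => sum_n (fun i => Re (f i)) (2 * n + 2)) (Re (f 0%nat) + Re l)).
    { eapply is_lim_seq_ext; [intros; symmetry; apply sum_n_pairs|]. apply is_lim_seq_plus'; [apply is_lim_seq_const | exact l1]. }
    apply is_lim_seq_unique in k1, k2. rewrite Re_plus. congruence.
  - assert (u : is_lim_seq (sum_n (fun i => Im (f i))) (Im (Cser f))) by exact t2.
    pose proof (is_lim_seq_subseq _ _ _ hf u) as k1.
    assert (k2 : is_lim_seq (fun n => sum_n (fun i => Im (f i)) (2 * n + 2)) (Im (f 0%nat) + Im l)).
    { eapply is_lim_seq_ext; [intros; symmetry; apply sum_n_pairs|]. apply is_lim_seq_plus'; [apply is_lim_seq_const | exact l2]. }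
    apply is_lim_seq_unique in k1, k2. rewrite Im_plus. congruence.
Qed.

(** Half of the telescoping series at both ends turns the trapezoidal sums into plain ones. The
    middle term stays apart, matching the place of [0] in the enumeration [zz]. *)
Lemma row_pairs k a s : 0 < k -> 1 <= Re s ->
  is_Cser (fun j => fp k s (INR (S j) - a) + fp k s (- INR (S j) - a))%C
    (tau 0 k a s - tau_up (tau 2 k a) k s - fp k s (- a))%C.
Proof.
  intros hk hs. destruct (vanish_fp k s a hk hs) as [v1 v2].
  assert (h := is_Cser_plus _ _ _ _ (row_trapezoid k a s hk hs) (is_Cser_Cmult _ _ (1/2)%C
     (is_Cser_plus _ _ _ _ (is_Cser_tel _ v1) (is_Cser_tel _ v2)))).
  eapply is_Cser_ext; [| eapply is_Cser_eq; [apply h|]].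
  - intros j; cbv beta. field.
  - cbv beta. simpl INR. replace (0 - a) with (- a) by ring. replace (- 0 - a) with (- a) by ring. field.
Qed.

(** * Row sums and the Dirichlet series *)

Section LatticeSum.
Variables (A B : R) (hB : 0 < B).

Definition lamq (n m : Z) : R := 4 * PI ^ 2 * (IZR n ^ 2 + (IZR m - IZR n * A) ^ 2 / B ^ 2).

Definition epstein_term (n m : Z) (s : C) : C := if Req_EM_T (lamq n m) 0 then RtoC 0 else pw (lamq n m) s.

Lemma PI2_pos : 0 < 4 * PI ^ 2.
Proof. pose proof PI_RGT_0. pose proof (pow_lt PI 2 ltac:(lra)). lra. Qed.

Lemma lamq_0 : lamq 0 0 = 0.
Proof. unfold lamq. field. lra. Qed.

Lemma lamq_row (j : nat) (n m : Z) : IZR n ^ 2 = (INR j + 1) ^ 2 ->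
  lamq n m = 4 * PI ^ 2 * ((INR j + 1) ^ 2 * G (kB B j) (IZR m - IZR n * A)).
Proof. intros e. unfold lamq, G, kB. rewrite e. pose proof (pos_INR j). field. lra. Qed.

Lemma lamq_row_pos j n m : IZR n ^ 2 = (INR j + 1) ^ 2 -> 0 < lamq n m.
Proof.
  intros e. rewrite (lamq_row j) by assumption. pose proof PI2_pos. pose proof (pos_INR j).
  apply Rmult_lt_0_compat; [lra|]. apply Rmult_lt_0_compat; [apply pow_lt; lra | apply G_pos].
Qed.

Lemma epstein_term_row (j : nat) (n m : Z) s : IZR n ^ 2 = (INR j + 1) ^ 2 ->
  epstein_term n m s = (pw (4 * PI ^ 2) s * pw ((INR j + 1) ^ 2) s * fp (kB B j) s (IZR m - IZR n * A))%C.
Proof.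
  intros e. unfold epstein_term. pose proof (lamq_row_pos j n m e) as p. destruct (Req_EM_T (lamq n m) 0) as [q|q]; [lra|].
  rewrite (lamq_row j) by assumption. pose proof PI2_pos. pose proof (pos_INR j). pose proof (G_pos (kB B j) (IZR m - IZR n * A)).
  assert (0 < (INR j + 1) ^ 2) by (apply pow_lt; lra).
  unfold fp. rewrite (pw_mult (4 * PI ^ 2)), (pw_mult ((INR j + 1) ^ 2)); try assumption; [ring|]. apply Rmult_lt_0_compat; assumption.
Qed.

(** Meant for [n = j + 1] and [n = - (j + 1)]: it is then the sum of the row [n] over all [m], and
    the sign of [n] enters only through the shift [n A]. *)
Definition rho (j : nat) (n : Z) (s : C) : C :=
  (pw (4 * PI ^ 2) s * pw ((INR j + 1) ^ 2) s *
   (tau 0 (kB B j) (IZR n * A) s - tau_up (tau 2 (kB B j) (IZR n * A)) (kB B j) s))%C.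

Lemma epstein_term_row_pairs j n s : IZR n ^ 2 = (INR j + 1) ^ 2 -> 1 <= Re s ->
  is_Cser (fun i => epstein_term n (zz (2 * i + 1)) s + epstein_term n (zz (2 * i + 2)) s)%C (rho j n s - epstein_term n 0 s)%C.
Proof.
  intros e hs. destruct (kB_pos B hB j) as [hk _].
  eapply is_Cser_ext; [| eapply is_Cser_eq; [apply (is_Cser_Cmult _ _ (pw (4 * PI ^ 2) s * pw ((INR j + 1) ^ 2) s)%C (row_pairs (kB B j) (IZR n * A) s hk hs))|]].
  - intros i; cbv beta. rewrite zz_odd, zz_even, !(epstein_term_row j) by assumption.
    rewrite opp_IZR, <- INR_IZR_INZ. ring.
  - rewrite (epstein_term_row j n 0) by assumption. unfold rho. rewrite Rminus_0_l. ring.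
Qed.

Lemma epstein_term_0_pairs s : 1 <= 2 * Re s - 1 ->
  is_Cser (fun i => epstein_term 0 (zz (2 * i + 1)) s + epstein_term 0 (zz (2 * i + 2)) s)%C
    (2 * (pw (4 * PI ^ 2) s * pw (/ B ^ 2) s * zeta 0 (2 * s)))%C.
Proof.
  intros hs. pose proof PI2_pos. assert (hB2 : 0 < / B ^ 2) by (apply Rinv_0_lt_compat, pow_lt, hB).
  assert (hz := zeta_is_Cser (2 * s)%C ltac:(rewrite Re_scal; lra)).
  eapply is_Cser_ext; [| eapply is_Cser_eq; [apply (is_Cser_Cmult _ _ (2 * (pw (4 * PI ^ 2) s * pw (/ B ^ 2) s))%C hz)|]].
  - intros i; cbv beta. rewrite zz_odd, zz_even.
    assert (e : forall m : Z, IZR m ^ 2 = (INR i + 1) ^ 2 -> epstein_term 0 m s = (pw (4 * PI ^ 2) s * pw (/ B ^ 2) s * pw (INR i + 1) (2 * s))%C).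
    { intros m hm. pose proof (pos_INR i). assert (hi : 0 < (INR i + 1) ^ 2) by (apply pow_lt; lra).
      assert (el : lamq 0 m = 4 * PI ^ 2 * (/ B ^ 2 * ((INR i + 1) * (INR i + 1)))).
      { unfold lamq. rewrite Rmult_0_l, Rminus_0_r, hm. field. lra. }
      unfold epstein_term. assert (0 < / B ^ 2 * ((INR i + 1) * (INR i + 1))) by (apply Rmult_lt_0_compat; [assumption | nra]).
      destruct (Req_EM_T (lamq 0 m) 0) as [q|q].
      - rewrite el in q. apply Rmult_integral in q. destruct q; lra.
      - rewrite el, (pw_mult (4 * PI ^ 2)), (pw_mult (/ B ^ 2)), (pw_mult (INR i + 1)) by (try assumption; nra). replace (2 * s)%C with (s + s)%C by ring. rewrite pw_plus. ring. }
    rewrite !e; [ring | rewrite opp_IZR, <- INR_IZR_INZ, S_INR; ring | rewrite <- INR_IZR_INZ, S_INR; ring].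
  - unfold zeta. simpl Jext. ring.
Qed.

(** A modulus is itself a term, at the real exponent [Re s]. The row formulas at [Re s] therefore
    sum the moduli, and absolute convergence needs no estimate of its own. *)
Lemma Cmod_epstein_term n m s : Cmod (epstein_term n m s) = Re (epstein_term n m (RtoC (Re s))) /\ 0 <= Re (epstein_term n m (RtoC (Re s))).
Proof.
  assert (e : Cmod (epstein_term n m s) = Re (epstein_term n m (RtoC (Re s)))).
  { unfold epstein_term. destruct (Req_EM_T (lamq n m) 0); [apply Cmod_0|].
    rewrite Cmod_pw, pw_exp. replace (- (RtoC (Re s) * RtoC (ln (lamq n m))))%C with (RtoC (- (Re s * ln (lamq n m)))) by (rewrite RtoC_opp, RtoC_mult; ring).
    rewrite Cexp_RtoC, Re_RtoC. reflexivity. }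
  split; [assumption | rewrite <- e; apply Cmod_ge_0].
Qed.

(** [zz (S i')] is plus or minus [i' / 2 + 1], whence the index given to [rho]. *)
Definition rowv (i : nat) (s : C) : C :=
  match i with
  | O => (2 * (pw (4 * PI ^ 2) s * pw (/ B ^ 2) s * zeta 0 (2 * s)))%C
  | S i' => rho (i' / 2) (zz i) s
  end.

Lemma zz_sq i : IZR (zz (S i)) ^ 2 = (INR (i / 2) + 1) ^ 2.
Proof.
  destruct (nat_cases (S i)) as [e|[[j e]|[j e]]]; [discriminate| |].
  - rewrite e, zz_odd, <- INR_IZR_INZ, S_INR. replace (i / 2)%nat with j; [reflexivity|].
    replace i with (0 + j * 2)%nat by lia. rewrite Nat.div_add by lia. reflexivity.
  - rewrite e, zz_even, opp_IZR, <- INR_IZR_INZ, S_INR. replace (i / 2)%nat with j; [ring|].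
    replace i with (1 + j * 2)%nat by lia. rewrite Nat.div_add by lia. reflexivity.
Qed.

Lemma epstein_term_pairs i s : 1 < Re s -> is_Cser (fun j => epstein_term (zz i) (zz (2 * j + 1)) s + epstein_term (zz i) (zz (2 * j + 2)) s)%C (rowv i s - epstein_term (zz i) 0 s)%C.
Proof.
  intros hs. destruct i as [|i].
  - change (zz 0) with 0%Z. eapply is_Cser_eq; [apply epstein_term_0_pairs; lra|].
    unfold rowv, epstein_term. rewrite lamq_0. destruct (Req_EM_T 0 0) as [_|q]; [ring | lra].
  - apply epstein_term_row_pairs; [apply zz_sq | lra].
Qed.

Lemma epstein_term_rows_abs i s : 1 < Re s -> is_series (fun j => Cmod (epstein_term (zz i) (zz j) s)) (Re (rowv i (RtoC (Re s)))).
Proof.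
  intros hs. destruct (epstein_term_pairs i (RtoC (Re s)) ltac:(rewrite Re_RtoC; assumption)) as [h _].
  assert (k := zser_nonneg (fun j => Re (epstein_term (zz i) (zz j) (RtoC (Re s)))) _ (fun j => proj2 (Cmod_epstein_term _ _ s)) h).
  eapply is_series_ext; [| eapply is_series_eq; [apply k|]].
  - intros j; symmetry; apply Cmod_epstein_term.
  - rewrite Re_minus. change (zz 0) with 0%Z. Rring.
Qed.

Lemma epstein_term_rows i s : 1 < Re s -> is_Cser (fun j => epstein_term (zz i) (zz j) s) (rowv i s).
Proof.
  intros hs. eapply is_Cser_eq; [apply (zser_abs (fun j => epstein_term (zz i) (zz j) s) (fun j => Cmod (epstein_term (zz i) (zz j) s)))|].
  - intros; apply Rle_refl.
  - eexists; apply epstein_term_rows_abs, hs.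
  - apply epstein_term_pairs, hs.
  - change (zz 0) with 0%Z. ring.
Qed.

(* The spectral zeta function on [Re s > 1 - N / 2]. *)
Definition Zf (N : nat) (s : C) : C :=
  (pw (4 * PI ^ 2) s * (2 * (pw (/ B ^ 2) s * zeta N (2 * s)) + 2 * RtoC B * (Wext N s * zeta N (2 * s - 1)) - E A B N s))%C.

(** For the rows [n] and [- n], the factor [1 / k = B n] of the row integral turns [n^(-2s)] into
    [n^(1 - 2s)], and the integrals sum to a zeta value at [2s - 1]. *)
Lemma rowv_pairs s : 1 < Re s -> is_Cser (fun j => rowv (2 * j + 1) s + rowv (2 * j + 2) s)%C
  (pw (4 * PI ^ 2) s * (2 * RtoC B * (W s * zeta 0 (2 * s - 1)) - E A B 0 s))%C.
Proof.
  intros hs.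
  assert (hz := zeta_is_Cser (2 * s - 1)%C ltac:(rewrite Re_minus, Re_scal; simpl; lra)).
  assert (hE : is_Cser (fun j => Eterm A B 0 j s) (E A B 0 s)).
  (* [HB_E] with [N = 0] would require [Re s >= 9/4]; [N = 2] covers the half-plane, and the terms
     agree there. *)
  { destruct (HB_E A B hB 2 s) as (f' & M & _ & _ & h); [simpl; lra|]. destruct (h s (Cmod_self s)) as [h1 _].
    rewrite (E_S A B hB 0 s), (E_S A B hB 1 s) by (simpl; lra).
    eapply is_Cser_ext; [|apply h1]. intros j; cbv beta. rewrite (Eterm_S A B hB 0), (Eterm_S A B hB 1) by (simpl; lra). reflexivity. }
  assert (h := is_Cser_Cmult _ _ (pw (4 * PI ^ 2) s) (is_Cser_plus _ _ _ _ (is_Cser_Cmult _ _ (2 * RtoC B * W s)%C hz) (is_Cser_opp _ _ hE))).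
  eapply is_Cser_ext; [| eapply is_Cser_eq; [apply h|]].
  - intros j; cbv beta. replace (2 * j + 1)%nat with (S (2 * j)) by lia. replace (2 * j + 2)%nat with (S (S (2 * j))) by lia.
    unfold rowv. replace (2 * j / 2)%nat with j by (rewrite Nat.mul_comm, Nat.div_mul; lia).
    replace (S (2 * j) / 2)%nat with j by (replace (S (2 * j)) with (1 + j * 2)%nat by lia; rewrite Nat.div_add by lia; reflexivity).
    replace (S (2 * j)) with (2 * j + 1)%nat by lia. replace (S (2 * j + 1)) with (2 * j + 2)%nat by lia.
    rewrite zz_odd, zz_even. unfold rho. rewrite opp_IZR, <- INR_IZR_INZ, S_INR.
    destruct (kB_pos B hB j) as [hk _]. rewrite !tau_0_W by (try assumption; lra).
    unfold Eterm. change (Text 1 0) with (fun k a => tau_up (tau 2 k a) k). cbv beta.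
    replace (- (INR j + 1) * A) with (- ((INR j + 1) * A)) by ring.
    pose proof (pos_INR j) as hj. set (n := INR j + 1) in *. assert (hn : 0 < n) by (unfold n; lra).
    replace (RtoC (/ kB B j)) with (RtoC B * RtoC n)%C by (unfold kB; rewrite Rinv_inv, <- RtoC_mult; reflexivity).
    assert (e : pw n (2 * s - 1) = (pw (n ^ 2) s * RtoC n)%C).
    { replace (pw n (2 * s - 1)) with (pw n (2 * s - 1 + 1) * RtoC n)%C.
      - replace (2 * s - 1 + 1)%C with (s + s)%C by ring. rewrite pw_plus. replace (n ^ 2) with (n * n) by ring. rewrite pw_mult by assumption. reflexivity.
      - rewrite pw_plus1 by assumption. replace (RtoC (/ n) * pw n (2 * s - 1) * RtoC n)%C with (RtoC (/ n * n) * pw n (2 * s - 1))%C by (rewrite RtoC_mult; ring).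
        rewrite Rinv_l by lra. ring. }
    rewrite e. ring.
  - unfold zeta. simpl Jext. ring.
Qed.

Lemma Dirichlet_series s : 1 < Re s ->
  let a := fun p : nat * nat => epstein_term (zz (fst p)) (zz (snd p)) s in
  ex_series (fun k => Cmod (a (Cantor.of_nat k))) /\ is_Cser (fun k => a (Cantor.of_nat k)) (Zf 0 s).
Proof.
  intros hs a.
  set (sg := RtoC (Re s)). assert (hsg : 1 < Re sg) by (unfold sg; rewrite Re_RtoC; assumption).
  assert (r0 : forall i, 0 <= Re (rowv i sg)).
  { intros i. pose proof (sum_n_le_series _ _ 0 (fun j => Cmod_ge_0 _) (epstein_term_rows_abs i s hs)) as q. rewrite sum_O in q.
    eapply Rle_trans; [apply Cmod_ge_0 | exact q]. }
  destruct (rowv_pairs sg hsg) as [hr _].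
  assert (hS := zser_nonneg (fun i => Re (rowv i sg)) _ r0 hr).
  assert (hT : is_Cser (fun i => rowv i s) (Zf 0 s)).
  { eapply is_Cser_eq; [apply (zser_abs (fun i => rowv i s) (fun i => 2 * Re (rowv i sg)))|].
    - intros i. refine (is_Cser_bound _ _ _ _ _ (epstein_term_rows i s hs) (epstein_term_rows_abs i s hs)). intros; apply Rle_refl.
    - eexists. apply (is_series_scal (K := R_AbsRing) (V := R_NormedModule)), hS.
    - apply rowv_pairs, hs.
    - unfold Zf, rowv. simpl Wext. ring. }
  refine (fubini_C a _ _ _ _ _ hS _ hT).
  - intros i. apply epstein_term_rows_abs, hs.
  - intros i. apply epstein_term_rows, hs.
Qed.
End LatticeSum.

(** * The determinant *)

Lemma Cd_unique f s l m : Cd f s l -> Cd f s m -> l = m.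
Proof. intros h1 h2. rewrite <- (is_C_derive_unique f s l h1). apply is_C_derive_unique, h2. Qed.

Lemma hol_Cd f p : hol f p -> exists l, Cd f p l.
Proof. intros (d & hd & h). apply h. replace (p - p)%C with (RtoC 0) by ring. rewrite Cmod_0; assumption. Qed.

(** With an explicit factor [s], the derivative at [0] is the value of the cofactor, and no
    derivative of [Text] or [Wext] has to be known. *)
Lemma Cd_s_mult k : hol k 0%C -> Cd (fun s => s * k s)%C 0%C (k 0%C).
Proof.
  intros h. destruct (hol_Cd _ _ h) as [l hl]. eapply Cd_eq; [apply Cd_mult; [apply Cd_id | apply hl]|]. cbv beta. ring.
Qed.

Lemma Text_base N p k a s : 0 < k -> 1 <= Re s -> Text N (S p) k a s = tau (S p) k a s.
Proof.
  intros hk hs. induction N as [|N IH]; [reflexivity|]. rewrite <- IH. symmetry. apply Text_S; [assumption|]. pose proof (pos_INR N); lra.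
Qed.

Lemma Wext_base N s : 1 <= Re s -> Wext N s = W s.
Proof. intros hs. induction N as [|N IH]; [reflexivity|]. rewrite <- IH. symmetry. apply Wext_S. pose proof (pos_INR N); lra. Qed.

Lemma hol_Text N p k a s0 : 0 < k -> 9/4 - INR N <= Re s0 -> hol (Text N p k a) s0.
Proof.
  intros hk hs. destruct (HB_Text k N p s0 hs) as (C & _ & h). destruct (h k a ltac:(lra)) as [f' q]. eapply HB_hol, q.
Qed.

Lemma zeta_Cd_0 N : (3 <= N)%nat -> Cd (zeta N) 0%C (RtoC (- (ln (2 * PI) / 2))).
Proof.
  intros hN. destruct (zeta_der_0 N hN) as (M & f' & h & e). apply HB_Cd in h. rewrite e in h.
  apply Cd_ext with (fun s => / (s - 1) + (1/2 + - s * Jext N 1 (s + 1)))%C.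
  { intros s. unfold zeta, Cdiv. ring. }
  eapply Cd_eq; [apply Cd_plus; [apply Cd_inv | apply Cd_plus; [apply Cd_const | exact h]]|].
  - intros q. apply RtoC_inj in q. lra.
  - replace (0 - 1)%C with (- (1))%C by ring. rewrite RtoC_minus, RtoC_opp. field.
Qed.

Lemma is_series_0 : is_series (fun _ : nat => 0) 0.
Proof.
  change (is_lim_seq (sum_n (fun _ : nat => 0)) 0). apply is_lim_seq_ext with (fun _ => 0); [|apply is_lim_seq_const].
  intros n. rewrite sum_n_const. ring.
Qed.

Section Determinant.
Variables (A B : R) (hB : 0 < B).

Lemma Zf_S N s : 2 - 2 * Re s <= INR N -> Zf A B N s = Zf A B (S N) s.
Proof.
  intros h. pose proof (pos_INR N). unfold Zf.
  rewrite (zeta_S N (2 * s)%C) by (rewrite Re_scal; lra).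
  rewrite (zeta_S N (2 * s - 1)%C) by (rewrite Re_minus, Re_scal; simpl; lra).
  rewrite (Wext_S N s) by lra. rewrite (E_S A B hB N s) by lra. reflexivity.
Qed.

Lemma Zf_stable N M s : 2 - 2 * Re s <= INR N -> 2 - 2 * Re s <= INR M -> Zf A B N s = Zf A B M s.
Proof.
  assert (k : forall N d, 2 - 2 * Re s <= INR N -> Zf A B N s = Zf A B (N + d) s).
  { intros n d h. induction d as [|d IH]; [rewrite Nat.add_0_r; reflexivity|].
    rewrite IH, Nat.add_succ_r. apply Zf_S. rewrite plus_INR. pose proof (pos_INR d). lra. }
  intros h1 h2. rewrite (k N M h1), (k M N h2), Nat.add_comm. reflexivity.
Qed.

(** The number of integrations by parts depends on [s], which gives a single function on the plane;
    near any point it may be replaced by a fixed [N], see [near_eq]. *)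
Definition torus_zeta (s : C) : C := Zf A B (Z.to_nat (up (2 - 2 * Re s))) s.

Lemma torus_zeta_eq N s : 2 - 2 * Re s <= INR N -> torus_zeta s = Zf A B N s.
Proof.
  intros h. apply Zf_stable; [|assumption].
  destruct (archimed (2 - 2 * Re s)) as [h1 _]. set (x := 2 - 2 * Re s) in *.
  destruct (Z_le_dec 0 (up x)) as [q|q].
  - rewrite INR_IZR_INZ, Z2Nat.id by assumption. lra.
  - pose proof (pos_INR (Z.to_nat (up x))). assert (IZR (up x) <= 0) by (apply IZR_le; lia). lra.
Qed.

Lemma exists_nat_ge x : exists N : nat, x <= INR N.
Proof.
  destruct (archimed x) as [h1 _]. exists (Z.to_nat (up x)).
  destruct (Z_le_dec 0 (up x)) as [q|q].
  - rewrite INR_IZR_INZ, Z2Nat.id by assumption. lra.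
  - pose proof (pos_INR (Z.to_nat (up x))). assert (IZR (up x) <= 0) by (apply IZR_le; lia). lra.
Qed.

Lemma near_eq N p : 5 - 2 * Re p <= INR N -> forall s, Cmod (s - p)%C < 1 -> Zf A B N s = torus_zeta s.
Proof.
  intros h s hs. symmetry. apply torus_zeta_eq. pose proof (re_le_Cmod (s - p)%C) as q. rewrite Re_minus in q.
  pose proof (Rle_abs (- (Re s - Re p))) as q'. rewrite Rabs_Ropp in q'. lra.
Qed.

Lemma hol_E N p : 9/4 - INR N <= Re p -> hol (E A B N) p.
Proof. intros h. destruct (HB_E A B hB N p h) as (f' & M & q & _). eapply HB_hol, q. Qed.

Lemma Binv2_pos : 0 < / B ^ 2.
Proof. apply Rinv_0_lt_compat, pow_lt, hB. Qed.

Lemma torus_zeta_meromorphic : meromorphic torus_zeta.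
Proof.
  apply mero_meromorphic. intros p. destruct (exists_nat_ge (5 - 2 * Re p)) as [N hN]. pose proof (pos_INR N).
  apply (mero_ext_loc (Zf A B N) _ p 1 Rlt_0_1 (near_eq N p hN)).
  unfold Zf. apply mero_mult; [apply mero_hol, hol_pw, PI2_pos|].
  apply mero_plus; [apply mero_plus|].
  - apply mero_mult; [apply mero_hol, hol_const|]. apply mero_mult; [apply mero_hol, hol_pw, Binv2_pos|].
    apply mero_ext with (fun s => zeta N (2 * s + 0))%C; [intros; f_equal; ring|].
    apply (zeta_affine N (1/2) 0 p mero); [auto | field | rewrite Re_plus, Re_scal; simpl; lra | apply mero_inv].
  - apply mero_mult; [apply mero_hol, hol_const|]. apply mero_mult.
    + apply mero_ext with (fun s => Wext N (s + 0))%C; [intros; f_equal; ring|]. apply mero_Wext. rewrite Re_plus; simpl; lra.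
    + apply (zeta_affine N 1 (- (1)) p mero); [auto | ring | rewrite Re_plus, Re_scal; simpl; lra | apply mero_inv].
  - apply mero_ext with (fun s => (- (1)) * E A B N s)%C; [intros; ring|].
    apply mero_hol, hol_mult; [apply hol_const | apply hol_E; lra].
Qed.

Lemma half_int (i : nat) (n : Z) : INR i + IZR n <> 1/2.
Proof.
  intros e. rewrite INR_IZR_INZ, <- plus_IZR in e.
  assert (e2 : IZR (2 * (Z.of_nat i + n)) = IZR 1) by (rewrite mult_IZR; lra). apply eq_IZR in e2. lia.
Qed.

(** The candidates for poles are [1/2] and [1] from the zeta factors and [1/2 - i] from [Wext]; none
    of them is [0]. *)
Lemma torus_zeta_hol_0 : hol torus_zeta 0%C.
Proof.
  assert (hN : 5 - 2 * Re 0%C <= INR 5) by (simpl; lra).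
  apply (hol_ext_loc (Zf A B 5) _ 0%C 1 Rlt_0_1 (near_eq 5 0%C hN)).
  unfold Zf. apply hol_mult; [apply hol_pw, PI2_pos|].
  apply hol_plus; [apply hol_plus|].
  - apply hol_mult; [apply hol_const|]. apply hol_mult; [apply hol_pw, Binv2_pos|].
    apply hol_ext with (fun s => zeta 5 (2 * s + 0))%C; [intros; f_equal; ring|].
    apply (zeta_affine 5 (1/2) 0 0%C hol); [auto | field | rewrite Re_plus, Re_scal; simpl; lra | apply hol_inv].
    intros q. apply (f_equal Re) in q. rewrite <- RtoC_div in q by lra. rewrite !Re_RtoC in q. lra.
  - apply hol_mult; [apply hol_const|]. apply hol_mult.
    + apply hol_ext with (fun s => Wext 5 (s + 0))%C; [intros; f_equal; ring|]. apply hol_Wext; [rewrite Re_plus; simpl; lra|].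
      intros i q. rewrite <- !RtoC_plus in q. apply RtoC_inj in q. apply (half_int i 0). simpl. lra.
    + apply (zeta_affine 5 1 (- (1)) 0%C hol); [auto | ring | rewrite Re_plus, Re_scal; simpl; lra | apply hol_inv].
      intros q. apply RtoC_inj in q. lra.
  - apply hol_ext with (fun s => (- (1)) * E A B 5 s)%C; [intros; ring|].
    apply hol_mult; [apply hol_const | apply hol_E; simpl; lra].
Qed.

(** By [Cmod_eta], the logarithm of the factor with [n = j + 1] of the infinite product. *)
Definition eta_term (j : nat) : R := 4 * lnq ((INR j + 1) * A) (B * (INR j + 1)).

(** [tau_up] carries a factor [s], so only [K 0] matters. There [Text] is evaluated at [1] and [2],
    where it coincides with [tau], and [tau_lnq] applies to both shifts, with equal results by
    [lnq_opp]. *)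
Lemma Eterm_Cd_0 N j : (2 <= N)%nat -> Cd (Eterm A B N j) 0%C (RtoC (eta_term j)).
Proof.
  intros hN. apply le_INR in hN. simpl (INR 2) in hN. destruct (kB_pos B hB j) as [hk _]. set (k := kB B j) in *. set (n := INR j + 1).
  assert (hn : 0 < n) by (unfold n; pose proof (pos_INR j); lra).
  set (U := fun a s => (2 * RtoC (k ^ 2) * ((2 * s + 1) * Text N 2 k a (s + 1) + - (2 * (s + 1)) * Text N 2 k a (s + 2)))%C).
  set (K := fun s => (pw (n ^ 2) s * (U (n * A)%R s + U (- (n * A))%R s))%C).
  assert (hU : forall a, hol (U a) 0%C).
  { intros a. apply hol_mult; [apply hol_const|].
    assert (t : forall c, 1 <= Re c -> hol (fun s => Text N 2 k a (s + c))%C 0%C).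
    { intros c hc. apply hol_ext with (fun s => Text N 2 k a (1 * s + c))%C; [intros; f_equal; ring|].
      apply (hol_affine (Text N 2 k a) 1 c). apply hol_Text; [assumption|]. rewrite Re_plus, Re_scal. simpl. lra. }
    apply hol_plus; apply hol_mult.
    - apply hol_plus; [apply hol_mult; [apply hol_const | apply hol_id] | apply hol_const].
    - apply t; simpl; lra.
    - apply hol_ext with (fun s => (- (2)) * s + - (2))%C; [intros; ring|].
      apply hol_plus; [apply hol_mult; [apply hol_const | apply hol_id] | apply hol_const].
    - apply t; simpl; lra. }
  assert (hK : hol K 0%C) by (apply hol_mult; [apply hol_pw, pow_lt, hn | apply hol_plus; apply hU]).
  apply Cd_ext with (fun s => s * K s)%C.
  { intros s. unfold Eterm, K, U. fold k. fold n. change (Text (S N) 0) with (fun k a => tau_up (Text N 2 k a) k). cbv beta. unfold tau_up. ring. }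
  eapply Cd_eq; [apply Cd_s_mult, hK|].
  assert (u0 : forall a, U a 0%C = RtoC (2 * lnq a (/ k))).
  { intros a. unfold U. rewrite !Text_base by (try assumption; rewrite Re_plus; simpl; lra).
    rewrite (RtoC_mult 2), <- (tau_lnq k a hk).
    replace (0 + 1)%C with (RtoC 1) by ring. replace (0 + 2)%C with (RtoC 2) by ring. ring. }
  unfold K. rewrite pw_0, !u0, lnq_opp, Cmult_1_l, <- RtoC_plus. f_equal. unfold eta_term. fold n.
  replace (/ k) with (B * n) by (unfold k, kB; rewrite Rinv_inv; reflexivity). ring.
Qed.

(** Termwise differentiation comes from [HB_E]; its unspecified derivatives [f' j 0] are identified
    by uniqueness of the derivative. Convergence of the logarithms of the product is a
    by-product. *)
Lemma E_Cd_0 N : (3 <= N)%nat -> exists l, is_series eta_term l /\ Cd (E A B N) 0%C (RtoC l) /\ E A B N 0%C = 0%C.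
Proof.
  intros hN. assert (hN2 : (2 <= N)%nat) by lia. apply le_INR in hN. simpl (INR 3) in hN.
  destruct (HB_E A B hB N 0%C) as (f' & M & h1 & h2 & h3); [simpl; lra|].
  assert (hf : forall j, f' j 0%C = RtoC (eta_term j)).
  { intros j. destruct (h2 j) as [M' q]. apply (Cd_unique _ _ _ _ (HB_Cd _ _ _ _ q) (Eterm_Cd_0 N j hN2)). }
  destruct (h3 0%C (Cmod_self 0%C)) as [h4 h5].
  assert (h6 : is_Cser (fun j => RtoC (eta_term j)) (Cser (fun j => f' j 0%C))) by (eapply is_Cser_ext; [|apply h5]; intros; apply hf).
  destruct h6 as [h7 h8]. exists (Re (Cser (fun j => f' j 0%C))). split; [|split].
  - exact h7.
  - eapply Cd_eq; [apply HB_Cd in h1; exact h1|]. cbv beta. apply Ceq; [reflexivity|]. rewrite Im_RtoC.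
    apply is_series_unique in h8. rewrite <- h8. symmetry.
    replace 0 with (0 * Series (fun k => Im (RtoC (eta_term k)))) by ring. rewrite <- Series_scal_l. apply Series_ext. intros; rewrite Im_RtoC; ring.
  - rewrite <- (is_Cser_unique _ _ h4).
    transitivity (Cser (fun _ => 0%C)).
    + apply Cser_ext. intros j. unfold Eterm. change (Text (S N) 0) with (fun k a => tau_up (Text N 2 k a) k). cbv beta. unfold tau_up. ring.
    + apply is_Cser_unique. split; apply is_series_0.
Qed.

Lemma torus_zeta_Cd_0 : exists l, is_series eta_term l /\ Cd torus_zeta 0%C (RtoC (- 2 * ln B + PI * B / 3 - l)).
Proof.
  destruct (E_Cd_0 5 ltac:(lia)) as (l & hl & hE & hE0). exists l. split; [assumption|].
  assert (hN : 5 - 2 * Re 0%C <= INR 5) by (simpl; lra).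
  apply (Cd_ext_loc (Zf A B 5) _ 0%C _ 1 Rlt_0_1 (near_eq 5 0%C hN)).
  assert (d1 : Cd (fun s => zeta 5 (2 * s))%C 0%C (2 * RtoC (- (ln (2 * PI) / 2)))%C).
  { apply Cd_ext with (fun s => zeta 5 (2 * s + 0))%C; [intros; f_equal; ring|]. apply Cd_affine.
    replace (2 * 0 + 0)%C with (RtoC 0) by ring. apply zeta_Cd_0; lia. }
  (* The zero of [Wext] at [0] leaves [(- 2) W(1) zeta(- 1) = (- 2) PI (- 1/12)]. *)
  assert (d2 : Cd (fun s => Wext 5 s * zeta 5 (2 * s - 1))%C 0%C (RtoC (PI / 6))).
  { set (K := fun s => (/ (s - 1/2) * Wext 4 (s + 1) * zeta 5 (2 * s + - (1)))%C).
    assert (hK : hol K 0%C).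
    { apply hol_mult; [apply hol_mult|].
      - apply hol_inv. intros q. rewrite <- RtoC_div in q by lra. apply RtoC_inj in q. lra.
      - apply hol_Wext; [rewrite Re_plus; simpl; lra|]. intros i q. rewrite <- !RtoC_plus in q. apply RtoC_inj in q. apply (half_int i 1). lra.
      - apply (zeta_affine 5 1 (- (1)) 0%C hol); [auto | ring | rewrite Re_plus, Re_scal; simpl; lra | apply hol_inv].
        intros q. apply RtoC_inj in q. lra. }
    apply Cd_ext with (fun s => s * K s)%C.
    { intros s. unfold K. change (Wext 5 s) with (s / (s - 1/2) * Wext 4 (s + 1))%C. unfold Cdiv. replace (2 * s - 1)%C with (2 * s + - (1))%C by ring. ring. }
    eapply Cd_eq; [apply Cd_s_mult, hK|]. unfold K. replace (0 + 1)%C with (RtoC 1) by ring.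
    rewrite Wext_base by (simpl; lra). rewrite W_1. replace (2 * 0 + - (1))%C with (- (1))%C by ring. rewrite zeta_m1.
    replace (0 - 1/2)%C with (RtoC (- (1/2))) by (rewrite RtoC_opp, RtoC_div by lra; ring).
    rewrite <- RtoC_inv, <- !RtoC_mult by lra. f_equal. field. }
  eapply Cd_eq.
  { unfold Zf. apply Cd_mult; [apply Cd_pw, PI2_pos|].
    apply Cd_plus; [apply Cd_plus|].
    - apply Cd_Cmult. apply Cd_mult; [apply Cd_pw, Binv2_pos | exact d1].
    - apply Cd_Cmult, d2.
    - apply Cd_ext with (fun s => (- (1)) * E A B 5 s)%C; [intros; ring|]. apply Cd_Cmult, hE. }
  cbv beta. rewrite !pw_0, hE0. replace (2 * 0)%C with (RtoC 0) by ring. rewrite zeta_0.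
  change (Wext 5 0%C) with (0 / (0 - 1/2) * Wext 4 (0 + 1))%C.
  replace (0 / (0 - 1 / 2) * Wext 4 (0 + 1))%C with (RtoC 0) by (unfold Cdiv; ring).
  rewrite (Cmult_0_l (zeta 5 _)).
  replace (ln (/ B ^ 2)) with (- (2 * ln B)).
  2:{ rewrite ln_Rinv, ln_pow by (try apply pow_lt; assumption). reflexivity. }
  pose proof PI_RGT_0. assert (e4 : ln (4 * PI ^ 2) = 2 * ln (2 * PI)).
  { replace (4 * PI ^ 2) with ((2 * PI) ^ 2) by ring. rewrite ln_pow by lra. reflexivity. }
  rewrite e4. rewrite <- RtoC_div by lra.
  repeat first [rewrite <- RtoC_opp | rewrite <- RtoC_mult | rewrite <- RtoC_plus | rewrite <- RtoC_minus].
  f_equal. field.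
Qed.

(** With [u = PI B n] and [v = PI n A], the square of the modulus is [1 - 2 e^(-2u) cos (2v) +
    e^(-4u) = 4 e^(-2u) (sinh u ^ 2 + sin v ^ 2)]. *)
Lemma Cmod_eta n : 0 < n -> Cmod (1 - Cexp (- (2 * PI * n)%R * (RtoC B - Ci * RtoC A)))%C ^ 4 = exp (4 * lnq (n * A) (B * n)).
Proof.
  intros hn. pose proof PI_RGT_0.
  set (u := PI * (B * n)). set (v := PI * (n * A)).
  assert (hu : 0 < u) by (unfold u; apply Rmult_lt_0_compat; [lra | apply Rmult_lt_0_compat; assumption]).
  set (w := ((- (2 * u))%R, (2 * v)%R) : C).
  replace (- (2 * PI * n)%R * (RtoC B - Ci * RtoC A))%C with w by (unfold w, u, v; apply Ceq; simpl; ring).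
  replace (Cmod (1 - Cexp w)%C ^ 4) with ((Cmod (1 - Cexp w)%C ^ 2) ^ 2) by ring.
  rewrite Cmod2_alt. unfold Cexp, w. cbn [Re Im fst snd].
  rewrite Re_minus, Im_minus. cbn [Re Im fst snd].
  replace (4 * lnq (n * A) (B * n)) with (2 * (2 * lnq (n * A) (B * n))) by ring.
  replace (exp (2 * (2 * lnq (n * A) (B * n)))) with (exp (2 * lnq (n * A) (B * n)) ^ 2).
  2:{ replace (2 * (2 * lnq (n * A) (B * n))) with (2 * lnq (n * A) (B * n) + 2 * lnq (n * A) (B * n)) by ring. rewrite exp_plus. ring. }
  f_equal. unfold lnq. fold u v.
  replace (2 * (ln 2 - u + ln (sinh u ^ 2 + sin v ^ 2) / 2)) with (2 * ln 2 + - (2 * u) + ln (sinh u ^ 2 + sin v ^ 2)) by field.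
  rewrite !exp_plus, exp_ln by (apply Qpos, hu).
  replace (exp (2 * ln 2)) with 4. 2:{ replace (2 * ln 2) with (ln 2 + ln 2) by ring. rewrite exp_plus, exp_ln by lra. ring. }
  rewrite cos_2a_sin, sin_2a. unfold sinh.
  replace (exp (- (2 * u))) with (exp (- u) * exp (- u)) by (rewrite <- exp_plus; f_equal; ring).
  pose proof (exp_plus u (- u)) as e. rewrite Rplus_opp_r, exp_0 in e.
  pose proof (sin2_cos2 v) as t. unfold Rsqr in t.
  set (x := exp (- u)) in *. set (y := exp u) in *. set (a := sin v) in *. set (b := cos v) in *.
  assert (hb : b * b = 1 - a * a) by lra.
  change (Re 1) with 1. change (Im 1) with 0.
  replace ((1 - x * x * (1 - 2 * a * a)) ^ 2 + (0 - x * x * (2 * a * b)) ^ 2) with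
    ((1 - x * x * (1 - 2 * a * a)) ^ 2 + x * x * x * x * 4 * a * a * (b * b)) by ring.
  rewrite hb.
  replace (4 * (x * x) * (((y - x) / 2) ^ 2 + a ^ 2)) with ((y * x) * (y * x) - 2 * (y * x) * (x * x) + x * x * x * x + 4 * x * x * a * a) by field.
  rewrite <- e. ring.
Qed.

Lemma eta_prod l : is_series eta_term l ->
  is_inf_prod (fun n : nat => Cmod (1 - Cexp (- (2 * PI * INR n)%R * (RtoC B - Ci * RtoC A)))%C ^ 4) (exp l).
Proof.
  intros h. unfold is_inf_prod.
  apply is_lim_seq_ext with (fun N => exp (sum_n eta_term N)).
  - intros N. induction N as [|N IH].
    + rewrite sum_O. cbn [prod_f_R0]. rewrite Cmod_eta by (simpl; lra). unfold eta_term. rewrite S_INR. reflexivity.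
    + rewrite sum_Sn. unfold plus; simpl plus. cbn [prod_f_R0]. rewrite <- IH.
      rewrite Cmod_eta by (apply lt_0_INR; lia). change (exp (sum_n eta_term N + eta_term (S N)) = exp (sum_n eta_term N) * exp (4 * lnq (INR (S (S N)) * A) (B * INR (S (S N))))).
      rewrite exp_plus. unfold eta_term at 2. rewrite (S_INR (S N)). reflexivity.
  - apply (is_lim_seq_continuous exp (sum_n eta_term) l); [|exact h].
    apply derivable_continuous_pt, derivable_pt_exp.
Qed.

Lemma det_value l : Cexp (- RtoC (- 2 * ln B + PI * B / 3 - l))%C = RtoC (B ^ 2 * exp (- (PI * B / 3)) * exp l).
Proof.
  rewrite <- RtoC_opp, Cexp_RtoC. f_equal.
  replace (- (- 2 * ln B + PI * B / 3 - l)) with (INR 2 * ln B + - (PI * B / 3) + l) by (simpl; ring).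
  rewrite !exp_plus, exp_INR by assumption. reflexivity.
Qed.

Definition lam (k : nat) : R := lamq A B (zz (fst (Cantor.of_nat k))) (zz (snd (Cantor.of_nat k))).

Lemma is_series_C_pair (f : nat -> C) l : is_Cser f l -> @is_series C_AbsRing C_NormedModule f l.
Proof.
  intros [h1 h2].
  assert (e : forall n, @sum_n (NormedModule.AbelianMonoid C_AbsRing C_NormedModule) f n = (sum_n (fun k => Re (f k)) n, sum_n (fun k => Im (f k)) n)).
  { induction n as [|n IH]; [rewrite !sum_O; destruct (f 0%nat); reflexivity|]. rewrite !sum_Sn, IH. apply Ceq; reflexivity. }
  intros P hP. apply (locally_C l P) in hP. destruct hP as [eps hP].
  assert (he : 0 < eps / 2) by (pose proof (cond_pos eps); lra).
  destruct (h1 (ball (Re l) (mkposreal _ he)) (locally_ball _ _)) as [N1 k1].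
  destruct (h2 (ball (Im l) (mkposreal _ he)) (locally_ball _ _)) as [N2 k2].
  exists (max N1 N2). intros n hn. apply hP. rewrite e.
  change (Cmod ((sum_n (fun k => Re (f k)) n, sum_n (fun k => Im (f k)) n) - l)%C < eps).
  eapply Rle_lt_trans; [apply Cmod_Re_Im|].
  specialize (k1 n ltac:(lia)). specialize (k2 n ltac:(lia)).
  change (Rabs (sum_n (fun k => Re (f k)) n - Re l) < eps / 2) in k1.
  change (Rabs (sum_n (fun k => Im (f k)) n - Im l) < eps / 2) in k2.
  rewrite Re_minus, Im_minus. cbn [Re Im fst snd]. lra.
Qed.

Lemma torus_spectral_zeta : is_spectral_zeta lam torus_zeta.
Proof.
  split; [apply torus_zeta_meromorphic|]. intros s hs.
  destruct (Dirichlet_series A B hB s hs) as [h1 h2]. split.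
  - exact h1.
  - rewrite (torus_zeta_eq 0 s) by (simpl; lra). apply is_series_C_pair, h2.
Qed.

Lemma det_of_spectrum : is_spectrum (lattice A B) lam ->
  exists P, is_inf_prod (fun n : nat => Cmod (1 - Cexp (- (2 * PI * INR n)%R * (RtoC B - Ci * RtoC A)))%C ^ 4) P /\
    is_Det_Laplacian (lattice A B) (RtoC (B ^ 2 * exp (- (PI * B / 3)) * P)).
Proof.
  intros hspec. destruct torus_zeta_Cd_0 as (l & hl & hd). exists (exp l). split; [apply eta_prod, hl|].
  exists lam, torus_zeta, (RtoC (- 2 * ln B + PI * B / 3 - l)). split; [assumption|]. split; [apply torus_spectral_zeta|].
  split; [apply hol_holomorphic, torus_zeta_hol_0|]. split; [exact hd|].
  symmetry. apply det_value.
Qed.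
End Determinant.

(** * Fourier coefficients of periodic functions *)

Definition cis (t : R) : C := Cexp (RtoC t * Ci)%C.

Lemma cis_plus a b : cis (a + b) = (cis a * cis b)%C.
Proof. unfold cis. rewrite <- Cexp_plus, RtoC_plus. f_equal. ring. Qed.

Lemma cis_0 : cis 0 = 1%C.
Proof. unfold cis. rewrite <- Cexp_0. f_equal. ring. Qed.

Lemma cis_2PI : cis (2 * PI) = 1%C.
Proof.
  unfold cis, Cexp. apply Ceq; simpl.
  - replace (2 * PI * 1 + 0 * 0) with (2 * PI) by ring. replace (2 * PI * 0 - 0 * 1) with 0 by ring. rewrite exp_0, cos_2PI. ring.
  - replace (2 * PI * 1 + 0 * 0) with (2 * PI) by ring. rewrite sin_2PI. ring.
Qed.

Lemma cis_opp a : (cis a * cis (- a))%C = 1%C.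
Proof. rewrite <- cis_plus, Rplus_opp_r. apply cis_0. Qed.

Lemma cis_nat n : cis (2 * PI * INR n) = 1%C.
Proof.
  induction n as [|n IH]; [simpl; rewrite Rmult_0_r; apply cis_0|].
  rewrite S_INR. replace (2 * PI * (INR n + 1)) with (2 * PI * INR n + 2 * PI) by ring. rewrite cis_plus, IH, cis_2PI. ring.
Qed.

Lemma cis_Z (n : Z) : cis (2 * PI * IZR n) = 1%C.
Proof.
  destruct (Z_le_dec 0 n) as [h|h].
  - rewrite <- (Z2Nat.id n h), <- INR_IZR_INZ. apply cis_nat.
  - pose proof (cis_opp (2 * PI * IZR n)) as e. replace (- (2 * PI * IZR n)) with (2 * PI * INR (Z.to_nat (- n))) in e.
    + rewrite cis_nat, Cmult_1_r in e. exact e.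
    + rewrite INR_IZR_INZ, Z2Nat.id, opp_IZR by lia. ring.
Qed.

Lemma Cder_cis a t : Cder (fun t => cis (a * t)) t (RtoC a * Ci * cis (a * t))%C.
Proof.
  apply Cder_ext with (fun t => Cexp (RtoC t * (RtoC a * Ci)))%C.
  { intros x. unfold cis. f_equal. rewrite RtoC_mult. ring. }
  eapply Cder_eq; [apply Cder_Cexp, Cder_linear|]. unfold cis. f_equal. f_equal. rewrite RtoC_mult. ring.
Qed.

Lemma Ccont_cis a t : Ccont (fun t => cis (a * t)) t.
Proof. eapply Cder_cont, Cder_cis. Qed.

Lemma CInt_lin f g a b x y : (forall t, Ccont f t) -> (forall t, Ccont g t) ->
  CInt (fun t => x * f t + y * g t)%C a b = (x * CInt f a b + y * CInt g a b)%C.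
Proof.
  intros h1 h2. apply is_CInt_unique. apply is_CInt_plus; apply is_CInt_Cmult; apply CInt_correct; auto.
Qed.

Lemma CInt_Cmult f a b x : (forall t, Ccont f t) -> CInt (fun t => x * f t)%C a b = (x * CInt f a b)%C.
Proof. intros h1. apply is_CInt_unique, is_CInt_Cmult, CInt_correct; auto. Qed.

Lemma RInt_periodic (f : R -> R) a : (forall t, continuous f t) -> (forall t, f (t + 1) = f t) -> RInt (fun t => f (t + a)) 0 1 = RInt f 0 1.
Proof.
  intros hc hp.
  assert (sh : forall u v c, RInt (fun t => f (t + c)) u v = RInt f (u + c) (v + c)).
  { intros u v c. assert (e := RInt_comp_lin (V := R_CompleteNormedModule) f 1 c u v (ex_RInt_cont _ _ _ hc)).
    rewrite !Rmult_1_l in e. rewrite <- e. apply RInt_ext. intros x _. unfold scal; simpl; unfold mult; simpl. rewrite !Rmult_1_l. reflexivity. }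
  rewrite sh, Rplus_0_l.
  assert (e1 := RInt_Chasles (V := R_CompleteNormedModule) f 0 a (1 + a) (ex_RInt_cont _ _ _ hc) (ex_RInt_cont _ _ _ hc)).
  assert (e2 := RInt_Chasles (V := R_CompleteNormedModule) f 0 1 (1 + a) (ex_RInt_cont _ _ _ hc) (ex_RInt_cont _ _ _ hc)).
  assert (e3 : RInt f 1 (1 + a) = RInt f 0 a).
  { pose proof (sh 0 a 1) as q. rewrite Rplus_0_l, (Rplus_comm a) in q. rewrite <- q. apply RInt_ext. intros; apply hp. }
  unfold plus in *; simpl in *. rewrite e3 in e2. rewrite <- e1 in e2. lra.
Qed.

Lemma CInt_periodic f a : (forall t, Ccont f t) -> (forall t, f (t + 1)%R = f t) -> CInt (fun t => f (t + a)%R) 0 1 = CInt f 0 1.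
Proof.
  intros hc hp. unfold CInt. f_equal.
  - apply (RInt_periodic (fun t => Re (f t))); [intros t; exact (proj1 (hc t)) | intros; now rewrite hp].
  - apply (RInt_periodic (fun t => Im (f t))); [intros t; exact (proj2 (hc t)) | intros; now rewrite hp].
Qed.

(** A non-negative trigonometric polynomial equal to [1] exactly at the integers; its powers serve
    as peaking kernels. *)
Definition cos2 (t : R) : R := cos (PI * t) ^ 2.

Lemma cos2_cis t : RtoC (cos2 t) = (1/2 + 1/4 * cis (2 * PI * t) + 1/4 * cis (- (2 * PI * t)))%C.
Proof.
  assert (e : forall u, cis u = (cos u, sin u)).
  { intros u. unfold cis, Cexp. apply Ceq; simpl; replace (u * 0 - 0 * 1) with 0 by ring; replace (u * 1 + 0 * 0) with u by ring; rewrite exp_0; ring. }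
  unfold cos2. rewrite !e, cos_neg, sin_neg. replace (2 * PI * t) with (2 * (PI * t)) by ring. rewrite cos_2a_cos.
  rewrite <- !RtoC_div by lra. apply Ceq; simpl; field.
Qed.

Lemma cos2_pow_cont N t : continuous (fun t => cos2 t ^ N) t.
Proof. unfold cos2. apply (ex_derive_continuous (K := R_AbsRing) (V := R_NormedModule)); auto_derive; auto. Qed.

(** By [cos2_cis] each factor [cos2] mixes the frequencies [n - 1], [n] and [n + 1], so the
    induction on [N] runs over all [n] at once. *)
Lemma kernel_zero (g : R -> C) : (forall t, Ccont g t) ->
  (forall n : Z, CInt (fun t => g t * cis (2 * PI * IZR n * t))%C 0 1 = 0%C) ->
  forall N (n : Z), CInt (fun t => RtoC (cos2 t ^ N) * (g t * cis (2 * PI * IZR n * t)))%C 0 1 = 0%C.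
Proof.
  intros hc h. induction N as [|N IH]; intros n.
  - rewrite (CInt_ext _ (fun t => g t * cis (2 * PI * IZR n * t))%C); [apply h|]. intros; simpl; ring.
  - assert (k : forall m t, Ccont (fun t => RtoC (cos2 t ^ N) * (g t * cis (2 * PI * IZR m * t)))%C t).
    { intros m t. apply Ccont_mult; [apply Ccont_RtoC, cos2_pow_cont | apply Ccont_mult; [apply hc | apply Ccont_cis]]. }
    rewrite (CInt_ext _ (fun t => 1/2 * (RtoC (cos2 t ^ N) * (g t * cis (2 * PI * IZR n * t))) +
      1 * (1/4 * (RtoC (cos2 t ^ N) * (g t * cis (2 * PI * IZR (n + 1) * t))) + 1/4 * (RtoC (cos2 t ^ N) * (g t * cis (2 * PI * IZR (n - 1) * t)))))%C).
    + rewrite CInt_lin, CInt_lin, !IH; auto; [ring|]. intros t. apply Ccont_plus; apply Ccont_mult; try apply Ccont_const; apply k.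
    + intros t _. simpl pow. rewrite RtoC_mult, cos2_cis.
      replace (2 * PI * IZR (n + 1) * t) with (2 * PI * IZR n * t + 2 * PI * t) by (rewrite plus_IZR; ring).
      replace (2 * PI * IZR (n - 1) * t) with (2 * PI * IZR n * t + - (2 * PI * t)) by (rewrite minus_IZR; ring).
      rewrite !cis_plus. ring.
Qed.

Definition cos2_moment (N : nat) : R := RInt (fun t => cos2 t ^ N) 0 1.

(** Wallis' recursion: [sin (PI t) cos (PI t)^(2N + 1)] vanishes at both ends, so its derivative has
    integral zero. *)
Lemma cos2_moment_step N : INR (2 * N + 2) * cos2_moment (S N) = INR (2 * N + 1) * cos2_moment N.
Proof.
  pose proof PI_RGT_0.
  set (F := fun t => sin (PI * t) * cos (PI * t) ^ (2 * N + 1)).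
  set (F' := fun t => minus (scal (PI * INR (2 * N + 2)) (cos2 t ^ S N)) (scal (PI * INR (2 * N + 1)) (cos2 t ^ N))).
  assert (hp : forall t, cos (PI * t) ^ (2 * N + 1) = cos (PI * t) * cos2 t ^ N).
  { intros t. unfold cos2. rewrite pow_add, <- pow_mult. simpl (_ ^ 1). ring. }
  assert (hd : forall t, is_derive F t (F' t)).
  { intros t. unfold F, F'. evar_last.
    - apply Derive.is_derive_mult.
      + apply (is_derive_comp sin (fun t => PI * t)); [apply is_derive_sin | auto_derive; [auto | reflexivity]].
      + apply (is_derive_pow (fun t => cos (PI * t))). apply (is_derive_comp cos (fun t => PI * t)); [apply is_derive_cos | auto_derive; [auto | reflexivity]].
    - cbv beta. rewrite hp. replace (Init.Nat.pred (2 * N + 1)) with (2 * N)%nat by lia. rewrite pow_mult.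
      unfold minus, plus, opp, scal; simpl; unfold mult; simpl. fold (cos2 t). change (cos (PI * t) * (cos (PI * t) * 1)) with (cos2 t).
      replace (INR (N + (N + 0) + 2)) with (INR (N + (N + 0) + 1) + 1) by (rewrite <- S_INR; f_equal; lia).
      pose proof (sin2_cos2 (PI * t)) as e. unfold Rsqr in e.
      set (c := cos (PI * t)) in *. set (s := sin (PI * t)) in *. set (q := INR (N + (N + 0) + 1)) in *.
      unfold cos2. fold c. set (w := (c ^ 2) ^ N). eqR.
      replace (s * (q * (PI * 1 * - s) * w)) with (- (PI * q * w) * (s * s)) by ring.
      replace (s * s) with (1 - c * c) by lra. ring. }
  assert (hI := is_RInt_derive (V := R_CompleteNormedModule) F F' 0 1 (fun t _ => hd t)).
  assert (hc : forall t, continuous F' t).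
  { intros t. apply (continuous_minus (V := R_NormedModule)); apply (continuous_scal_r (V := R_NormedModule)), cos2_pow_cont. }
  specialize (hI (fun t _ => hc t)).
  assert (h2 : is_RInt F' 0 1 (minus (scal (PI * INR (2 * N + 2)) (cos2_moment (S N))) (scal (PI * INR (2 * N + 1)) (cos2_moment N)))).
  { apply (is_RInt_minus (V := R_NormedModule)); apply (is_RInt_scal (V := R_NormedModule)), (RInt_correct (V := R_CompleteNormedModule)), ex_RInt_cont, cos2_pow_cont. }
  apply (is_RInt_unique (V := R_CompleteNormedModule)) in hI. apply (is_RInt_unique (V := R_CompleteNormedModule)) in h2. rewrite hI in h2.
  unfold F in h2. rewrite Rmult_1_r, Rmult_0_r, sin_PI, sin_0 in h2.
  set (a := INR (2 * N + 2)) in *. set (b := INR (2 * N + 1)) in *.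
  unfold minus, plus, opp, scal in h2; simpl in h2; unfold mult in h2; simpl in h2.
  apply Rmult_eq_reg_l with PI; lra.
Qed.

Lemma cos2_moment_pos N : 0 < cos2_moment N.
Proof.
  induction N as [|N IH].
  - unfold cos2_moment. simpl. rewrite RInt_const. unfold scal; simpl; unfold mult; simpl. lra.
  - pose proof (cos2_moment_step N) as e. assert (0 < INR (2 * N + 2)) by (apply lt_0_INR; lia). assert (0 < INR (2 * N + 1)) by (apply lt_0_INR; lia).
    assert (0 < INR (2 * N + 2) * cos2_moment (S N)) by (rewrite e; apply Rmult_lt_0_compat; assumption).
    apply Rmult_lt_reg_l with (INR (2 * N + 2)); lra.
Qed.

(* The averages [cos2_moment N] decrease too slowly for a kernel [cos2 ^ N] to be orthogonal to a function positive at its peak. *)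
Lemma kernel_positive (u : R -> R) : (forall t, continuous u t) -> (forall t, u (t + 1) = u t) ->
  (forall N, RInt (fun t => cos2 t ^ N * u t) 0 1 = 0) -> u 0 <= 0.
Proof.
  intros hc hp h. apply Rnot_lt_le. intros hpos. pose proof PI_RGT_0.
  set (eta := u 0 / 2).
  assert (hd : exists d, 0 < d < 1/2 /\ forall t, Rabs t < d -> eta < u t).
  { assert (q : locally (u 0) (fun v => eta < v)) by (apply (open_gt eta); unfold eta; lra).
    destruct (hc 0 _ q) as [d hd]. exists (Rmin d (1/4)). pose proof (Rmin_l d (1/4)). pose proof (Rmin_r d (1/4)). pose proof (cond_pos d).
    split; [split; [apply Rmin_pos; lra | lra]|]. intros t ht. apply hd. change (Rabs (t - 0) < d). rewrite Rminus_0_r. lra. }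
  destruct hd as (d & hd1 & hd2).
  destruct (continuity_ab_min u 0 1 ltac:(lra)) as (tm & hm & _).
  { intros c _. apply continuity_pt_filterlim, hc. }
  set (M := Rabs (u tm)).
  assert (hM : forall t, 0 <= t <= 1 -> - M <= u t).
  { intros t ht. pose proof (hm t ht). pose proof (Rle_abs (- u tm)) as q. rewrite Rabs_Ropp in q. unfold M. lra. }
  set (sd := sin (PI * d) ^ 2).
  assert (hsd : 0 < sd).
  { apply pow_lt, sin_gt_0; [apply Rmult_lt_0_compat; lra|]. rewrite <- (Rmult_1_r PI) at 2. apply Rmult_lt_compat_l; lra. }
  assert (hM0 : 0 <= M) by apply Rabs_pos.
  set (K := (M + eta) / sd). assert (heta : 0 < eta) by (unfold eta; lra).
  assert (hK : 0 < K) by (apply Rdiv_lt_0_compat; lra).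
  assert (hs : forall t, d <= t <= 1 - d -> sd <= 1 - cos2 t).
  { intros t ht. unfold cos2. pose proof (sin2_cos2 (PI * t)) as e. unfold Rsqr in e.
    replace (1 - cos (PI * t) ^ 2) with (sin (PI * t) ^ 2) by (simpl; lra).
    assert (l : forall v, d <= v <= 1/2 -> sin (PI * d) <= sin (PI * v)).
    { intros v hv. apply sin_incr_1; nra. }
    assert (p0 : 0 <= sin (PI * d)) by (apply sin_ge_0; nra).
    apply pow_incr. split; [assumption|]. destruct (Rle_dec t (1/2)) as [z|z]; [apply l; lra|].
    replace (sin (PI * t)) with (sin (PI * (1 - t))); [apply l; lra|].
    replace (PI * (1 - t)) with (PI - PI * t) by ring. rewrite sin_PI_x. reflexivity. }
  assert (hc1 : forall t, 0 <= cos2 t <= 1).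
  { intros t. unfold cos2. pose proof (pow2_ge_0 (cos (PI * t))). pose proof (COS_bound (PI * t)). nra. }
  (* Near the integers this follows from continuity and periodicity; elsewhere [1 - cos2 >= sd], and
     [K sd = M + eta] brings the left side below [- M]. *)
  assert (lb : forall t, 0 <= t <= 1 -> eta - K * (1 - cos2 t) <= u t).
  { intros t ht. pose proof (hc1 t). destruct (Rlt_dec t d) as [z|z]; [|destruct (Rlt_dec (1 - d) t) as [z2|z2]].
    - pose proof (hd2 t ltac:(rewrite Rabs_pos_eq; lra)). nra.
    - replace (u t) with (u (t - 1)) by (rewrite <- (hp (t - 1)); f_equal; ring).
      pose proof (hd2 (t - 1) ltac:(rewrite Rabs_left1; lra)). nra.
    - pose proof (hs t ltac:(lra)) as q. pose proof (hM t ht).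
      assert (K * sd <= K * (1 - cos2 t)) by (apply Rmult_le_compat_l; lra).
      assert (K * sd = M + eta) by (unfold K; field; lra). lra. }
  assert (ineq : forall N, eta * cos2_moment N - K * (cos2_moment N - cos2_moment (S N)) <= 0).
  { intros N. rewrite <- (h N).
    set (F := fun t => plus (scal (eta - K) (cos2 t ^ N)) (scal K (cos2 t ^ S N))).
    assert (e : RInt F 0 1 = (eta - K) * cos2_moment N + K * cos2_moment (S N)).
    { apply is_RInt_unique. apply (is_RInt_plus (V := R_NormedModule)); apply (is_RInt_scal (V := R_NormedModule)), (RInt_correct (V := R_CompleteNormedModule)), ex_RInt_cont, cos2_pow_cont. }
    replace (eta * cos2_moment N - K * (cos2_moment N - cos2_moment (S N))) with (RInt F 0 1) by (rewrite e; Rring).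
    apply RInt_le; [lra | | |].
    - apply ex_RInt_cont. intros t. apply (continuous_plus (V := R_NormedModule)); apply (continuous_scal_r (V := R_NormedModule)), cos2_pow_cont.
    - apply ex_RInt_cont. intros t. apply (continuous_mult (K := R_AbsRing)); [apply cos2_pow_cont | apply hc].
    - intros t ht. unfold F, plus, scal; simpl; unfold mult; simpl.
      pose proof (lb t ltac:(lra)) as q. pose proof (pow_le _ N (proj1 (hc1 t))) as q2.
      replace ((eta - K) * cos2 t ^ N + K * (cos2 t * cos2 t ^ N)) with (cos2 t ^ N * (eta - K * (1 - cos2 t))) by ring.
      apply Rmult_le_compat_l; assumption. }
  (* By the recursion [2N + 2] times the difference of consecutive moments is [cos2_moment N], which
     then divides out; the result fails for large [N]. *)
  assert (bad : forall N, eta * INR (2 * N + 2) <= K).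
  { intros N. pose proof (ineq N) as q. pose proof (cos2_moment_step N) as e. pose proof (cos2_moment_pos N) as p.
    assert (e2 : INR (2 * N + 2) = INR (2 * N + 1) + 1) by (rewrite <- S_INR; f_equal; lia).
    assert (hN : 0 < INR (2 * N + 2)) by (apply lt_0_INR; lia).
    set (a := INR (2 * N + 2)) in *.
    assert (e3 : a * (cos2_moment N - cos2_moment (S N)) = cos2_moment N) by (rewrite Rmult_minus_distr_l, e, e2; ring).
    apply Rmult_le_reg_r with (cos2_moment N); [assumption|]. rewrite <- e3 at 2.
    replace (eta * a * cos2_moment N) with (a * (eta * cos2_moment N)) by ring. replace (K * (a * (cos2_moment N - cos2_moment (S N)))) with (a * (K * (cos2_moment N - cos2_moment (S N)))) by ring.
    apply Rmult_le_compat_l; lra. }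
  destruct (exists_nat_ge (K / eta)) as [N hN]. specialize (bad N).
  assert (INR N < INR (2 * N + 2)) by (apply lt_INR; lia).
  assert (K <= eta * INR N). { replace K with (eta * (K / eta)) by (field; lra). apply Rmult_le_compat_l; lra. }
  assert (eta * INR N < eta * INR (2 * N + 2)) by (apply Rmult_lt_compat_l; assumption). lra.
Qed.

(** The point [x0] is translated to [0], where [kernel_positive] bounds [Re (c f)] above by zero;
    the choices [1], [-1], [i] and [-i] of [c] then force both components to vanish. *)
Lemma fourier_unique (f : R -> C) : (forall t, Ccont f t) -> (forall t, f (t + 1)%R = f t) ->
  (forall n : Z, CInt (fun t => f t * cis (2 * PI * IZR n * t))%C 0 1 = 0%C) -> forall t, f t = 0%C.
Proof.
  intros hc hp h x0.
  assert (main : forall c : C, Re (c * f x0)%C <= 0).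
  { intros c. set (g := fun t => (c * f (t + x0)%R)%C).
    assert (gc : forall t, Ccont g t).
    { intros t. apply Ccont_mult; [apply Ccont_const|]. apply (Ccont_comp f (fun t => t + x0)); [|apply hc].
      apply (ex_derive_continuous (K := R_AbsRing) (V := R_NormedModule)); auto_derive; auto. }
    assert (gp : forall t, g (t + 1)%R = g t).
    { intros t. unfold g. replace (t + 1 + x0) with (t + x0 + 1) by ring. rewrite hp. reflexivity. }
    assert (gz : forall n : Z, CInt (fun t => g t * cis (2 * PI * IZR n * t))%C 0 1 = 0%C).
    { intros n. set (F := fun t => (f t * cis (2 * PI * IZR n * t))%C).
      assert (fc : forall t, Ccont F t) by (intros; apply Ccont_mult; [apply hc | apply Ccont_cis]).
      rewrite (CInt_ext _ (fun t => (c * cis (2 * PI * IZR n * - x0)) * F (t + x0)%R)%C).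
      - rewrite CInt_Cmult.
        + rewrite CInt_periodic; [unfold F; rewrite h; ring | exact fc |].
          intros t. unfold F. rewrite hp. replace (2 * PI * IZR n * (t + 1)) with (2 * PI * IZR n * t + 2 * PI * IZR n) by ring.
          rewrite cis_plus, cis_Z. ring.
        + intros t. apply (Ccont_comp F (fun t => t + x0)); [|apply fc].
          apply (ex_derive_continuous (K := R_AbsRing) (V := R_NormedModule)); auto_derive; auto.
      - intros t _. unfold g, F. replace (2 * PI * IZR n * t) with (2 * PI * IZR n * - x0 + 2 * PI * IZR n * (t + x0)) by ring. rewrite cis_plus. ring. }
    replace (c * f x0)%C with (g 0) by (unfold g; rewrite Rplus_0_l; reflexivity).
    apply (kernel_positive (fun t => Re (g t))).
    - intros t; exact (proj1 (gc t)).
    - intros t; now rewrite gp.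
    - intros N. pose proof (f_equal Re (kernel_zero g gc gz N 0%Z)) as e. unfold CInt in e. cbn [Re fst] in e. change (Re 0%C) with 0 in e.
      etransitivity; [|exact e]. apply RInt_ext. intros t _. rewrite Re_scal. f_equal. f_equal. rewrite Rmult_0_r, Rmult_0_l, cis_0. ring. }
  pose proof (main 1%C) as m1. pose proof (main (- (1))%C) as m2. pose proof (main Ci) as m3. pose proof (main (- Ci)%C) as m4.
  destruct (f x0) as [a b]. simpl in *. apply Ceq; simpl; lra.
Qed.

(** * Partial derivatives and partial Fourier coefficients *)

Definition jcont (f : R * R -> C) : Prop := forall p : R * R,
  @continuous (prod_UniformSpace R_UniformSpace R_UniformSpace) R_UniformSpace (fun p => Re (f p)) p /\
  @continuous (prod_UniformSpace R_UniformSpace R_UniformSpace) R_UniformSpace (fun p => Im (f p)) p.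

Definition dx (f fx : R * R -> C) : Prop := forall x y, Cder (fun t => f (t, y)) x (fx (x, y)).
Definition dy (f fy : R * R -> C) : Prop := forall x y, Cder (fun t => f (x, t)) y (fy (x, y)).

Lemma is_derive_C_R (f : R -> C) x l : @is_derive R_AbsRing C_R_NormedModule f x l <-> Cder f x l.
Proof.
  split.
  - intros h. split.
    + assert (k := filterdiff_comp' f (fun z : C_R_NormedModule => (fst z : R_NormedModule)) x _ _ h (filterdiff_linear _ (is_linear_fst (U := R_NormedModule) (V := R_NormedModule)))).
      exact k.
    + assert (k := filterdiff_comp' f (fun z : C_R_NormedModule => (snd z : R_NormedModule)) x _ _ h (filterdiff_linear _ (is_linear_snd (U := R_NormedModule) (V := R_NormedModule)))).
      exact k.
  - intros [h1 h2].
    assert (k := is_derive_plus (V := C_R_NormedModule) _ _ _ _ _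
      (is_derive_scal_l (V := C_R_NormedModule) (fun t => Re (f t)) x (Re l) (1, 0) h1)
      (is_derive_scal_l (V := C_R_NormedModule) (fun t => Im (f t)) x (Im l) (0, 1) h2)).
    evar_last; [eapply is_derive_ext; [|exact k]|].
    + intros t. apply Ceq; [change (Re (f t) * 1 + Im (f t) * 0 = Re (f t)) | change (Re (f t) * 0 + Im (f t) * 1 = Im (f t))]; ring.
    + apply Ceq; [change (Re l * 1 + Im l * 0 = Re l) | change (Re l * 0 + Im l * 1 = Im l)]; ring.
Qed.

Lemma partial_x_dx f fx : is_partial_x f fx <-> dx f fx.
Proof. split; intros h x y; apply is_derive_C_R, h. Qed.

Lemma partial_y_dy f fy : is_partial_y f fy <-> dy f fy.
Proof. split; intros h x y; apply is_derive_C_R, h. Qed.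

Lemma Cder_unique f x l m : Cder f x l -> Cder f x m -> l = m.
Proof.
  intros [a b] [c d]. apply is_derive_unique in a, b, c, d. apply Ceq; congruence.
Qed.

Lemma dx_unique f g h : dx f g -> dx f h -> g = h.
Proof. intros a b. apply functional_extensionality. intros [x y]. apply (Cder_unique _ _ _ _ (a x y) (b x y)). Qed.

Lemma dy_unique f g h : dy f g -> dy f h -> g = h.
Proof. intros a b. apply functional_extensionality. intros [x y]. apply (Cder_unique _ _ _ _ (a x y) (b x y)). Qed.

(** Each order of [class_C] comes with its own witnesses for the partial derivatives; their
    uniqueness allows one pair to serve for all orders. *)
Lemma smooth_partials f : smooth f -> exists fx fy, dx f fx /\ dy f fy /\ smooth fx /\ smooth fy.
Proof.
  intros h. destruct (h 1%nat) as (fx & fy & px & py & _). apply partial_x_dx in px. apply partial_y_dy in py.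
  exists fx, fy. split; [assumption|]. split; [assumption|]. split; intros n;
  destruct (h (S n)) as (gx & gy & qx & qy & c1 & c2); apply partial_x_dx in qx; apply partial_y_dy in qy.
  - rewrite (dx_unique _ _ _ px qx). exact c1.
  - rewrite (dy_unique _ _ _ py qy). exact c2.
Qed.

Lemma smooth_jcont f : smooth f -> jcont f.
Proof.
  intros h p. pose proof (h 0%nat p) as c. split.
  - apply (continuous_comp f (fun z : C_UniformSpace => (fst z : R_UniformSpace))); [exact c|]. apply continuous_fst.
  - apply (continuous_comp f (fun z : C_UniformSpace => (snd z : R_UniformSpace))); [exact c|]. apply continuous_snd.
Qed.

Lemma jcont_const c : jcont (fun _ => c).
Proof. intros p; split; apply continuous_const. Qed.

Lemma jcont_plus f g : jcont f -> jcont g -> jcont (fun p => f p + g p)%C.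
Proof.
  intros h k p. destruct (h p), (k p). split.
  - apply (continuous_plus (V := R_NormedModule) (fun p => Re (f p)) (fun p => Re (g p))); assumption.
  - apply (continuous_plus (V := R_NormedModule) (fun p => Im (f p)) (fun p => Im (g p))); assumption.
Qed.

Lemma jcont_mult f g : jcont f -> jcont g -> jcont (fun p => f p * g p)%C.
Proof.
  intros h k p. destruct (h p) as [a b], (k p) as [c d]. split; simpl.
  - apply (continuous_minus (V := R_NormedModule) (fun p => Re (f p) * Re (g p)) (fun p => Im (f p) * Im (g p)));
    apply (continuous_mult (K := R_AbsRing)); assumption.
  - apply (continuous_plus (V := R_NormedModule) (fun p => Re (f p) * Im (g p)) (fun p => Im (f p) * Re (g p)));
    apply (continuous_mult (K := R_AbsRing)); assumption.
Qed.

Lemma jcont_x f y x : jcont f -> Ccont (fun t => f (t, y)) x.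
Proof.
  intros h. destruct (h (x, y)) as [a b].
  assert (c : @continuous R_UniformSpace (prod_UniformSpace R_UniformSpace R_UniformSpace) (fun t : R => (t, y)) x).
  { intros P [eps hP]. exists eps. intros t ht. apply hP. split; [exact ht | apply ball_center]. }
  split.
  - exact (continuous_comp (fun t : R => (t, y)) (fun p => Re (f p)) x c a).
  - exact (continuous_comp (fun t : R => (t, y)) (fun p => Im (f p)) x c b).
Qed.

Lemma jcont_2d (g : R * R -> R) x y :
  @continuous (prod_UniformSpace R_UniformSpace R_UniformSpace) R_UniformSpace g (x, y) -> continuity_2d_pt (fun u v => g (v, u)) y x.
Proof.
  intros h eps. destruct (h (ball (g (x, y)) eps) (locally_ball _ _)) as [d hd]. exists d.
  intros u v hu hv. apply (hd (v, u)). split; assumption.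
Qed.

Definition coefX (a : R) (f : R * R -> C) (y : R) : C := CInt (fun x => f (x, y) * cis (a * x))%C 0 1.

Lemma jcont_cis a b : jcont (fun p => cis (a * fst p + b * snd p)).
Proof.
  assert (l : forall p, @continuous (prod_UniformSpace R_UniformSpace R_UniformSpace) R_UniformSpace (fun p => a * fst p + b * snd p) p).
  { intros p. apply (continuous_plus (V := R_NormedModule) (fun p : R * R => a * fst p) (fun p : R * R => b * snd p)).
    - apply (continuous_scal_r (V := R_NormedModule) a (fun p : R * R => fst p)), continuous_fst.
    - apply (continuous_scal_r (V := R_NormedModule) b (fun p : R * R => snd p)), continuous_snd. }
  assert (c : forall t, Ccont (fun t => cis t) t).
  { intros t. apply Ccont_ext with (fun t => cis (1 * t)); [intros; f_equal; ring | apply Ccont_cis]. }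
  intros p. destruct (c (a * fst p + b * snd p)) as [c1 c2]. split.
  - exact (continuous_comp (fun p : prod_UniformSpace R_UniformSpace R_UniformSpace => a * fst p + b * snd p) (fun t => Re (cis t)) p (l p) c1).
  - exact (continuous_comp (fun p : prod_UniformSpace R_UniformSpace R_UniformSpace => a * fst p + b * snd p) (fun t => Im (cis t)) p (l p) c2).
Qed.

Lemma jcont_cisx f a : jcont f -> jcont (fun p => f p * cis (a * fst p))%C.
Proof.
  intros h. apply jcont_mult; [assumption|]. pose proof (jcont_cis a 0) as k.
  replace (fun p : R * R => cis (a * fst p)) with (fun p : R * R => cis (a * fst p + 0 * snd p)); [exact k|].
  apply functional_extensionality. intros p. f_equal. ring.
Qed.

Lemma coefX_cont f a y x : jcont f -> Ccont (fun x => f (x, y) * cis (a * x))%C x.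
Proof. intros h. apply (jcont_x (fun p => f p * cis (a * fst p))%C), jcont_cisx, h. Qed.

Lemma coefX_der f fy a y : dy f fy -> jcont f -> jcont fy -> Cder (coefX a f) y (coefX a fy y).
Proof.
  intros hd hf hfy.
  set (F := fun p : R * R => (f p * cis (a * fst p))%C). set (Fy := fun p : R * R => (fy p * cis (a * fst p))%C).
  assert (d : dy F Fy).
  { intros x z. assert (q := Cder_mult (fun t => f (x, t)) (fun _ => cis (a * x)) z _ _ (hd x z) (Cder_const _ z)).
    cbv beta in q. replace (Fy (x, z)) with (fy (x, z) * cis (a * x) + f (x, z) * 0)%C by (unfold Fy; simpl; ring). exact q. }
  assert (cF := jcont_cisx f a hf). assert (cFy := jcont_cisx fy a hfy). fold F in cF. fold Fy in cFy.
  assert (main : forall (g : C -> R) (hg : forall z x l, Cder (fun t => F (x, t)) z l -> is_derive (fun t => g (F (x, t))) z (g l)),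
     (forall p, @continuous (prod_UniformSpace R_UniformSpace R_UniformSpace) R_UniformSpace (fun p => g (F p)) p) ->
     (forall p, @continuous (prod_UniformSpace R_UniformSpace R_UniformSpace) R_UniformSpace (fun p => g (Fy p)) p) ->
     (forall z x, continuous (fun x => g (F (x, z))) x) ->
     is_derive (fun z => RInt (fun x => g (F (x, z))) 0 1) y (RInt (fun x => g (Fy (x, y))) 0 1)).
  { intros g hg g1 g2 g3.
    assert (e : forall z x, Derive (fun t => g (F (x, t))) z = g (Fy (x, z))) by (intros; apply is_derive_unique, hg, d).
    evar_last.
    - apply (is_derive_RInt_param (fun z x => g (F (x, z))) 0 1 y).
      + exists (mkposreal 1 Rlt_0_1). intros z _ t _. eexists; apply hg, d.
      + intros t _. apply (continuity_2d_pt_ext (fun u v => g (Fy (v, u)))); [intros; symmetry; apply e|].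
        apply (jcont_2d (fun p => g (Fy p))), g2.
      + exists (mkposreal 1 Rlt_0_1). intros z _. apply ex_RInt_cont, g3.
    - apply RInt_ext. intros; apply e. }
  split.
  - apply (main Re); [intros z x l [q _]; exact q | intros; apply cF | intros; apply cFy | intros z x; apply (jcont_x F z x cF)].
  - apply (main Im); [intros z x l [_ q]; exact q | intros; apply cF | intros; apply cFy | intros z x; apply (jcont_x F z x cF)].
Qed.

Lemma coefX_lin f g a y u v : jcont f -> jcont g -> coefX a (fun p => u * f p + v * g p)%C y = (u * coefX a f y + v * coefX a g y)%C.
Proof.
  intros hf hg. unfold coefX. rewrite <- CInt_lin; [|intros; apply coefX_cont; assumption | intros; apply coefX_cont; assumption].
  apply CInt_ext. intros; ring.
Qed.

(** The boundary conditions concern the products with the exponential, because in the [y] direction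
    neither factor needs to be periodic by itself. *)
Lemma by_parts_2 (h h1 h2 : R -> C) g a b : (forall t, Cder h t (h1 t)) -> (forall t, Cder h1 t (h2 t)) -> (forall t, Ccont h2 t) ->
  (h b * cis (g * b) = h a * cis (g * a))%C -> (h1 b * cis (g * b) = h1 a * cis (g * a))%C ->
  CInt (fun t => h2 t * cis (g * t))%C a b = (- RtoC (g ^ 2) * CInt (fun t => h t * cis (g * t))%C a b)%C.
Proof.
  intros d1 d2 c2 b0 b1.
  assert (step : forall k k1 : R -> C, (forall t, Cder k t (k1 t)) -> (forall t, Ccont k1 t) -> (k b * cis (g * b) = k a * cis (g * a))%C ->
     CInt (fun t => k1 t * cis (g * t))%C a b = (- (RtoC g * Ci) * CInt (fun t => k t * cis (g * t))%C a b)%C).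
  { intros k k1 dk ck hb.
    assert (e := is_CInt_parts (fun t => cis (g * t)) (fun t => RtoC g * Ci * cis (g * t))%C k k1 a b
      (fun t _ => Cder_cis g t) (fun t _ => dk t) (fun t _ => Ccont_mult _ _ t (Ccont_const _ t) (Ccont_cis g t)) (fun t _ => ck t)).
    rewrite (CInt_ext _ (fun t => cis (g * t) * k1 t)%C) by (intros; ring). rewrite e.
    rewrite (CInt_ext (fun t => RtoC g * Ci * cis (g * t) * k t)%C (fun t => (RtoC g * Ci) * (k t * cis (g * t)))%C) by (intros; ring).
    rewrite CInt_Cmult.
    - replace (cis (g * b) * k b)%C with (k b * cis (g * b))%C by ring. rewrite hb. ring.
    - intros t. apply Ccont_mult; [eapply Cder_cont, dk | apply Ccont_cis]. }
  rewrite (step h1 h2 d2 c2 b1), (step h h1 d1); [| intros t; eapply Cder_cont, d2 | exact b0].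
  assert (i2 : (Ci * Ci)%C = (- (1))%C) by (apply Ceq; simpl; ring).
  replace (- (RtoC g * Ci) * (- (RtoC g * Ci) * CInt (fun t => h t * cis (g * t)) a b))%C with ((Ci * Ci) * (RtoC g * RtoC g) * CInt (fun t => h t * cis (g * t)) a b)%C by ring.
  rewrite i2, <- RtoC_mult. replace (g * g) with (g ^ 2) by ring. ring.
Qed.

(** * Fourier coefficients on the torus *)

Section Torus.
Variables (A B : R) (hB : 0 < B).

Definition per (f : R * R -> C) : Prop := (forall x y, f (x + 1, y) = f (x, y)) /\ (forall x y, f (x + A, y + B) = f (x, y)).

Lemma per_iff f : periodic (lattice A B) f <-> per f.
Proof.
  split.
  - intros h. split; intros x y.
    + rewrite <- (h (1, 0) (x, y)); [simpl; rewrite Rplus_0_r; reflexivity|]. exists 1%Z, 0%Z. simpl. f_equal; ring.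
    + rewrite <- (h (A, B) (x, y)); [reflexivity|]. exists 0%Z, 1%Z. simpl. f_equal; ring.
  - intros [p1 p2] v [x y] (a & b & e). subst v. simpl.
    assert (k1 : forall (n : nat) x y, f (x + INR n, y) = f (x, y)).
    { induction n as [|n IH]; intros u v; [simpl; rewrite Rplus_0_r; reflexivity|]. rewrite S_INR, <- Rplus_assoc, p1. apply IH. }
    assert (k2 : forall (n : nat) x y, f (x + INR n * A, y + INR n * B) = f (x, y)).
    { induction n as [|n IH]; intros u v; [simpl; rewrite !Rmult_0_l, !Rplus_0_r; reflexivity|].
      rewrite S_INR. replace (u + (INR n + 1) * A) with (u + INR n * A + A) by ring. replace (v + (INR n + 1) * B) with (v + INR n * B + B) by ring. rewrite p2. apply IH. }
    assert (z1 : forall (n : Z) x y, f (x + IZR n, y) = f (x, y)).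
    { intros n u v. destruct (Z_le_dec 0 n) as [q|q].
      - rewrite <- (Z2Nat.id n q), <- INR_IZR_INZ. apply k1.
      - rewrite <- (k1 (Z.to_nat (- n)) (u + IZR n) v). rewrite INR_IZR_INZ, Z2Nat.id, opp_IZR by lia. f_equal. f_equal. ring. }
    assert (z2 : forall (n : Z) x y, f (x + IZR n * A, y + IZR n * B) = f (x, y)).
    { intros n u v. destruct (Z_le_dec 0 n) as [q|q].
      - rewrite <- (Z2Nat.id n q), <- INR_IZR_INZ. apply k2.
      - rewrite <- (k2 (Z.to_nat (- n)) (u + IZR n * A) (v + IZR n * B)). rewrite INR_IZR_INZ, Z2Nat.id, opp_IZR by lia. f_equal. f_equal; ring. }
    replace (x + (IZR a * 1 + IZR b * A)) with (x + IZR b * A + IZR a) by ring.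
    replace (y + (IZR a * 0 + IZR b * B)) with (y + IZR b * B) by ring. rewrite z1, z2. reflexivity.
Qed.

Lemma Cder_shift_back f x c l : Cder (fun t => f (t + c)%R) x l -> Cder f (x + c) l.
Proof.
  intros h. apply Cder_ext with (fun t => f (- c + t + c)%R); [intros; f_equal; ring|].
  replace (x + c) with (c + x) by ring.
  apply (Cder_shift (fun t => f (t + c)%R)). replace (- c + (c + x)) with x by ring. exact h.
Qed.

Lemma per_dx f fx : per f -> dx f fx -> per fx.
Proof.
  intros [p1 p2] d. split; intros x y.
  - apply (Cder_unique (fun t => f (t, y)) (x + 1)); [apply d|].
    apply (Cder_shift_back (fun t => f (t, y))). eapply Cder_ext; [|apply d]. intros; symmetry; apply p1.
  - apply (Cder_unique (fun t => f (t, y + B)) (x + A)); [apply d|].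
    apply (Cder_shift_back (fun t => f (t, y + B))). eapply Cder_ext; [|apply d]. intros; symmetry; apply p2.
Qed.

Lemma per_dy f fy : per f -> dy f fy -> per fy.
Proof.
  intros [p1 p2] d. split; intros x y.
  - apply (Cder_unique (fun t => f (x + 1, t)) y); [apply d|].
    eapply Cder_ext; [|apply d]. intros; symmetry; apply p1.
  - apply (Cder_unique (fun t => f (x + A, t)) (y + B)); [apply d|].
    apply (Cder_shift_back (fun t => f (x + A, t))). eapply Cder_ext; [|apply d]. intros; symmetry; apply p2.
Qed.

Lemma cis_Zopp (n : Z) : cis (- (2 * PI * IZR n)) = 1%C.
Proof. replace (- (2 * PI * IZR n)) with (2 * PI * IZR (- n)) by (rewrite opp_IZR; ring). apply cis_Z. Qed.

(** The second generator shifts [x] by [A]; as the integrand has period [1] in [x], only a phase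
    remains. *)
Lemma coefX_quasi f (n : Z) y : per f -> jcont f ->
  coefX (- (2 * PI * IZR n)) f (y + B) = (cis (- (2 * PI * IZR n) * A) * coefX (- (2 * PI * IZR n)) f y)%C.
Proof.
  intros [p1 p2] hf. set (a := - (2 * PI * IZR n)). unfold coefX.
  set (chi := fun x => (f (x, y) * cis (a * x))%C).
  assert (cc : forall x, Ccont chi x) by (intros; apply coefX_cont, hf).
  rewrite <- (CInt_periodic chi (- A) cc).
  - rewrite <- CInt_Cmult.
    + apply CInt_ext. intros x _. unfold chi. rewrite <- (p2 (x + - A) y). replace (x + - A + A) with x by ring.
      replace (a * x) with (a * A + a * (x + - A)) by ring. rewrite cis_plus. ring.
    + intros t. apply (Ccont_comp chi (fun t => t + - A)); [|apply cc].
      apply (ex_derive_continuous (K := R_AbsRing) (V := R_NormedModule)); auto_derive; auto.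
  - intros t. unfold chi. rewrite p1. replace (a * (t + 1)) with (a * t + a) by ring. rewrite cis_plus. unfold a at 2. rewrite cis_Zopp. ring.
Qed.

Definition freqX (n : Z) : R := - (2 * PI * IZR n).
(** Chosen so that the phase acquired over [[0, B]] cancels the multiplier of [coefX_quasi], see
    [freq_boundary]. The minus signs are those of Fourier coefficients; [mode] has the opposite
    ones. *)
Definition freqY (n m : Z) : R := - (2 * PI * (IZR m - IZR n * A) / B).

Definition Lcoef (n m : Z) (f : R * R -> C) : C := CInt (fun y => coefX (freqX n) f y * cis (freqY n m * y))%C 0 B.

Lemma freq_lamq n m : freqX n ^ 2 + freqY n m ^ 2 = lamq A B n m.
Proof. unfold freqX, freqY, lamq. field. lra. Qed.

Lemma freq_boundary n m : (cis (freqX n * A) * cis (freqY n m * B))%C = 1%C.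
Proof.
  rewrite <- cis_plus. replace (freqX n * A + freqY n m * B) with (- (2 * PI * IZR m)) by (unfold freqX, freqY; field; lra). apply cis_Zopp.
Qed.

Lemma Lcoef_boundary f n m : per f -> jcont f ->
  (coefX (freqX n) f B * cis (freqY n m * B) = coefX (freqX n) f 0 * cis (freqY n m * 0))%C.
Proof.
  intros hp hf. pose proof (coefX_quasi f n 0 hp hf) as e. rewrite Rplus_0_l in e. fold (freqX n) in e. rewrite e, Rmult_0_r, cis_0.
  replace (cis (freqX n * A) * coefX (freqX n) f 0 * cis (freqY n m * B))%C with (coefX (freqX n) f 0 * (cis (freqX n * A) * cis (freqY n m * B)))%C by ring.
  rewrite freq_boundary. reflexivity.
Qed.

(** Two integrations by parts in each variable move the Laplacian onto the exponential, so that the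
    eigenvalue equation becomes [(lamq - mu) Lcoef = 0]. *)
Lemma eigen_coef mu f n m : eigenspace (lattice A B) mu f -> mu <> lamq A B n m -> Lcoef n m f = 0%C.
Proof.
  intros (hs & hp & hl) hne. apply per_iff in hp.
  destruct hl as (fx & fy & fxx & fyy & q1 & q2 & q3 & q4 & e).
  apply partial_x_dx in q1, q2. apply partial_y_dy in q3, q4.
  destruct (smooth_partials f hs) as (gx & gy & d1 & d2 & s1 & s2).
  rewrite <- (dx_unique _ _ _ q1 d1) in s1. rewrite <- (dy_unique _ _ _ q3 d2) in s2.
  destruct (smooth_partials fx s1) as (gxx & _ & d3 & _ & s3 & _). rewrite <- (dx_unique _ _ _ q2 d3) in s3.
  destruct (smooth_partials fy s2) as (_ & gyy & _ & d4 & _ & s4). rewrite <- (dy_unique _ _ _ q4 d4) in s4.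
  (* The third derivative in [y] gives the continuity of [coefX a fyy], as a differentiable function
     of [y]. *)
  destruct (smooth_partials fyy s4) as (_ & fyyy & _ & d5 & _ & s5).
  pose proof (smooth_jcont _ hs) as c0. pose proof (smooth_jcont _ s1) as c1. pose proof (smooth_jcont _ s2) as c2.
  pose proof (smooth_jcont _ s3) as c3. pose proof (smooth_jcont _ s4) as c4. pose proof (smooth_jcont _ s5) as c5.
  pose proof (per_dx _ _ hp q1) as px. pose proof (per_dy _ _ hp q3) as py.
  set (a := freqX n). set (b := freqY n m).
  assert (hx : forall y, coefX a fxx y = (- RtoC (a ^ 2) * coefX a f y)%C).
  { intros y. unfold coefX. apply (by_parts_2 (fun x => f (x, y)) (fun x => fx (x, y)) (fun x => fxx (x, y))).
    - intros t; apply q1.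
    - intros t; apply q2.
    - intros t; apply jcont_x, c3.
    - rewrite Rmult_1_r, Rmult_0_r, cis_0. unfold a, freqX. rewrite cis_Zopp, <- (proj1 hp 0 y), Rplus_0_l. reflexivity.
    - rewrite Rmult_1_r, Rmult_0_r, cis_0. unfold a, freqX. rewrite cis_Zopp, <- (proj1 px 0 y), Rplus_0_l. reflexivity. }
  assert (hyy : forall y, coefX a fyy y = ((RtoC (a ^ 2) - RtoC mu) * coefX a f y)%C).
  { intros y. replace fyy with (fun p => - RtoC mu * f p + - (1) * fxx p)%C.
    - rewrite coefX_lin, hx by assumption. ring.
    - apply functional_extensionality. intros p. replace (- RtoC mu * f p)%C with (- (RtoC mu * f p))%C by ring. rewrite e. ring. }
  assert (L := by_parts_2 (coefX a f) (coefX a fy) (coefX a fyy) b 0 B (fun t => coefX_der f fy a t q3 c0 c2) (fun t => coefX_der fy fyy a t q4 c2 c4)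
     (fun t => Cder_cont _ _ _ (coefX_der fyy fyyy a t d5 c4 c5)) (Lcoef_boundary f n m hp c0) (Lcoef_boundary fy n m py c2)).
  rewrite (CInt_ext _ (fun t => (RtoC (a ^ 2) - RtoC mu) * (coefX a f t * cis (b * t)))%C) in L by (intros; rewrite hyy; ring).
  rewrite CInt_Cmult in L.
  2:{ intros t. apply Ccont_mult; [eapply Cder_cont, (coefX_der f fy); assumption | apply Ccont_cis]. }
  fold (Lcoef n m f) in L. change (CInt (fun t => coefX a f t * cis (b * t))%C 0 B) with (Lcoef n m f) in L.
  assert (z : ((RtoC (lamq A B n m - mu)) * Lcoef n m f)%C = 0%C).
  { rewrite <- freq_lamq. fold a b. rewrite RtoC_minus, RtoC_plus.
    replace ((RtoC (a ^ 2) + RtoC (b ^ 2) - RtoC mu) * Lcoef n m f)%C with ((RtoC (a ^ 2) - RtoC mu) * Lcoef n m f + RtoC (b ^ 2) * Lcoef n m f)%C by ring.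
    rewrite L. ring. }
  replace (Lcoef n m f) with (RtoC (/ (lamq A B n m - mu)) * (RtoC (lamq A B n m - mu) * Lcoef n m f))%C.
  - rewrite z. ring.
  - rewrite Cmult_assoc, <- RtoC_mult, Rinv_l by lra. ring.
Qed.

(** In [y], the function [D] is [coefX] rescaled to period [1] and freed of its multiplier, so
    [fourier_unique] makes every [coefX] vanish; applied once more in [x], it gives [g = 0]. *)
Lemma Lcoef_unique g gy : per g -> jcont g -> dy g gy -> jcont gy -> (forall n m, Lcoef n m g = 0%C) -> forall p, g p = 0%C.
Proof.
  intros hp hg hd hgy h.
  assert (hc : forall (n : Z) y, Ccont (coefX (freqX n) g) y) by (intros; eapply Cder_cont, (coefX_der g gy); assumption).
  assert (c0 : forall (n : Z) y, coefX (freqX n) g y = 0%C).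
  { intros n.
    set (D := fun t => (coefX (freqX n) g (B * t) * cis (2 * PI * IZR n * A * t))%C).
    assert (hD : forall t, D t = 0%C).
    { apply fourier_unique.
      - intros t. apply Ccont_mult; [|apply Ccont_cis]. apply (Ccont_comp (coefX (freqX n) g) (fun t => B * t)); [|apply hc].
        apply (ex_derive_continuous (K := R_AbsRing) (V := R_NormedModule)); auto_derive; auto.
      - intros t. unfold D. replace (B * (t + 1)) with (B * t + B) by ring. unfold freqX. rewrite coefX_quasi by assumption.
        replace (2 * PI * IZR n * A * (t + 1)) with (2 * PI * IZR n * A * t + 2 * PI * IZR n * A) by ring. rewrite cis_plus.
        pose proof (cis_opp (2 * PI * IZR n * A)) as q. replace (- (2 * PI * IZR n * A)) with (- (2 * PI * IZR n) * A) in q by ring.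
        set (X := cis (- (2 * PI * IZR n) * A)) in *. set (Y := cis (2 * PI * IZR n * A)) in *. set (c := coefX _ g (B * t)).
        replace (X * c * (cis (2 * PI * IZR n * A * t) * Y))%C with ((Y * X) * (c * cis (2 * PI * IZR n * A * t)))%C by ring. rewrite q. ring.
      (* The index is [- k] because [freqY] carries a minus sign. *)
      - intros k. set (F := fun y => (coefX (freqX n) g y * cis (freqY n (- k) * y))%C).
        assert (fc : forall y, Ccont F y) by (intros; apply Ccont_mult; [apply hc | apply Ccont_cis]).
        assert (e : is_CInt (fun t => RtoC B * F (B * t)%R)%C 0 1 (Lcoef n (- k) g)).
        { assert (q : is_CInt F (B * 0 + 0) (B * 1 + 0) (Lcoef n (- k) g)).
          { replace (B * 0 + 0) with 0 by ring. replace (B * 1 + 0) with B by ring. apply CInt_correct. intros; apply fc. }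
          destruct q as [q1 q2]. split.
          - apply (is_RInt_comp_lin (V := R_NormedModule)) in q1. eapply is_RInt_ext; [|exact q1]. intros x _. cbv beta. rewrite Rplus_0_r, Re_scal. reflexivity.
          - apply (is_RInt_comp_lin (V := R_NormedModule)) in q2. eapply is_RInt_ext; [|exact q2]. intros x _. cbv beta. rewrite Rplus_0_r, Im_scal. reflexivity. }
        apply is_CInt_unique in e. rewrite h in e.
        assert (fc' : forall t, Ccont (fun t => F (B * t)%R) t).
        { intros t. apply (Ccont_comp F (fun t => B * t)); [|apply fc]. apply (ex_derive_continuous (K := R_AbsRing) (V := R_NormedModule)); auto_derive; auto. }
        rewrite CInt_Cmult in e by exact fc'.
        transitivity (RtoC (/ B) * (RtoC B * CInt (fun t => F (B * t)%R) 0 1))%C; [|rewrite e; ring].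
        rewrite Cmult_assoc, <- RtoC_mult, Rinv_l, Cmult_1_l by lra. apply CInt_ext. intros t _. unfold D, F.
        replace (freqY n (- k) * (B * t)) with (2 * PI * IZR n * A * t + 2 * PI * IZR k * t) by (unfold freqY; rewrite opp_IZR; field; lra).
        rewrite cis_plus. ring. }
    intros y. specialize (hD (y / B)). unfold D in hD. replace (B * (y / B)) with y in hD by (field; lra).
    pose proof (cis_opp (2 * PI * IZR n * A * (y / B))) as q. set (c := coefX (freqX n) g y) in *. set (X := cis (2 * PI * IZR n * A * (y / B))) in *.
    replace c with ((c * X) * cis (- (2 * PI * IZR n * A * (y / B))))%C.
    - rewrite hD. ring.
    - rewrite <- Cmult_assoc, q. ring. }
  intros [x y]. apply (fourier_unique (fun x => g (x, y))).
  - intros t; apply jcont_x, hg.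
  - intros t; apply (proj1 hp).
  - intros k. specialize (c0 (- k)%Z y). unfold coefX, freqX in c0. rewrite opp_IZR in c0.
    rewrite <- c0. apply CInt_ext. intros t _. do 2 f_equal. ring.
Qed.
End Torus.

(** * Exponential modes and the spectrum *)

Lemma CInt_cis_0 g b : g <> 0 -> cis (g * b) = 1%C -> CInt (fun t => cis (g * t)) 0 b = 0%C.
Proof.
  intros hg hb.
  assert (e : is_CInt (fun t => RtoC g * Ci * cis (g * t))%C 0 b (cis (g * b) - cis (g * 0))%C).
  { apply (is_CInt_der (fun t => cis (g * t))); intros t _; [apply Cder_cis|]. apply Ccont_mult; [apply Ccont_const | apply Ccont_cis]. }
  apply is_CInt_unique in e. rewrite CInt_Cmult in e by (intros; apply Ccont_cis).
  rewrite hb, Rmult_0_r, cis_0 in e.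
  assert (i2 : (Ci * Ci)%C = (- (1))%C) by (apply Ceq; simpl; ring).
  set (X := CInt (fun t => cis (g * t)) 0 b) in *.
  transitivity (- RtoC (/ g) * Ci * (RtoC g * Ci * X))%C; [|rewrite e; ring].
  replace (- RtoC (/ g) * Ci * (RtoC g * Ci * X))%C with (- (Ci * Ci) * (RtoC (/ g) * RtoC g) * X)%C by ring.
  rewrite i2, <- RtoC_mult, Rinv_l by assumption. ring.
Qed.

Lemma CInt_const c b : CInt (fun _ => c) 0 b = (RtoC b * c)%C.
Proof.
  apply is_CInt_unique. replace (RtoC b * c)%C with (RtoC b * c - RtoC 0 * c)%C by ring.
  apply (is_CInt_der (fun t => RtoC t * c)%C); intros; [apply Cder_linear | apply Ccont_const].
Qed.

Lemma csum_single (f : nat -> C) n j : (j < n)%nat -> (forall i, (i < n)%nat -> i <> j -> f i = 0%C) -> csum f n = f j.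
Proof.
  induction n as [|n IH]; intros hj h; [lia|]. simpl. destruct (Nat.eq_dec j n) as [->|q].
  - rewrite (csum_ext f (fun i => 0 * f i)%C), csum_Cmult; [ring|]. intros i hi. rewrite h by lia. ring.
  - rewrite IH, (h n) by (try lia; intros; apply h; lia). ring.
Qed.

Lemma csum_zero (f : nat -> C) n : (forall i, (i < n)%nat -> f i = 0%C) -> csum f n = 0%C.
Proof. induction n as [|n IH]; intros h; [reflexivity|]. simpl. rewrite IH, h by auto. ring. Qed.

Lemma sum_n_m_csum (F : nat -> C) n : sum_n_m F 1 n = csum (fun i => F (S i)) n.
Proof.
  induction n as [|n IH].
  - rewrite sum_n_m_zero by lia. reflexivity.
  - rewrite sum_n_Sm, IH by lia. reflexivity.
Qed.

(** Just enough regularity for [coefX] to be differentiable, hence continuous in [y], so that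
    [Lcoef] is linear; it is stable under finite combinations. *)
Definition good (g : R * R -> C) : Prop := jcont g /\ exists gy, dy g gy /\ jcont gy.

Lemma good_lin f g u v : good f -> good g -> good (fun p => u * f p + v * g p)%C.
Proof.
  intros (c1 & f' & d1 & c1') (c2 & g' & d2 & c2'). split.
  - apply jcont_plus; apply jcont_mult; try apply jcont_const; assumption.
  - exists (fun p => u * f' p + v * g' p)%C. split.
    + intros x y. eapply Cder_eq; [apply Cder_plus; (apply Cder_mult; [apply Cder_const | auto])|]. cbv beta. ring.
    + apply jcont_plus; apply jcont_mult; try apply jcont_const; assumption.
Qed.

Lemma good_csum (g : nat -> R * R -> C) (c : nat -> C) n : (forall i, good (g i)) -> good (fun p => csum (fun i => c i * g i p)%C n).
Proof.
  intros h. induction n as [|n IH].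
  - split; [exact (jcont_const 0%C)|]. exists (fun _ => 0%C). split; [intros x y; exact (Cder_const 0%C y) | apply jcont_const].
  - pose proof (good_lin _ _ 1 (c n) IH (h n)) as q. simpl.
    replace (fun p => csum (fun i => c i * g i p) n + c n * g n p)%C with (fun p => 1 * csum (fun i => c i * g i p) n + c n * g n p)%C; [exact q|].
    apply functional_extensionality. intros p. ring.
Qed.

Section Spectrum.
Variables (A B : R) (hB : 0 < B).

Lemma per_lin f g u v : per A B f -> per A B g -> per A B (fun p => u * f p + v * g p)%C.
Proof. intros [a b] [c d]. split; intros x y; [rewrite a, c | rewrite b, d]; reflexivity. Qed.

Lemma per_csum (g : nat -> R * R -> C) (c : nat -> C) n : (forall i, per A B (g i)) -> per A B (fun p => csum (fun i => c i * g i p)%C n).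
Proof. intros h. split; intros x y; apply csum_ext; intros i _; [rewrite (proj1 (h i)) | rewrite (proj2 (h i))]; reflexivity. Qed.

Lemma Lcoef_lin n m f g u v : good f -> good g ->
  Lcoef A B n m (fun p => u * f p + v * g p)%C = (u * Lcoef A B n m f + v * Lcoef A B n m g)%C.
Proof.
  intros (c1 & f' & d1 & c1') (c2 & g' & d2 & c2'). unfold Lcoef. rewrite <- CInt_lin.
  - apply CInt_ext. intros y _. rewrite coefX_lin by assumption. ring.
  - intros t. apply Ccont_mult; [eapply Cder_cont, (coefX_der f f'); assumption | apply Ccont_cis].
  - intros t. apply Ccont_mult; [eapply Cder_cont, (coefX_der g g'); assumption | apply Ccont_cis].
Qed.

Lemma Lcoef_zero n m : Lcoef A B n m (fun _ => 0%C) = 0%C.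
Proof.
  assert (h : good (fun _ => 0%C)).
  { split; [apply jcont_const|]. exists (fun _ => 0%C). split; [intros x y; apply Cder_const | apply jcont_const]. }
  transitivity (Lcoef A B n m (fun p : R * R => 0 * (fun _ : R * R => 0%C) p + 0 * (fun _ : R * R => 0%C) p)%C).
  - f_equal. apply functional_extensionality. intros p. ring.
  - rewrite (Lcoef_lin n m _ _ 0 0 h h). ring.
Qed.

Lemma Lcoef_csum n m (g : nat -> R * R -> C) (c : nat -> C) N : (forall i, good (g i)) ->
  Lcoef A B n m (fun p => csum (fun i => c i * g i p)%C N) = csum (fun i => c i * Lcoef A B n m (g i))%C N.
Proof.
  intros h. induction N as [|N IH]; [apply Lcoef_zero|]. simpl. rewrite <- IH.
  transitivity (Lcoef A B n m (fun p => 1 * csum (fun i => c i * g i p) N + c N * g N p)%C).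
  - f_equal. apply functional_extensionality. intros p. ring.
  - rewrite Lcoef_lin; [ring | apply good_csum, h | apply h].
Qed.

Definition mode (n m : Z) (p : R * R) : C := cis (- freqX n * fst p + - freqY A B n m * snd p).

Lemma mode_dx n m : dx (mode n m) (fun p => RtoC (- freqX n) * Ci * mode n m p)%C.
Proof.
  intros x y. unfold mode. simpl. set (a := - freqX n). set (b := - freqY A B n m).
  apply Cder_ext with (fun t => cis (a * t) * cis (b * y))%C; [intros; rewrite cis_plus; reflexivity|].
  eapply Cder_eq; [apply Cder_mult; [apply Cder_cis | apply Cder_const]|]. cbv beta. rewrite cis_plus. ring.
Qed.

Lemma mode_dy n m : dy (mode n m) (fun p => RtoC (- freqY A B n m) * Ci * mode n m p)%C.
Proof.
  intros x y. unfold mode. simpl. set (a := - freqX n). set (b := - freqY A B n m).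
  apply Cder_ext with (fun t => cis (a * x) * cis (b * t))%C; [intros; rewrite cis_plus; reflexivity|].
  eapply Cder_eq; [apply Cder_mult; [apply Cder_const | apply Cder_cis]|]. cbv beta. rewrite cis_plus. ring.
Qed.

Lemma mode_jcont n m : jcont (mode n m).
Proof. apply jcont_cis. Qed.

Lemma dx_Cmult c f fx : dx f fx -> dx (fun p => c * f p)%C (fun p => c * fx p)%C.
Proof. intros h x y. eapply Cder_eq; [apply Cder_mult; [apply Cder_const | apply h]|]. cbv beta. ring. Qed.

Lemma dy_Cmult c f fy : dy f fy -> dy (fun p => c * f p)%C (fun p => c * fy p)%C.
Proof. intros h x y. eapply Cder_eq; [apply Cder_mult; [apply Cder_const | apply h]|]. cbv beta. ring. Qed.

(** The constant [c] is generalised because differentiation multiplies a mode by a constant. *)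
Lemma mode_class n m k : forall c, class_C k (fun p => c * mode n m p)%C.
Proof.
  induction k as [|k IH]; intros c.
  - intros p. assert (h : jcont (fun p => c * mode n m p)%C) by (apply jcont_mult; [apply jcont_const | apply mode_jcont]).
    destruct (h p) as [h1 h2]. intros P [eps hP].
    unfold filtermap. apply (filter_imp (fun q => ball (Re (c * mode n m p)%C) eps (Re (c * mode n m q)%C) /\ ball (Im (c * mode n m p)%C) eps (Im (c * mode n m q)%C))).
    + intros q [q1 q2]. apply hP. split; [exact q1 | exact q2].
    + apply filter_and; [apply (h1 _ (locally_ball _ eps)) | apply (h2 _ (locally_ball _ eps))].
  - exists (fun p => c * (RtoC (- freqX n) * Ci * mode n m p))%C, (fun p => c * (RtoC (- freqY A B n m) * Ci * mode n m p))%C.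
    split; [apply partial_x_dx, dx_Cmult, mode_dx|]. split; [apply partial_y_dy, dy_Cmult, mode_dy|].
    assert (e : forall d : C, (fun p => c * (d * mode n m p))%C = (fun p => (c * d) * mode n m p)%C).
    { intros d. apply functional_extensionality. intros p. ring. }
    rewrite !e. split; apply IH.
Qed.

Lemma mode_smooth n m : smooth (mode n m).
Proof.
  intros k. replace (mode n m) with (fun p => 1 * mode n m p)%C; [apply mode_class|]. apply functional_extensionality. intros p; ring.
Qed.

Lemma mode_per n m : per A B (mode n m).
Proof.
  split; intros x y; unfold mode; simpl.
  - replace (- freqX n * (x + 1) + - freqY A B n m * y) with (- freqX n * x + - freqY A B n m * y + - freqX n) by ring.
    assert (e : cis (- freqX n) = 1%C) by (unfold freqX; rewrite Ropp_involutive; apply cis_Z).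
    rewrite (cis_plus _ (- freqX n)), e. ring.
  - replace (- freqX n * (x + A) + - freqY A B n m * (y + B)) with (- freqX n * x + - freqY A B n m * y + 2 * PI * IZR m).
    + rewrite (cis_plus _ (2 * PI * IZR m)), cis_Z. ring.
    + unfold freqX, freqY. field. lra.
Qed.

Lemma mode_good n m : good (mode n m).
Proof.
  split; [apply mode_jcont|]. eexists; split; [apply mode_dy|]. apply jcont_mult; [apply jcont_const | apply mode_jcont].
Qed.

Lemma mode_eigen n m : eigenspace (lattice A B) (lamq A B n m) (mode n m).
Proof.
  split; [apply mode_smooth|]. split; [apply per_iff, mode_per|].
  exists (fun p => RtoC (- freqX n) * Ci * mode n m p)%C, (fun p => RtoC (- freqY A B n m) * Ci * mode n m p)%C,
    (fun p => RtoC (- freqX n) * Ci * (RtoC (- freqX n) * Ci * mode n m p))%C,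
    (fun p => RtoC (- freqY A B n m) * Ci * (RtoC (- freqY A B n m) * Ci * mode n m p))%C.
  split; [apply partial_x_dx, mode_dx|]. split; [apply partial_x_dx, dx_Cmult, mode_dx|].
  split; [apply partial_y_dy, mode_dy|]. split; [apply partial_y_dy, dy_Cmult, mode_dy|].
  intros p. rewrite <- (freq_lamq A B hB n m).
  assert (i2 : (Ci * Ci)%C = (- (1))%C) by (apply Ceq; simpl; ring).
  set (a := freqX n). set (b := freqY A B n m). set (X := mode n m p).
  replace (- (RtoC (- a) * Ci * (RtoC (- a) * Ci * X) + RtoC (- b) * Ci * (RtoC (- b) * Ci * X)))%C
    with (- (Ci * Ci) * (RtoC a * RtoC a + RtoC b * RtoC b) * X)%C by (rewrite !RtoC_opp; ring).
  rewrite i2, RtoC_plus, !RtoC_pow. ring.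
Qed.

(** If the first indices differ, the integral in [x] vanishes for every [y]. If they agree, the
    shifts [n A] cancel in the difference of frequencies, and the integral in [y] runs over whole
    periods. *)
Lemma Lcoef_mode_neq n m n' m' : (n, m) <> (n', m') -> Lcoef A B n m (mode n' m') = 0%C.
Proof.
  intros hne. unfold Lcoef. pose proof PI_RGT_0.
  assert (e : forall y, coefX (freqX n) (mode n' m') y = (cis (- freqY A B n' m' * y) * CInt (fun x => cis ((2 * PI * IZR (n' - n)) * x)) 0 1)%C).
  { intros y. unfold coefX. rewrite <- CInt_Cmult by (intros; apply Ccont_cis). apply CInt_ext. intros x _. unfold mode; simpl.
    replace (2 * PI * IZR (n' - n) * x) with (- freqX n' * x + freqX n * x) by (rewrite minus_IZR; unfold freqX; ring).
    rewrite !cis_plus. ring. }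
  destruct (Z.eq_dec n n') as [<-|hn].
  - assert (hm : m <> m') by congruence.
    assert (f1 : forall y, coefX (freqX n) (mode n m') y = cis (- freqY A B n m' * y)).
    { intros y. rewrite e. rewrite Z.sub_diag, (CInt_ext _ (fun _ => 1%C)), CInt_const; [ring|]. intros; rewrite Rmult_0_r, Rmult_0_l. apply cis_0. }
    rewrite (CInt_ext _ (fun y => cis ((2 * PI * IZR (m' - m) / B) * y))).
    + apply CInt_cis_0.
      * assert (IZR (m' - m) <> 0) by (apply not_0_IZR; lia). unfold Rdiv. apply Rmult_integral_contrapositive_currified; [|apply Rinv_neq_0_compat; lra].
        apply Rmult_integral_contrapositive_currified; [lra | assumption].
      * replace (2 * PI * IZR (m' - m) / B * B) with (2 * PI * IZR (m' - m)) by (field; lra). apply cis_Z.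
    + intros y _. rewrite f1, <- cis_plus. f_equal. unfold freqY. rewrite minus_IZR. field. lra.
  - rewrite (CInt_ext _ (fun _ => 0%C)), CInt_const; [ring|]. intros y _. rewrite e, CInt_cis_0; [ring | |].
    + assert (IZR (n' - n) <> 0) by (apply not_0_IZR; lia). apply Rmult_integral_contrapositive_currified; [lra | assumption].
    + rewrite Rmult_1_r. apply cis_Z.
Qed.

Lemma Lcoef_mode_eq n m : Lcoef A B n m (mode n m) = RtoC B.
Proof.
  unfold Lcoef. rewrite (CInt_ext _ (fun _ => 1%C)), CInt_const; [ring|]. intros y _.
  unfold coefX. rewrite (CInt_ext _ (fun _ => cis (- freqY A B n m * y))), CInt_const.
  - replace (- freqY A B n m * y) with (- (freqY A B n m * y)) by ring. pose proof (cis_opp (freqY A B n m * y)) as q.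
    transitivity (cis (freqY A B n m * y) * cis (- (freqY A B n m * y)))%C; [ring | exact q].
  - intros x _. unfold mode; simpl. rewrite cis_plus. pose proof (cis_opp (freqX n * x)) as q.
    replace (- freqX n * x) with (- (freqX n * x)) by ring.
    transitivity (cis (freqX n * x) * cis (- (freqX n * x)) * cis (- freqY A B n m * y))%C; [ring | rewrite q; ring].
Qed.

Definition mode_at (k : nat) : R * R -> C := mode (zz (fst (Cantor.of_nat k))) (zz (snd (Cantor.of_nat k))).
Definition Lcoef_at (k : nat) : (R * R -> C) -> C := Lcoef A B (zz (fst (Cantor.of_nat k))) (zz (snd (Cantor.of_nat k))).

Lemma Lcoef_mode_at k k' : Lcoef_at k (mode_at k') = if Nat.eq_dec k k' then RtoC B else 0%C.
Proof.
  unfold Lcoef_at, mode_at. destruct (Nat.eq_dec k k') as [->|hne]; [apply Lcoef_mode_eq|]. apply Lcoef_mode_neq. intros e. apply hne.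
  inversion e as [[e1 e2]]. apply zz_inj in e1, e2.
  rewrite <- (cancel_to_of k), <- (cancel_to_of k'). f_equal. apply injective_projections; assumption.
Qed.

Lemma index_bound i x : Rabs (IZR (zz i)) <= x -> INR i <= 2 * x + 2.
Proof.
  intros h. destruct (nat_cases i) as [->|[[j ->]|[j ->]]].
  - simpl. pose proof (Rabs_pos (IZR (zz 0))). lra.
  - rewrite zz_odd, <- INR_IZR_INZ, Rabs_pos_eq in h by apply pos_INR. rewrite plus_INR, mult_INR. rewrite S_INR in h. simpl. lra.
  - rewrite zz_even, opp_IZR, Rabs_Ropp, <- INR_IZR_INZ, Rabs_pos_eq in h by apply pos_INR. rewrite plus_INR, mult_INR. rewrite S_INR in h. simpl. lra.
Qed.

Lemma sqr_le_abs x q : x ^ 2 <= q -> Rabs x <= q + 1.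
Proof.
  intros h. rewrite <- (pow2_abs x) in h. pose proof (Rabs_pos x). pose proof (pow2_ge_0 (Rabs x - 1)). nra.
Qed.

(** Both summands of the eigenvalue are non-negative, so [n] is bounded first, then [m - n A], then
    [m]. The crude [|x| <= q + 1] for [x^2 <= q] replaces square roots. *)
Lemma lam_finite mu : exists K, forall k, lam A B k = mu -> (k < K)%nat.
Proof.
  pose proof PI2_pos as hpi. pose proof (pow_lt B 2 hB) as hB2.
  set (q := Rabs (mu / (4 * PI ^ 2))). set (q2 := B ^ 2 * q).
  assert (hq : 0 <= q) by apply Rabs_pos. assert (hq2 : 0 <= q2) by (apply Rmult_le_pos; lra).
  destruct (exists_nat_ge (2 * (q + 1) + 2)) as [I hI].
  destruct (exists_nat_ge (2 * (q2 + 1 + (q + 1) * Rabs A) + 2)) as [J0 hJ0].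
  assert (hK : forall l : list (nat * nat), exists K, forall p, In p l -> (Cantor.to_nat p < K)%nat).
  { induction l as [|x t IHt]; [exists 0%nat; intros p []|]. destruct IHt as [K hK].
    exists (max (S (Cantor.to_nat x)) K). intros p [e|e]; [subst; lia | specialize (hK p e); lia]. }
  destruct (hK (list_prod (seq 0 (S I)) (seq 0 (S J0)))) as [K hK']. exists K. intros k hk.
  rewrite <- (cancel_to_of k). apply hK'. unfold lam, lamq in hk. destruct (Cantor.of_nat k) as [i j]. cbn [fst snd] in hk.
  set (n := IZR (zz i)) in *. set (m := IZR (zz j)) in *.
  assert (e : n ^ 2 + (m - n * A) ^ 2 / B ^ 2 = mu / (4 * PI ^ 2)) by (rewrite <- hk; field; split; [lra | apply PI_neq0]).
  assert (h0 : 0 <= (m - n * A) ^ 2 / B ^ 2) by (apply Rmult_le_pos; [apply pow2_ge_0 | left; apply Rinv_0_lt_compat, hB2]).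
  pose proof (Rle_abs (mu / (4 * PI ^ 2))) as ha. fold q in ha. pose proof (pow2_ge_0 n).
  assert (hn : Rabs n <= q + 1) by (apply sqr_le_abs; lra).
  assert (hm : Rabs (m - n * A) <= q2 + 1).
  { apply sqr_le_abs. replace ((m - n * A) ^ 2) with (B ^ 2 * ((m - n * A) ^ 2 / B ^ 2)) by (field; lra). apply Rmult_le_compat_l; lra. }
  assert (hm2 : Rabs m <= q2 + 1 + (q + 1) * Rabs A).
  { replace m with ((m - n * A) + n * A) by ring. eapply Rle_trans; [apply Rabs_triang|]. rewrite Rabs_mult. pose proof (Rabs_pos A).
    assert (Rabs n * Rabs A <= (q + 1) * Rabs A) by (apply Rmult_le_compat_r; assumption). lra. }
  apply in_prod_iff. rewrite !in_seq.
  pose proof (index_bound i _ hn) as b1. pose proof (index_bound j _ hm2) as b2.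
  assert ((i <= I)%nat) by (apply INR_le; lra). assert ((j <= J0)%nat) by (apply INR_le; lra). lia.
Qed.

(** The modes with eigenvalue [mu] form a basis of the eigenspace. For an eigenfunction [f], the
    difference between [f] and its expansion has only zero coefficients: at listed indices by the
    choice of [c], at all others by [eigen_coef]. A value [mu] that is not attained gives the empty
    list and dimension [0]. *)
Lemma torus_spectrum : is_spectrum (lattice A B) (lam A B).
Proof.
  intros mu. destruct (lam_finite mu) as [K hK].
  set (l := filter (fun k => if Req_EM_T (lam A B k) mu then true else false) (seq 0 K)).
  assert (hnd : NoDup l) by (apply NoDup_filter, seq_NoDup).
  assert (hin : forall k, In k l <-> lam A B k = mu).
  { intros k. unfold l. rewrite filter_In, in_seq. destruct (Req_EM_T (lam A B k) mu) as [q|q]; split; intros h; try tauto.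
    - split; [specialize (hK k q); lia | reflexivity].
    - destruct h; discriminate. }
  exists l. split; [assumption|]. split; [assumption|].
  (* Basis vectors are numbered from [1], list positions from [0]. *)
  exists (fun i => mode_at (nth (i - 1) l 0%nat)). split; [|split].
  - intros i hi. assert (q : lam A B (nth (i - 1) l 0%nat) = mu) by (apply hin, nth_In; lia).
    rewrite <- q. apply mode_eigen.
  (* The coefficient of a mode with itself is [B], not [1], hence the factor [/ B]. *)
  - intros f hf. set (c := fun i => (Lcoef_at (nth (i - 1) l 0%nat) f * RtoC (/ B))%C). exists c.
    pose proof hf as (hs & hp & _). apply per_iff in hp.
    set (S1 := fun p => csum (fun i => c (S i) * mode_at (nth i l 0%nat) p)%C (length l)).
    assert (gf : good f).
    { destruct (smooth_partials f hs) as (_ & fy & _ & d & _ & s). split; [apply smooth_jcont, hs|]. exists fy. split; [assumption | apply smooth_jcont, s]. }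
    assert (gS : good S1) by (apply (good_csum (fun i => mode_at (nth i l 0%nat)) (fun i => c (S i))); intros; apply mode_good).
    assert (pS : per A B S1) by (apply (per_csum (fun i => mode_at (nth i l 0%nat)) (fun i => c (S i))); intros; apply mode_per).
    pose proof (good_lin f S1 1 (- (1)) gf gS) as gg. pose proof (per_lin f S1 1 (- (1)) hp pS) as pg.
    assert (z : forall p, (1 * f p + - (1) * S1 p)%C = 0%C).
    { destruct gg as (g1 & gy & g2 & g3). apply (Lcoef_unique A B hB _ gy pg g1 g2 g3).
      intros n m. destruct (zz_surj n) as [a ea], (zz_surj m) as [b eb].
      set (k := Cantor.to_nat (a, b)). assert (ek : forall g, Lcoef A B n m g = Lcoef_at k g).
      { intros g. unfold Lcoef_at, k. rewrite cancel_of_to. cbn [fst snd]. rewrite ea, eb. reflexivity. }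
      rewrite Lcoef_lin by assumption. unfold S1.
      rewrite (Lcoef_csum n m (fun i => mode_at (nth i l 0%nat)) (fun i => c (S i))) by (intros; apply mode_good).
      rewrite (csum_ext _ (fun i => c (S i) * (if Nat.eq_dec k (nth i l 0%nat) then RtoC B else 0))%C) by (intros; rewrite ek, Lcoef_mode_at; reflexivity).
      destruct (Req_EM_T (lam A B k) mu) as [q|q].
      - apply hin in q. destruct (In_nth l k 0%nat q) as (j & hj & ej).
        match goal with |- context [csum ?F (length l)] => rewrite (csum_single F (length l) j hj) end.
        + destruct (Nat.eq_dec k (nth j l 0%nat)); [|congruence]. unfold c. simpl (S j - 1)%nat. rewrite Nat.sub_0_r, ej, ek.
          replace (Lcoef_at k f * RtoC (/ B) * RtoC B)%C with (Lcoef_at k f * (RtoC (/ B) * RtoC B))%C by ring. rewrite <- RtoC_mult, Rinv_l by lra. ring.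
        + intros i hi hij. destruct (Nat.eq_dec k (nth i l 0%nat)) as [w|w]; [|ring]. exfalso. apply hij.
          apply (proj1 (NoDup_nth l 0%nat) hnd); congruence.
      - match goal with |- context [csum ?F (length l)] => rewrite (csum_zero F (length l)) end.
        + rewrite (eigen_coef A B hB mu f n m hf); [ring|]. intros w. apply q. rewrite w. unfold lam, k. rewrite cancel_of_to. cbn [fst snd]. rewrite ea, eb. reflexivity.
        + intros i hi. destruct (Nat.eq_dec k (nth i l 0%nat)) as [w|w]; [|ring]. exfalso. apply q, hin. rewrite w. apply nth_In, hi. }
    intros p. rewrite sum_n_m_csum.
    rewrite (csum_ext _ (fun i => c (S i) * mode_at (nth i l 0%nat) p)%C) by (intros; simpl (S k - 1)%nat; rewrite Nat.sub_0_r; reflexivity).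
    specialize (z p). unfold S1 in z. set (T := csum _ _) in *.
    replace (f p) with ((1 * f p + - (1) * T) + T)%C by ring. rewrite z. ring.
  - intros c h i hi.
    assert (h' : (fun p => csum (fun i => c (S i) * mode_at (nth i l 0%nat) p)%C (length l)) = (fun _ => 0%C)).
    { apply functional_extensionality. intros p. rewrite <- (h p), sum_n_m_csum. apply csum_ext. intros j _. simpl (S j - 1)%nat. rewrite Nat.sub_0_r. reflexivity. }
    set (k := nth (i - 1) l 0%nat).
    assert (e : Lcoef_at k (fun p => csum (fun i => c (S i) * mode_at (nth i l 0%nat) p)%C (length l)) = 0%C).
    { transitivity (Lcoef_at k (fun _ => 0%C)); [exact (f_equal (Lcoef_at k) h') | unfold Lcoef_at; apply Lcoef_zero]. }
    unfold Lcoef_at in e. rewrite (Lcoef_csum _ _ (fun i => mode_at (nth i l 0%nat)) (fun i => c (S i))) in e by (intros; apply mode_good).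
    rewrite (csum_ext _ (fun j => c (S j) * (if Nat.eq_dec k (nth j l 0%nat) then RtoC B else 0))%C) in e by (intros; fold (Lcoef_at k (mode_at (nth k0 l 0%nat))); rewrite Lcoef_mode_at; reflexivity).
    match type of e with context [csum ?F (length l)] => rewrite (csum_single F (length l) (i - 1)) in e end; [|lia|].
    2:{ intros j hj hne. destruct (Nat.eq_dec k (nth j l 0%nat)) as [w|w]; [exfalso; apply hne | ring].
        apply (proj1 (NoDup_nth l 0%nat) hnd); [assumption | lia | unfold k in w; congruence]. }
    destruct (Nat.eq_dec k (nth (i - 1) l 0%nat)) as [_|w]; [|exfalso; apply w; reflexivity].
    replace (S (i - 1)) with i in e by lia.
    replace (c i) with (c i * RtoC B * RtoC (/ B))%C.
    + rewrite e. ring.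
    + rewrite <- Cmult_assoc, <- RtoC_mult, Rinv_r by lra. ring.
Qed.
End Spectrum.

Theorem theorem7p3 (A B : R) (hB : 0 < B) :
  exists P : R,
    is_inf_prod
      (fun n : nat =>
         Cmod (1 - Cexp (- (2 * PI * INR n)%R * (RtoC B - Ci * RtoC A)))%C ^ 4) P /\
    is_Det_Laplacian (lattice A B)
      (RtoC (B ^ 2 * exp (- (PI * B / 3)) * P)).
Proof.
  exact (det_of_spectrum A B hB (torus_spectrum A B hB)).
Qed.
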